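(* Let $c$ be a radial cost, and let $\mu,\nu\in\mathcal M_+(\Omega)$ satisfy $\mu\ll\mathcal L$ and $\nu=\sum_{i=1}^M m_i\delta_{x_i}$ with $m_i>0$, $x_i\in\Omega$ and $x_i\neq x_j$ for $i\neq j$. Define $\mathcal G:\mathbb R^M\to(-\infty,\infty]$ by $$\mathcal G(w)=-\sum_{i=1}^M\left(\int_{C_i(w)}F^*\big(-c(x,x_i)+w_i\big)\,\mathrm d\mu(x)+F^*(-w_i)\cdot m_i\right)+F(0)\cdot\mu(R),$$ with the convention $\infty\cdot 0=0$. Then $$W(\mu,\nu)=\sup\{\mathcal G(w)\mid w\in\mathbb R^M\},$$ and this is a concave maximization problem (i.e. $\mathcal G$ is a concave function on $\mathbb R^M$).
   Context: $\Omega=\overline U\subset\mathbb R^d$ with $U$ open; $d(\cdot,\cdot)$ is the Euclidean distance; $\mathcal L$ is the $d$-dimensional Lebesgue measure; $\mathcal M_+(X)$ is the set of finite nonnegative Radon measures on $X$; $\pi_1,\pi_2:\Omega\times\Omega\to\Omega$ are the coordinate projections and $T_\#\mu$ denotes pushforward. Marginal discrepancy: $F:[0,\infty)\to[0,\infty]$ is proper, convex, lower semi-continuous with $\lim_{s\to\infty}F(s)/s=\infty$. For $\rho,\mu\in\mathcal M_+(\Omega)$ set $\mathcal F(\rho|\mu)=\int_\Omega F\big(\tfrac{\mathrm d\rho}{\mathrm d\mu}\big)\,\mathrm d\mu$ if $\rho\ll\mu$ and $\mathcal F(\rho|\mu)=+\infty$ otherwise. $F$ is extended by $F(s)=\infty$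 for $s<0$, and $F^*(z)=\sup_{s\ge0}(z s-F(s))$, $z\in\mathbb R$. Cost: $c:\Omega\times\Omega\to[0,\infty]$ is lower semi-continuous. It is called radial if $c(x,y)=\ell(d(x,y))$ for a nondecreasing function $\ell:[0,\infty)\to[0,\infty]$ with $\ell(0)=0$ that is strictly increasing and continuous on its domain $\{\ell<\infty\}$. Unbalanced transport: $W(\mu,\nu)=\inf\{\mathcal E(\gamma)\mid\gamma\in\mathcal M_+(\Omega\times\Omega)\}$, where $\mathcal E(\gamma)=\int_{\Omega\times\Omega}c\,\mathrm d\gamma+\mathcal F(\pi_{1\#}\gamma|\mu)+\mathcal F(\pi_{2\#}\gamma|\nu)$. Generalized Laguerre cells for $x_1,\dots,x_M\in\Omega$ and $w\in\mathbb R^M$: $C_i(w)=\{x\in\Omega\mid c(x,x_i)<\infty,\ c(x,x_i)-w_i\le c(x,x_j)-w_j\text{ for all }j\in\{1,\dots,M\}\}$. Residual set: $R=\{x\in\Omega\mid c(x,x_i)=\infty\text{ for all }i\in\{1,\dots,M\}\}$.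
   Formalization: For d=1 the claim can fail (e.g. c=|x-y|, where two cells may overlap on a half-line and are counted twice); the formal theorem adds, for d=1 only, that C_i(w)∩C_j(w) is Lebesgue-null for all w and i≠j; nothing is added for d≥2. *)

(* Defs.v *)
From HB Require Import structures.
From mathcomp Require Import all_boot all_order all_algebra.
From mathcomp Require Import all_classical all_reals all_analysis measurable_realfun.

Set Implicit Arguments.
Unset Strict Implicit.
Unset Printing Implicit Defensive.

Import Order.TTheory GRing.Theory Num.Theory.
Import numFieldNormedType.Exports.

Local Open Scope classical_set_scope.
Local Open Scope ring_scope.

(* The library topology of 'rV[R]_d comes from the sup norm; it coincides with
   the Euclidean topology.  The sigma-algebra is the Borel one. *)
Section borel_rV.
Context (R : realType) (d : nat).

Definition borel_rV : set (set 'rV[R]_d) := <<s @open 'rV[R]_d >>.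

Let borel_rV0 : borel_rV set0. Proof. exact: sigma_algebra0. Qed.

Let borel_rVC A : borel_rV A -> borel_rV (~` A).
Proof. exact: sigma_algebraC. Qed.

Let borel_rV_bigcup (A : (set 'rV[R]_d)^nat) :
  (forall i, borel_rV (A i)) -> borel_rV (\bigcup_i A i).
Proof. exact: sigma_algebra_bigcup. Qed.

HB.instance Definition _ := @isMeasurable.Build default_measure_display
  'rV[R]_d borel_rV borel_rV0 borel_rVC borel_rV_bigcup.

End borel_rV.

Definition edist (R : realType) (d : nat) (x y : 'rV[R]_d) : R :=
  Num.sqrt (\sum_(i < d) (x 0 i - y 0 i) ^+ 2).

(* d-dimensional Lebesgue measure by Cavalieri's principle, as an iterated
   integral: R^(d+1) is R x R^d through row_mx, and R^0 is a point of mass 1.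
   Only its values on Borel sets are meaningful. *)
Fixpoint lebesgue_rV (R : realType) (d : nat) : set 'rV[R]_d -> \bar R :=
  match d with
  | 0 => fun A => \d_(0 : 'rV[R]_0) A
  | d'.+1 => fun A =>
      (\int[lebesgue_measure]_(t in [set: R])
         @lebesgue_rV R d'
           [set v : 'rV[R]_d' | A (row_mx (t%:M : 'rV[R]_1) v)])%E
  end.

Lemma lebesgue_rV0 (R : realType) d : @lebesgue_rV R d set0 = 0%E.
Proof.
elim: d => [|d IH] /=; first by rewrite measure0.
by apply: integral0_eq => t _; rewrite -[RHS]IH; congr lebesgue_rV.
Qed.

Lemma lebesgue_rV_box (R : realType) d (a b : 'rV[R]_d) :
  (forall i, a 0 i <= b 0 i) ->
  lebesgue_rV [set v | forall i, a 0 i <= v 0 i <= b 0 i] =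
  (\prod_(i < d) (b 0 i - a 0 i))%:E.
Proof.
elim: d a b => [|d IH] a b ab /=.
  by rewrite diracE mem_set ?big_ord0//= => -[].
pose r (v : 'rV[R]_d.+1) : 'rV[R]_d := \row_j v 0 (lift ord0 j).
have rE v j : r v 0 j = v 0 (lift ord0 j) by rewrite mxE.
have rab j : r a 0 j <= r b 0 j by rewrite !rE.
pose p := \prod_(i < d) (b 0 (lift ord0 i) - a 0 (lift ord0 i)).
have pE : lebesgue_rV [set v | forall i, r a 0 i <= v 0 i <= r b 0 i] = p%:E.
  by rewrite IH//; congr EFin; apply: eq_bigr => i _; rewrite !rE.
have rm0 (t : R) (v : 'rV[R]_d) : row_mx (t%:M : 'rV[R]_1) v 0 ord0 = t.
  have -> : ord0 = lshift d ord0 :> 'I_(1 + d) by apply: val_inj.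
  by rewrite row_mxEl mxE eqxx.
have rmS (t : R) (v : 'rV[R]_d) j :
    row_mx (t%:M : 'rV[R]_1) v 0 (lift ord0 j) = v 0 j.
  have -> : lift ord0 j = rshift 1 j :> 'I_(1 + d) by apply: val_inj.
  by rewrite row_mxEr.
rewrite big_ord_recl -/p.
transitivity (\int[lebesgue_measure]_(t in [set: R])
  ((p%:E) * (\1_`[a 0 ord0, b 0 ord0] t)%:E))%E.
  apply: eq_integral => t _; rewrite indicE.
  case: (boolP (t \in `[a 0 ord0, b 0 ord0])) => tab.
    rewrite (@mem_set _ `[a 0 ord0, b 0 ord0]%classic t)//= mule1 -pE; congr lebesgue_rV.
    apply/seteqP; split => v /= H i.
      by rewrite !rE; have := H (lift ord0 i); rewrite rmS.
    case: (unliftP ord0 i) => [j ->|->]; last by rewrite rm0; move: tab; rewrite in_itv.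
    by rewrite rmS; have := H j; rewrite !rE.
  rewrite memNset /=; last by move=> h; move: tab; rewrite h.
  rewrite mule0 -[RHS](lebesgue_rV0 R d); congr lebesgue_rV.
  apply/seteqP; split => v //= /(_ ord0); rewrite rm0 => h.
  by move: tab; rewrite in_itv/= h.
rewrite ge0_integralZl//=.
- rewrite integral_indic//= setIT lebesgue_measure_itv/= lte_fin.
  have := ab ord0; rewrite le_eqVlt => /predU1P[->|->].
    by rewrite ltxx subrr mul0r mule0.
  by rewrite -EFinD -EFinM mulrC.
- apply/measurable_EFinP; exact: measurable_indic.
- by rewrite lee_fin; apply: prodr_ge0 => i _; rewrite subr_ge0.
Qed.

(* The proof mf is an argument so that the finite-measure structure on the
   image is found by inference. *)
Section image_measure.
Context d1 d2 (T1 : measurableType d1) (T2 : measurableType d2) (R : realType).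
Variables (f : T1 -> T2) (mf : measurable_fun [set: T1] f).
Variable gam : {finite_measure set T1 -> \bar R}.

Definition image_measure & measurable_fun [set: T1] f : set T2 -> \bar R :=
  pushforward gam f.

Local Notation img := (image_measure mf).

Let img0 : img set0 = 0%E.
Proof. by rewrite /image_measure /pushforward preimage_set0 measure0. Qed.

Let img_ge0 A : (0 <= img A)%E. Proof. exact: measure_ge0. Qed.

Let img_sigma_additive : semi_sigma_additive img.
Proof.
exact: (@measure_semi_sigma_additive _ _ _
  (measure_function_pushforward__canonical__measure_function_Measure gam mf)).
Qed.

HB.instance Definition _ :=
  isMeasure.Build _ _ _ img img0 img_ge0 img_sigma_additive.

Let img_fin : fin_num_fun img.
Proof.
move=> A mA; apply: fin_num_measure; rewrite -[X in measurable X]setTI.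
exact: mf.
Qed.

HB.instance Definition _ := Measure_isFinite.Build _ _ _ img img_fin.

End image_measure.

(* For A closed, the finite (Radon) measures on A are represented by the finite
   Borel measures on the ambient space that vanish off A. *)
Definition concentrated_on d (T : measurableType d) (R : realType)
  (A : set T) (mu : set T -> \bar R) : Prop := mu (~` A) = 0%E.

Section entropy.
Context (R : realType).
Implicit Type F : R -> \bar R.
Local Open Scope ereal_scope.

Definition proper_fun F := exists2 s : R, (0 <= s)%R & F s < +oo.

Definition ereal_convex (V : lmodType R) (f : V -> \bar R) :=
  forall (t : R) (a b : V), (0 <= t <= 1)%R ->
    f (t *: a + (1 - t) *: b)%R <= t%:E * f a + (1 - t)%:E * f b.

Definition ereal_concave (V : lmodType R) (f : V -> \bar R) :=
  forall (t : R) (a b : V), (0 <= t <= 1)%R ->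
    t%:E * f a + (1 - t)%:E * f b <= f (t *: a + (1 - t) *: b)%R.

(* F : [0, +oo[ -> [0, +oo] is given by its extension by +oo to the line. *)
Record marginal_entropy F : Prop := MarginalEntropy {
  entropy_ge0 : forall s, 0 <= F s;
  entropy_neg : forall s : R, (s < 0)%R -> F s = +oo;
  entropy_proper : proper_fun F;
  entropy_convex : ereal_convex (F : R^o -> \bar R);
  entropy_lsc : lower_semicontinuous F;
  entropy_superlinear : F s * (s^-1)%:E @[s --> +oo%R] --> +oo }.

Definition conjugate F (z : R) : \bar R :=
  ereal_sup [set (z * s)%:E - F s | s in [set s : R | (0 <= s)%R]].

End entropy.

Section discrepancy.
Context d (T : measurableType d) (R : realType).
Local Open Scope ereal_scope.
Local Open Scope charge_scope.

Definition discrepancy (F : R -> \bar R) (Omega : set T)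
    (rho mu : {finite_measure set T -> \bar R}) : \bar R :=
  if `[< rho `<< mu >] then
    \int[mu]_(x in Omega)
      F (fine (('d (charge_of_finite_measure rho) '/d mu) x))
  else +oo.

End discrepancy.

Section transport.
Context (R : realType) (d : nat).
Local Notation V := 'rV[R]_d.
Local Open Scope ereal_scope.
Variables (Omega : set V) (c : V -> V -> \bar R).

Definition cost : Prop :=
  (forall x y, Omega x -> Omega y -> 0 <= c x y) /\
  lower_semicontinuous
    ((fun p => c p.1 p.2) : subspace (Omega `*` Omega) -> \bar R).

Record radial_profile (l : R -> \bar R) : Prop := RadialProfile {
  profile_ge0 : forall r : R, (0 <= r)%R -> 0 <= l r;
  profile0 : l 0%R = 0;
  profile_nondecreasing : forall r s : R, (0 <= r <= s)%R -> l r <= l s;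
  profile_increasing : forall r s : R,
    (0 <= r < s)%R -> l s < +oo -> l r < l s;
  profile_continuous :
    {within [set r : R | (0 <= r)%R /\ l r < +oo], continuous l} }.

Definition radial : Prop :=
  exists2 l : R -> \bar R, radial_profile l &
    forall x y, Omega x -> Omega y -> c x y = l (edist x y).

Variable F : R -> \bar R.

Definition energy (mu nu : {finite_measure set V -> \bar R})
    (gam : {finite_measure set (V * V)%type -> \bar R}) : \bar R :=
  \int[gam]_(p in Omega `*` Omega) c p.1 p.2
  + discrepancy F Omega (image_measure gam measurable_fst) mu
  + discrepancy F Omega (image_measure gam measurable_snd) nu.

Definition unbalanced_transport
    (mu nu : {finite_measure set V -> \bar R}) : \bar R :=
  ereal_inf [set energy mu nu gam | gam in
    [set gam : {finite_measure set (V * V)%type -> \bar R} |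
      concentrated_on (Omega `*` Omega) gam]].

Variables (M : nat) (xs : 'I_M -> V).

Definition laguerre_cell (w : 'rV[R]_M) (i : 'I_M) : set V :=
  [set x | [/\ Omega x, c x (xs i) < +oo &
    forall j, c x (xs i) - (w 0%R i)%:E <= c x (xs j) - (w 0%R j)%:E]].

Definition residual_set : set V :=
  [set x | Omega x /\ forall i, c x (xs i) = +oo].

(* [fine] is harmless: c x (xs i) is finite on the i-th cell. *)
Definition dual_objective (m : 'I_M -> R)
    (mu : {finite_measure set V -> \bar R}) (w : 'rV[R]_M) : \bar R :=
  - (\sum_(i < M)
       (\int[mu]_(x in laguerre_cell w i)
          conjugate F (- fine (c x (xs i)) + w 0%R i)%R
        + conjugate F (- w 0%R i)%R * (m i)%:E))
  + F 0%R * mu residual_set.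

End transport.

(* Main.v *)
Require Import Defs.
From HB Require Import structures.
From mathcomp Require Import all_boot all_order all_algebra.
From mathcomp Require Import all_classical all_reals all_analysis.
From mathcomp Require Import measurable_realfun ring lra.

Set Implicit Arguments.
Unset Strict Implicit.
Unset Printing Implicit Defensive.

Import Order.TTheory GRing.Theory Num.Theory.
Import numFieldNormedType.Exports.

Local Open Scope classical_set_scope.
Local Open Scope ring_scope.
Local Open Scope ereal_scope.

(** Every plan of finite energy has second marginal absolutely continuous with respect
    to the atomic measure [nu] and first marginal absolutely continuous with
    respect to [mu], so it is a family of densities [g i] on [mu], one for each
    atom [xs i], and the transport problem becomes convex in [g] with
    [M] linear constraints identifying the mass of [g i] with the mass [p i]
    received by the atom. Weak duality is Young's inequality for [F], which is an
    equality for the densities supported on the cells; hence the dual function is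
    an infimum of functions affine in [w], and it is concave. For strong duality,
    penalize the constraints by [kappa / 2 * |mass g - p| ^ 2]: comparing a near
    minimizer with the best reply to [w = kappa * (p - mass g)] bounds the
    penalized infimum by the dual supremum. As [kappa] grows this gives a
    minimizing sequence, and choosing each term near the minimum of the strictly
    convex functional [sum_i \int (1 + g i)^-1] among near optimal pairs makes the
    transforms [(1 + g i)^-1] converge, so that Fatou's lemma and the
    superlinearity of [F] give a minimizer in the limit.

    The boundary between two cells is null because on it [l (|x - xs i|) - w i =
    l (|x - xs j|) - w j], so that [|x - xs i|] determines [(xs i - xs j) . x]. After
    slicing along coordinates, down to the plane if necessary, such a set meets the
    hyperplanes [x_1 = t] in preimages, under the squared distance to a point, of
    pairwise disjoint subsets of the line; all but countably many of these subsets
    are null, and so are their preimages. *)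

(** * Marginal entropies and their conjugates *)

(** Infinite values shape the argument. Superlinearity makes F^* real valued and its supremum
    attained, but [F 0] may be +oo; then F^* tends to -oo at -oo, integrals over cells may be -oo
    and the dual value +oo. On cell i the argument of F^* is at most [w i], so F^* is bounded above
    there; adding a constant b gives a nonnegative [potential], whose integral always makes sense,
    and b cancels after integration.

    No minimax theorem is invoked. The masses p are kept apart from those of the densities, so the
    reply to any w competes in the penalized problem although it violates the constraint, and its
    cost is known exactly from the dual value.

    The cost controls densities only in L^1. The bounded transforms live in L^2, where midpoint
    convexity gives a Cauchy estimate as for projections onto convex sets of a Hilbert space.

    For the cell boundaries, an exceptional set of slices is required to be countable rather than
    null: a function vanishing off a countable set is Borel, so the masses of the slices need no
    measurability proof. This is why disjointness of level sets drives that part. *)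

Section entropy.
Context (R : realType) (F : R -> \bar R).
Hypothesis FE : marginal_entropy F.

Lemma entropy_measurable : measurable_fun setT F.
Proof. by apply: lower_semicontinuous_measurable; exact: entropy_lsc FE. Qed.

(** Superlinearity as an affine minorant of any slope: slope z + 1 gives attainment in F^*, slope 1
    an L^1 bound, a large slope uniform integrability. *)
Lemma entropy_superlinear_bound (a : R) :
  exists2 C : R, (0 <= C)%R & forall s, (0 <= s)%R -> (a * s - C)%:E <= F s.
Proof.
have [L [_ HL]] := cvgey_ge (entropy_superlinear FE) a.
pose L' := Num.max L 1%R.
have L'0 : (0 < L')%R by rewrite lt_max ltr01 orbT.
exists (`|a| * L')%R; first by rewrite mulr_ge0// ltW.
move=> s s0; have [sL|sL] := ltP L' s; last first.
  apply: (le_trans _ (entropy_ge0 FE s)); rewrite lee_fin subr_le0.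
  by apply: (le_trans (ler_norm _)); rewrite normrM (ger0_norm s0) ler_wpM2l.
have {}s0 : (0 < s)%R by rewrite (lt_trans L'0).
have /HL : (L < s)%R by apply: le_lt_trans sL; rewrite le_max lexx.
rewrite lee_pdivlMr// => h; apply: le_trans h.
by rewrite -EFinM lee_fin gerBl mulr_ge0// ltW.
Qed.

(** The minorant of slope z + 1 gives z s - F s <= C - s, so only a compact interval matters, and
    there lower semicontinuity of F yields a maximizer. If there were none, compactness would keep z
    s - F s below the supremum by a uniform 1 / (N + 1). *)
Lemma conjugate_attained (z : R) :
  exists s : R, [/\ (0 <= s)%R, F s < +oo & conjugate F z = (z * s)%:E - F s].
Proof.
have [C C0 FC] := entropy_superlinear_bound (z + 1).
have [s0 s00 Fs0] := entropy_proper FE.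
have Ffin s : F s < +oo -> F s = (fine (F s))%:E.
  by move=> h; rewrite fineK// ge0_fin_numE// (entropy_ge0 FE).
have ubC s : (0 <= s)%R -> (z * s)%:E - F s <= (C - s)%:E.
  move=> s_ge0; have := FC _ s_ge0; have := entropy_ge0 FE s.
  case: (F s) => //= r _; first by rewrite -EFinB !lee_fin; lra.
  by rewrite leNye.
have cfin : conjugate F z \is a fin_num.
  rewrite fin_real//; apply/andP; split.
    apply: (@lt_le_trans _ _ ((z * s0)%:E - F s0)).
      by rewrite (Ffin _ Fs0) -EFinB ltNyr.
    by apply: ereal_sup_ubound; exists s0.
  apply: (@le_lt_trans _ _ C%:E); last exact: ltry.
  apply: ge_ereal_sup => _ [s /= s_ge0 <-].
  by apply: (le_trans (ubC _ s_ge0)); rewrite lee_fin gerBl.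
pose v := fine (conjugate F z).
have vE : conjugate F z = v%:E by rewrite fineK.
have vub s : (0 <= s)%R -> (z * s - v)%:E <= F s.
  move=> s_ge0; have : (z * s)%:E - F s <= v%:E.
    by rewrite -vE; apply: ereal_sup_ubound; exists s.
  have := entropy_ge0 FE s; case: (F s) => //= r; last by rewrite leey.
  by rewrite -EFinB !lee_fin; lra.
rewrite vE; apply: contrapT => noattain.
have vlt s : (0 <= s)%R -> (z * s - v)%:E < F s.
  move=> s_ge0; rewrite lt_neqAle vub// andbT; apply/eqP => h.
  by apply: noattain; exists s; split=> //; rewrite -h ?ltry// -EFinB; congr EFin; lra.
(* Beyond L the value z s - F s is at most C - s < v - 1, which lies below v - 1 / (N + 1) for every
   N. *)
pose L := (C - v + 1)%R.
have cK := @segment_compact R 0%R L.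
move/compact_near_coveringP : cK => cK.
have : \forall n \near \oo, `[0%R, L]%classic `<=`
    [set s : R | (z * s - v + n.+1%:R^-1)%:E < F s].
  apply: (cK _ _ (fun n s => (z * s - v + n.+1%:R^-1)%:E < F s)) => x.
  rewrite /= in_itv/= => /andP[x0 _].
  have [dl dl0 hd] : exists2 dl : R, (0 < dl)%R & (z * x - v + 3 * dl)%:E < F x.
    have := vlt _ x0; case: (F x) => [r|_|//]; last by exists 1%R => //; rewrite ltry.
    rewrite lte_fin => h; exists ((r - (z * x - v)) / 4)%R; first by lra.
    by rewrite lte_fin; lra.
  have [W Wx HW] := entropy_lsc FE hd.
  have cz : (z * y)%R @[y --> x] --> (z * x)%R by apply: cvgMr; exact: cvg_id.
  near=> y n => /=.
  have Fy : (z * x - v + 3 * dl)%:E < F y by apply: HW; near: y.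
  apply: le_lt_trans Fy; rewrite lee_fin.
  have h1 : (z * y < z * x + dl)%R.
    by near: y; apply: (cvgr_lt _ cz); lra.
  have h2 : (n.+1%:R^-1 < dl)%R by near: n; exact: near_infty_natSinv_lt (PosNum dl0).
  have aux (a b e u q : R) : (a < b + q)%R -> (e < q)%R -> (0 < q)%R ->
      (a - u + e <= b - u + 3 * q)%R by lra.
  exact: aux h1 h2 dl0.
move=> [N _ /(_ N (leqnn N)) HN].
have : (v - N.+1%:R^-1)%:E < conjugate F z by rewrite vE lte_fin ltrBlDr ltrDl invr_gt0.
move=> /ereal_sup_gt[_ [s /= s_ge0 <-]].
apply/negP; rewrite -leNgt.
have [sL|sL] := leP s L.
  have /HN/= : `[0%R, L]%classic s by rewrite /= in_itv/= s_ge0 sL.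
  case: (F s) => [r| _|//]; last by rewrite leNye.
  have aux (a e u q : R) : (a - u + e < q)%R -> (a - q <= u - e)%R by lra.
  by rewrite -EFinB lte_fin lee_fin; exact: aux.
apply: le_trans (ubC _ s_ge0) _; rewrite lee_fin.
have : (N.+1%:R^-1 <= 1 :> R)%R by rewrite invf_le1// ler1n.
by move: sL; rewrite /L; move: (N.+1%:R^-1)%R => e; lra.
Unshelve. all: by end_near. Qed.

(** A subgradient of F^* at z, picked by choice; [best_response_young] is the subgradient
    inequality. *)
Definition best_response z : R := sval (cid (conjugate_attained z)).
Definition conj_fin z : R := (z * best_response z - fine (F (best_response z)))%R.

Lemma best_response_ge0 z : (0 <= best_response z)%R.
Proof. by rewrite /best_response; case: cid => s []. Qed.

Lemma entropy_best_response z :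
  F (best_response z) = (z * best_response z - conj_fin z)%:E.
Proof.
rewrite /conj_fin opprB addrCA subrr addr0 fineK//.
rewrite ge0_fin_numE ?(entropy_ge0 FE)//.
by rewrite /best_response; case: cid => s [].
Qed.

Lemma conjugateE z : conjugate F z = (conj_fin z)%:E.
Proof.
have -> : conjugate F z = (z * best_response z)%:E - F (best_response z).
  by rewrite /best_response; case: cid => s [].
by rewrite entropy_best_response -EFinB; congr EFin; lra.
Qed.

Lemma young z s : (0 <= s)%R -> (z * s)%:E <= F s + (conj_fin z)%:E.
Proof.
move=> s0; have : (z * s)%:E - F s <= (conj_fin z)%:E.
  by rewrite -conjugateE; apply: ereal_sup_ubound; exists s.
have := entropy_ge0 FE s; case: (F s) => //= [r _|_ _]; last by rewrite addye ?leey.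
by rewrite -EFinB -EFinD !lee_fin; lra.
Qed.

Lemma best_response_young z z' :
  (z' * best_response z <= z * best_response z - conj_fin z + conj_fin z')%R.
Proof.
have := young z' (best_response_ge0 z).
by rewrite entropy_best_response -EFinD lee_fin.
Qed.

(** Subdifferentials are monotone: adding the subgradient inequalities at z and z' shows that any
    selection is nondecreasing. An arbitrary choice is therefore already Borel. *)
Lemma best_response_nd : {homo best_response : x y / (x <= y)%R}.
Proof.
move=> z z'; rewrite le_eqVlt => /predU1P[->//|zz'].
have h1 := best_response_young z z'; have h2 := best_response_young z' z.
rewrite leNgt; apply/negP => h.
have : (0 < (z' - z) * (best_response z - best_response z'))%R.
  by rewrite mulr_gt0 ?subr_gt0.
by rewrite mulrBr !mulrBl; lra.
Qed.

Lemma conj_fin_nd : {homo conj_fin : x y / (x <= y)%R}.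
Proof.
move=> z z' zz'; have h1 := best_response_young z z'.
have : (z * best_response z <= z' * best_response z)%R.
  by rewrite ler_wpM2r// best_response_ge0.
lra.
Qed.

Lemma best_response_measurable : measurable_fun setT best_response.
Proof. exact: nondecreasing_measurable best_response_nd. Qed.

Lemma conj_fin_measurable : measurable_fun setT conj_fin.
Proof. exact: nondecreasing_measurable conj_fin_nd. Qed.

End entropy.

(** * Integrals that may be infinite *)

Section integral_shift.
Context d (T : measurableType d) (R : realType).
Variable mu : {finite_measure set T -> \bar R}.

(** The integral of u may be -oo. It is traded for that of the nonnegative b - u, the difference
    being the finite number b * mu D. *)
Lemma integralN_bounded_above (D : set T) (u : T -> R) (b : R) :
  measurable D -> measurable_fun D u -> (0 <= b)%R ->
  (forall x, D x -> (u x <= b)%R) ->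
  - (\int[mu]_(x in D) (u x)%:E) =
  \int[mu]_(x in D) (b - u x)%:E - b%:E * mu D.
Proof.
move=> mD mfu b0 ub.
have muD : mu D \is a fin_num by exact: fin_num_measure.
have mb : measurable_fun D (fun x => (b - u x)%R) by exact: measurable_funB.
have eb x : D x -> 0 <= (b - u x)%:E by move=> Dx; rewrite lee_fin subr_ge0 ub.
have [Ify|] := ltP (\int[mu]_(x in D) (b - u x)%:E) +oo.
  have iv : mu.-integrable D (EFin \o (fun x => (b - u x)%R)).
    apply/integrableP; split; first exact/measurable_EFinP.
    by under eq_integral => x /[!inE] Dx do rewrite /= ger0_norm ?subr_ge0 ?ub//.
  have ib : mu.-integrable D (EFin \o cst b).
    exact: finite_measure_integrable_cst.
  rewrite (eq_integral (fun x => (EFin \o cst b) x - (b - u x)%:E)); last first.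
    by move=> x _; rewrite /= -EFinB; congr EFin; ring.
  rewrite integralB// (_ : \int[mu]_(x in D) (EFin \o cst b) x = b%:E * mu D); last first.
    exact: (integral_cst mu mD b%:E).
  by rewrite oppeB ?[- _ + _]addeC// fin_num_adde_defr// fin_numM.
rewrite leye_eq => /eqP Ify; rewrite Ify.
have up_fin : \int[mu]_(x in D) (EFin \o u)^\+ x < +oo.
  apply: (@le_lt_trans _ _ (\int[mu]_(x in D) (cst b%:E) x)).
    apply: ge0_le_integral => //.
      exact/measurable_funepos/measurable_EFinP.
    move=> x Dx; rewrite funeposE ge_max !lee_fin.
    by rewrite ub// b0.
  by rewrite integral_cst// ltey_eq fin_numM.
have un_y : \int[mu]_(x in D) (EFin \o u)^\- x = +oo.
  apply/eqP; rewrite -leye_eq -Ify leNgt; apply/negP => h.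
  have : \int[mu]_(x in D) (b - u x)%:E < +oo.
    apply: (@le_lt_trans _ _ (\int[mu]_(x in D) (b%:E + (EFin \o u)^\- x))).
      apply: ge0_le_integral => //.
      - exact/measurable_EFinP.
      - by apply: emeasurable_funD => //; exact/measurable_funeneg/measurable_EFinP.
      - move=> x Dx; rewrite EFinB leeD2l// funenegE le_max.
        by rewrite lexx.
    rewrite ge0_integralD//; last by exact/measurable_funeneg/measurable_EFinP.
    rewrite integral_cst// lte_add_pinfty//; first by rewrite ltey_eq fin_numM.
    by rewrite (lt_le_trans h)// leey.
  by rewrite Ify ltxx.
rewrite integralE un_y addeNy.
rewrite [- -oo]/= addye//; have : b%:E * mu D \is a fin_num by rewrite fin_numM.
by case: (b%:E * mu D).
Qed.

(** Only h may change sign, and it is integrable, while f1 and f2 may have infinite integrals. If f2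
    is integrable, then f1 <= f2 + |h| makes f1 integrable as well. *)
Lemma integral_shift_le (f1 f2 : T -> \bar R) (h : T -> R) :
  measurable_fun setT f1 -> measurable_fun setT f2 ->
  (forall x, 0 <= f1 x) -> (forall x, 0 <= f2 x) ->
  mu.-integrable setT (EFin \o h) ->
  (forall x, f1 x + (h x)%:E <= f2 x) ->
  \int[mu]_x f1 x + \int[mu]_x (h x)%:E <= \int[mu]_x f2 x.
Proof.
move=> mf1 mf2 f10 f20 ih f12.
have [f2y|] := ltP (\int[mu]_x f2 x) +oo; last first.
  by rewrite leye_eq => /eqP ->; rewrite leey.
have if2 : mu.-integrable setT f2.
  apply/integrableP; split=> //.
  by under eq_integral do rewrite gee0_abs//.
have if1 : mu.-integrable setT f1.
  apply: (@le_integrable _ _ _ _ _ measurableT _ (fun x => f2 x + `|(h x)%:E|)) => //.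
    move=> x _; rewrite gee0_abs// gee0_abs; last first.
      by rewrite adde_ge0.
    have := f12 x; have := f10 x; case: (f1 x) (f2 x) => [a||] [c||]//=; rewrite ?lee_fin.
    - by have := ler_norm (- h x); rewrite normrN; lra.
    - by move=> _ _; rewrite addye// leey.
  exact: integrableD if2 (integrable_abse ih).
rewrite -(integralD measurableT if1 ih); apply: le_integral => //.
exact: integrableD.
Qed.

Lemma integral_shift_eq (f1 f2 : T -> \bar R) (h : T -> R) :
  measurable_fun setT f1 -> measurable_fun setT f2 ->
  (forall x, 0 <= f1 x) -> (forall x, 0 <= f2 x) ->
  mu.-integrable setT (EFin \o h) ->
  (forall x, f1 x + (h x)%:E = f2 x) ->
  \int[mu]_x f1 x + \int[mu]_x (h x)%:E = \int[mu]_x f2 x.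
Proof.
move=> mf1 mf2 f10 f20 ih f12; apply/eqP; rewrite eq_le.
rewrite integral_shift_le//=; last by move=> x; rewrite f12.
have ihN : mu.-integrable setT (EFin \o (\- h)%R) by exact: integrableN ih.
have hfin : \int[mu]_x (h x)%:E \is a fin_num by exact: integrable_fin_num ih.
have := @integral_shift_le f2 f1 (\- h)%R mf2 mf1 f20 f10 ihN.
have -> : \int[mu]_x (EFin ((\- h)%R x)) = - \int[mu]_x (h x)%:E.
  under eq_integral do rewrite /= EFinN.
  rewrite integralN//; exact: integrable_add_def ih.
rewrite leeBlDr//; apply => x.
by rewrite -f12 EFinN addeK.
Qed.

End integral_shift.

(** * Lower limits and a compactness lemma *)

Section limn_einf_lemmas.
Context (R : realType).
Implicit Types (u v : (\bar R)^nat) (l : \bar R).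

Lemma limn_einfE u : limn_einf u = ereal_sup (range (einfs u)).
Proof. by rewrite limn_einf_lim; apply/cvg_lim => //; exact: cvg_einfs_sup. Qed.

Lemma lee_by_lt_fin l (x : \bar R) : (forall a : R, a%:E < l -> a%:E <= x) -> l <= x.
Proof.
case: l => [l| |] h; last by rewrite leNye.
- apply/lee_subgt0Pr => e e0; apply: h.
  by rewrite lte_fin ltrBlDr ltrDl.
- rewrite leye_eq; apply/eqP/eqyP => A A0.
  by apply: h; rewrite ltry.
Qed.

Lemma le_limn_einf l u : (forall a : R, a%:E < l -> \forall n \near \oo, a%:E <= u n) ->
  l <= limn_einf u.
Proof.
move=> h; apply: lee_by_lt_fin => a /h[N _ HN]; rewrite limn_einfE.
apply: (@le_trans _ _ (einfs u N)); last by apply: ereal_sup_ubound; exists N.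
by apply: le_ereal_inf_tmp => _ [n /= Nn <-]; exact: HN.
Qed.

Lemma limn_einf_ge0 u : (forall n, 0 <= u n) -> 0 <= limn_einf u.
Proof.
move=> u0; apply: le_limn_einf => a a0; apply: nearW => n.
exact: le_trans (ltW a0) (u0 n).
Qed.

Lemma limn_einf_le l u : (\forall n \near \oo, u n <= l) -> limn_einf u <= l.
Proof.
move=> [N _ HN]; rewrite limn_einfE; apply: ge_ereal_sup => _ [n _ <-].
apply: (@le_trans _ _ (u (maxn n N))).
  by apply: ereal_inf_lbound; exists (maxn n N) => //=; rewrite leq_maxl.
by apply: HN => /=; rewrite leq_maxr.
Qed.

Lemma limn_einf_lt (a : R) u : a%:E < limn_einf u -> \forall n \near \oo, a%:E < u n.
Proof.
rewrite limn_einfE => /ereal_sup_gt[_ [N _ <-]] h; exists N => // n /= Nn.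
by apply: lt_le_trans h _; apply: ereal_inf_lbound; exists n.
Qed.

Lemma le_limn_einfD u v : (forall n, 0 <= u n) -> (forall n, 0 <= v n) ->
  limn_einf u + limn_einf v <= limn_einf (fun n => u n + v n).
Proof.
move=> u0 v0; rewrite !limn_einf_lim.
have e0 (w : (\bar R)^nat) n : (forall n, 0 <= w n) -> 0 <= einfs w n.
  by move=> w0; apply: le_ereal_inf_tmp => _ [i _ <-].
have l0 (w : (\bar R)^nat) : (forall n, 0 <= w n) -> 0 <= limn (einfs w).
  by move=> w0; rewrite -limn_einf_lim limn_einf_ge0.
rewrite -limeD; [|exact: is_cvg_einfs|exact: is_cvg_einfs|]; last first.
  by rewrite ge0_adde_def ?inE ?l0.
apply: lee_lim.
- apply: is_cvgeD; [|exact: is_cvg_einfs|exact: is_cvg_einfs].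
  by rewrite ge0_adde_def ?inE ?l0.
- exact: is_cvg_einfs.
- apply: nearW => n; apply: le_ereal_inf_tmp => _ [i /= ni <-].
  by apply: leeD; apply: ereal_inf_lbound; exists i.
Qed.

Lemma le_limn_einf_sum (I : Type) (s : seq I) (u : I -> (\bar R)^nat) :
  (forall i n, 0 <= u i n) ->
  \sum_(i <- s) limn_einf (u i) <= limn_einf (fun n => \sum_(i <- s) u i n).
Proof.
move=> u0; elim: s => [|i s ih].
  rewrite big_nil; apply: limn_einf_ge0 => n; by rewrite big_nil.
rewrite big_cons; apply: (@le_trans _ _
    (limn_einf (u i) + limn_einf (fun n => \sum_(i <- s) u i n))).
  exact: leeD.
apply: le_trans (le_limn_einfD _ _) _ => // [n|]; first exact: sume_ge0.
by under [X in _ <= limn_einf X]eq_fun do rewrite big_cons.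
Qed.

Lemma lsc_limn_einf (F : R -> \bar R) (x : R^nat) (a : R) :
  lower_semicontinuous F -> x @ \oo --> a -> F a <= limn_einf (F \o x).
Proof.
move=> Fl xa; apply: le_limn_einf => b /Fl[V Va HV].
have : \forall n \near \oo, V (x n) := xa _ Va.
by apply: filterS => n /HV; exact: ltW.
Qed.

Lemma cvgn_sum (I : Type) (s : seq I) (x : I -> R^nat) (a : I -> R) :
  (forall i, x i @ \oo --> a i) ->
  (fun n => \sum_(i <- s) x i n)%R @ \oo --> (\sum_(i <- s) a i)%R.
Proof.
move=> xa; elim: s => [|i s ih].
  by rewrite big_nil; under eq_cvg do rewrite big_nil; exact: cvg_cst.
rewrite big_cons; under eq_cvg do rewrite big_cons.
exact: cvgD (xa i) ih.
Qed.

Lemma limn_einfZ (r : R) u : (0 < r)%R ->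
  r%:E * limn_einf u <= limn_einf (fun n => r%:E * u n).
Proof.
move=> r0; apply: le_limn_einf => a; rewrite muleC -lte_pdivrMr// -EFinM => /limn_einf_lt.
by apply: filterS => n; rewrite EFinM lte_pdivrMr// muleC => /ltW.
Qed.

(** For k = +oo the product is discontinuous at 0, because +oo * 0 = 0, but still lower
    semicontinuous on nonnegative reals. This covers points from which an atom has infinite cost. *)
Lemma mule_limn_einf (k : \bar R) (x : R^nat) (a : R) : 0 <= k ->
  (forall n, (0 <= x n)%R) -> x @ \oo --> a ->
  k * a%:E <= limn_einf (fun n => k * (x n)%:E).
Proof.
move=> k0 x0 xa.
have a0 : (0 <= a)%R by apply: cvgr_to_ge xa _; exact: nearW.
case: k k0 => [k k0||//].
  have kx : k%:E * (x n)%:E @[n --> \oo] --> k%:E * a%:E.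
    by apply: cvg_EFin; [exact: nearW|exact: cvgMr].
  by have [-> _] := cvg_limn_einf_sup kx.
move=> _; move: a0; rewrite le_eqVlt => /predU1P[<-|a0].
  by rewrite mule0; apply: limn_einf_ge0 => n; rewrite mule_ge0// lee_fin.
apply: le_limn_einf => b _.
have : \forall n \near \oo, (0 < x n)%R by exact: cvgr_gt xa _ a0.
by apply: filterS => n xn; rewrite gt0_mulye ?lte_fin// leey.
Qed.

End limn_einf_lemmas.

Section limn_einf_measurable.
Context d (T : measurableType d) (R : realType) (D : set T).

Lemma measurable_fun_limn_einf (f : (T -> \bar R)^nat) :
  (forall n, measurable_fun D (f n)) ->
  measurable_fun D (fun x => limn_einf (f ^~ x)).
Proof.
move=> mf; rewrite /limn_einf; apply: measurableT_comp => //.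
by apply: measurable_fun_limn_esup => n; exact: measurableT_comp.
Qed.

End limn_einf_measurable.

(* The integrable functions f_n >= 0 converge almost everywhere as soon as their
   bounded transforms 1 / (1 + f_n) converge fast enough in L^2; the set where
   the transforms tend to 0 is null by Fatou's lemma. *)
Section inverse_transform.
Context d (T : measurableType d) (R : realType).
Variable mu : {finite_measure set T -> \bar R}.
Variables (f : (T -> R)^nat) (C a : R).
Hypotheses (mf : forall n, measurable_fun setT (f n))
  (f0 : forall n x, (0 <= f n x)%R)
  (fC : forall n, \int[mu]_x (f n x)%:E <= C%:E)
  (a0 : (0 <= a)%R).

Let u n x : R := (1 + f n x)^-1.

Hypothesis cauchy : forall n,
  \int[mu]_x ((u n x - u n.+1 x) ^+ 2)%:E <= (a * 8^-1 ^+ n)%:E.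

Let measurable_u n : measurable_fun setT (u n).
Proof.
(* The maximum with 1 makes the inverse monotone on the whole line, hence Borel. *)
rewrite (_ : u n = (fun y : R => (Num.max 1 y)^-1)%R \o (fun x => 1 + f n x)%R); last first.
  by apply/funext => x; rewrite /u /= max_r// lerDl.
apply: measurableT_comp; last exact: measurable_funD.
apply: nonincreasing_measurable => // x y xy.
rewrite lef_pV2 ?posrE ?lt_max ?ltr01//.
by rewrite ge_max !le_max lexx xy orbT.
Qed.

Let u_gt0 n x : (0 < u n x)%R.
Proof. by rewrite invr_gt0 ltr_wpDr. Qed.

Let msq n : measurable_fun setT (fun x => ((u n x - u n.+1 x) ^+ 2)%:E).
Proof. exact/measurable_EFinP/measurable_funX/measurable_funB. Qed.

(** By 2 |y| <= 2^-n + 2^n y^2, the series of the [h n] controls that of |u n - u n.+1|. The rate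
    8^-n for the squares leaves 4^-n after the weight 2^n, so both terms are summable. *)
Let h n x : \bar R := ((2^-1 ^+ n)%R%:E + (2 ^+ n)%R%:E * ((u n x - u n.+1 x) ^+ 2)%:E).

Let h0 n x : 0 <= h n x.
Proof.
apply: adde_ge0; first by rewrite lee_fin exprn_ge0.
by apply: mule_ge0; rewrite lee_fin ?sqr_ge0 ?exprn_ge0.
Qed.

Let mh n : measurable_fun setT (h n).
Proof. by apply: emeasurable_funD => //; exact: measurable_funeM. Qed.

Let inth n : \int[mu]_x h n x <= ((fine (mu setT) + a) / 2 ^+ n)%:E.
Proof.
rewrite ge0_integralD//; last first.
- exact: measurable_funeM.
- by move=> x _; rewrite mule_ge0 ?lee_fin ?sqr_ge0 ?exprn_ge0.
rewrite integral_cst// ge0_integralZl_EFin ?exprn_ge0//; last by move=> x _; rewrite lee_fin sqr_ge0.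
have muT : mu setT = (fine (mu setT))%:E by rewrite fineK// fin_num_measure.
apply: (@le_trans _ _ ((2^-1 ^+ n)%R%:E * mu setT + (2 ^+ n)%R%:E * (a * 8^-1 ^+ n)%R%:E)).
  by apply: leeD => //; rewrite lee_wpmul2l// lee_fin exprn_ge0.
rewrite muT -!EFinM -EFinD lee_fin [leRHS]mulrDl; apply: lerD.
  by rewrite mulrC exprVn.
rewrite mulrCA; apply: ler_wpM2l => //; rewrite -exprMn -exprVn.
by apply: lerXn2r; rewrite ?nnegrE; lra.
Qed.

Lemma inverse_transform_cvg : {ae mu, forall x, cvgn (fun n => u n x)}.
Proof.
have aT0 : (0 <= fine (mu setT) + a)%R by rewrite addr_ge0// fine_ge0.
have intg : \int[mu]_x (\sum_(n <oo) h n x) < +oo.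
  rewrite integral_nneseries//.
  apply: (@le_lt_trans _ _ ((fine (mu setT) + a) * (1 - 2^-1)^-1)%:E); last exact: ltry.
  apply: lime_le; first by apply: is_cvg_nneseries => n _ _; exact: integral_ge0.
  apply: nearW => N.
  apply: (@le_trans _ _ (\sum_(0 <= n < N) (geometric (fine (mu setT) + a) 2^-1 n)%:E)).
    by apply: lee_sum => n _; apply: le_trans (inth n) _; rewrite /= exprVn.
  rewrite sumEFin lee_fin.
  have := @geometric_le_lim R N (fine (mu setT) + a) 2^-1.
  by rewrite seriesEnat; apply => //; rewrite ?invr_gt0// gtr0_norm ?invr_gt0// invf_lt1// ltr1n.
have ig : mu.-integrable setT (fun x => \sum_(n <oo) h n x).
  apply/integrableP; split; first exact: ge0_emeasurable_sum.
  rewrite (eq_integral (fun x => \sum_(n <oo) h n x))// => x _.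
  by rewrite gee0_abs//; exact: nneseries_ge0.
have := integrable_ae measurableT ig.
apply: filterS => x /(_ I) hfin.
have cs : cvgn (series (telescope (u ^~ x))).
  apply: (@normed_cvg R R^o); apply: nondecreasing_is_cvgn.
    by apply: nondecreasing_series => n _ _; exact: normr_ge0.
  exists (fine (\sum_(n <oo) h n x)) => _ [N _ <-] /=.
  rewrite -lee_fin fineK//; apply: le_trans (nneseries_lim_ge N _) => //.
  rewrite seriesEnat/= -sumEFin; apply: lee_sum => n _.
  rewrite /h -EFinM -EFinD lee_fin /telescope/=.
  have := u_gt0 n x; have := u_gt0 n.+1 x; move: (u n x) (u n.+1 x) => p q _ _.
  rewrite -[(_ ^+ 2)%R]sqrrN opprB -[((q - p) ^+ 2)%R]real_normK ?num_real//.
  move: (normr_ge0 (q - p)%R); move: (`|q - p|)%R => y y0.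
  have e0 : (0 < 2 ^+ n :> R)%R by rewrite exprn_gt0.
  rewrite exprVn; move: (2 ^+ n)%R e0 => e e0.
  have : (0 <= (e * y - 1) ^+ 2 / e)%R by rewrite divr_ge0 ?sqr_ge0// ltW.
  rewrite (_ : (e * y - 1) ^+ 2 / e = e * y ^+ 2 - 2 * y + e^-1)%R; first by lra.
  by field; rewrite gt_eqF.
rewrite (_ : (fun n => u n x) = (fun n => u 0%N x + series (telescope (u ^~ x)) n)%R).
  by apply: is_cvgD => //; exact: is_cvg_cst.
by apply/funext => n; exact: (eq_sum_telescope (u ^~ x)).
Qed.

Lemma inverse_transform_limit : exists g : T -> R,
  [/\ measurable_fun setT g, forall x, (0 <= g x)%R,
      \int[mu]_x (g x)%:E <= C%:E &
      {ae mu, forall x, f ^~ x @ \oo --> g x}].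
Proof.
(* A lower limit is measurable everywhere, whatever happens where the sequence diverges. *)
pose e x := limn_einf (fun n => (f n x)%:E).
have me : measurable_fun setT e.
  by apply: measurable_fun_limn_einf => n; exact/measurable_EFinP.
have e0 x : 0 <= e x by apply: limn_einf_ge0 => n; rewrite lee_fin.
have eC : \int[mu]_x e x <= C%:E.
  apply: le_trans (fatou _ _ _ _) _ => //.
  - by move=> n; exact/measurable_EFinP.
  - by move=> n x _; rewrite lee_fin.
  - by apply: limn_einf_le; exact: nearW.
have ie : mu.-integrable setT e.
  apply/integrableP; split => //.
  under eq_integral do rewrite gee0_abs//.
  by apply: le_lt_trans eC _; exact: ltry.
have aefin := integrable_ae measurableT ie.
exists (fine \o e); split.
- exact: measurableT_comp.
- by move=> x; exact: fine_ge0.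
- rewrite (ae_eq_integral e)//.
    by apply/measurable_EFinP; exact: measurableT_comp.
  by apply: filterS aefin => x /(_ I) ? _ /=; rewrite fineK.
- near=> x.
  have cu : cvgn (fun n => u n x) by near: x; exact: inverse_transform_cvg.
  have efin : e x \is a fin_num by near: x; apply: filterS aefin => x /(_ I).
  pose l : R := limn (fun n => u n x).
  have ul : (fun n => u n x) @ \oo --> l by [].
  have l0 : (0 <= l)%R := cvgr_to_ge ul (nearW _ (fun n => ltW (u_gt0 n x))).
  have fE n : f n x = ((u n x)^-1 - 1)%R by rewrite invrK addrC addKr.
  have [l_eq0|l_neq0] := eqVneq 0%R l.
    have : e x = +oo.
      apply/eqP; rewrite -leye_eq; apply: le_limn_einf => A _.
      have A1 : (0 < `|A| + 1)%R by rewrite ltr_wpDl.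
      have : \forall n \near \oo, (u n x < (`|A| + 1)^-1)%R.
        by apply: (cvgr_lt _ ul); rewrite -l_eq0 invr_gt0.
      apply: filterS => n un; rewrite lee_fin.
      have : (`|A| + 1 <= 1 + f n x)%R.
        by rewrite -lef_pV2 ?posrE// ?ltW// ltr_wpDr.
      by have := ler_norm A; lra.
    by move=> ey; rewrite ey in efin.
  have fl : f ^~ x @ \oo --> (l^-1 - 1)%R.
    rewrite (_ : f ^~ x = (fun n => (u n x)^-1 - 1)%R); last exact/funext.
    by apply: cvgB; [apply: cvgV => //; rewrite eq_sym|exact: cvg_cst].
  suff -> : (fine \o e) x = (l^-1 - 1)%R by [].
  have fle : (f n x)%:E @[n --> \oo] --> (l^-1 - 1)%:E by apply: cvg_EFin => //; exact: nearW.
  by rewrite /= /e; have [-> _] := cvg_limn_einf_sup fle.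
Unshelve. all: by end_near. Qed.

End inverse_transform.

(** * Semidiscrete duality *)

Section semidiscrete.
Context dd (T : measurableType dd) (R : realType).
Variable mu : {finite_measure set T -> \bar R}.
Variables (F : R -> \bar R) (FE : marginal_entropy F).
Variables (M : nat) (k : 'I_M -> T -> \bar R) (m : 'I_M -> R).

Definition densities (g : 'I_M -> T -> R) :=
  forall i, (forall x, (0 <= g i x)%R) /\ mu.-integrable setT (EFin \o g i).

Definition mass (g : 'I_M -> T -> R) i : R := fine (\int[mu]_x (g i x)%:E).

(** The energy per unit of [mu] at x when the amount [g i] is sent to atom i. By +oo * 0 = 0 an
    unreachable atom that receives nothing costs nothing. *)
Definition local_cost (g : 'I_M -> R) (x : T) : \bar R :=
  \sum_i k i x * (g i)%:E + F (\sum_i g i)%R.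

Definition source_cost (g : 'I_M -> T -> R) : \bar R :=
  \int[mu]_x local_cost (g ^~ x) x.

(** The discrepancy of sum p_i delta_i relative to sum m_i delta_i. Its argument is a free vector p,
    so that the equality of p with [mass g] can be treated as a constraint with multiplier w. *)
Definition target_cost (p : 'I_M -> R) : \bar R :=
  \sum_i (m i)%:E * F (p i / m i)%R.

Definition cell (w : 'I_M -> R) (i : 'I_M) : set T :=
  [set x | k i x < +oo /\ forall j, k i x - (w i)%:E <= k j x - (w j)%:E].

Definition uncovered : set T := [set x | forall i, k i x = +oo].

Definition dual_value (w : 'I_M -> R) : \bar R :=
  - (\sum_i (\int[mu]_(x in cell w i) conjugate F (- fine (k i x) + w i)%R
             + conjugate F (- w i)%R * (m i)%:E))
  + F 0%R * mu uncovered.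

Hypotheses (mk : forall i, measurable_fun setT (k i))
           (k0 : forall i x, 0 <= k i x)
           (m0 : forall i, (0 < m i)%R).

Lemma massE g i : densities g -> \int[mu]_x (g i x)%:E = (mass g i)%:E.
Proof. by move=> /(_ i)[_ ig]; rewrite fineK//; exact: integrable_fin_num ig. Qed.

Lemma mass_ge0 g i : densities g -> (0 <= mass g i)%R.
Proof.
by move=> /(_ i)[g0 _]; apply/fine_ge0/integral_ge0 => x _; rewrite lee_fin.
Qed.

Lemma densities_measurable g i : densities g -> measurable_fun setT (g i).
Proof. by move=> /(_ i)[_ /measurable_int/measurable_EFinP]. Qed.

Lemma local_cost_ge0 g x : (forall i, (0 <= g i)%R) -> 0 <= local_cost g x.
Proof.
move=> g0; rewrite adde_ge0 ?(entropy_ge0 FE)// sume_ge0// => i _.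
by rewrite mule_ge0// lee_fin.
Qed.

Lemma local_cost_measurable (g : 'I_M -> T -> R) :
  (forall i, measurable_fun setT (g i)) ->
  measurable_fun setT (fun x => local_cost (g ^~ x) x).
Proof.
move=> mg; apply: emeasurable_funD.
  apply: emeasurable_sum => i; apply: emeasurable_funM; first exact: mk.
  exact/measurable_EFinP.
apply: measurableT_comp; first exact: entropy_measurable.
exact: measurable_sum.
Qed.

Lemma source_cost_ge0 g : densities g -> 0 <= source_cost g.
Proof.
by move=> dg; apply: integral_ge0 => x _; apply: local_cost_ge0 => i; case: (dg i).
Qed.

Lemma target_cost_ge0 p : 0 <= target_cost p.
Proof.
by apply: sume_ge0 => i _; rewrite mule_ge0 ?(entropy_ge0 FE)// lee_fin ltW.
Qed.

Lemma measurable_cell w i : measurable (cell w i).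
Proof.
rewrite (_ : cell w i = (setT `&` [set x | k i x < +oo]) `&`
   \bigcap_(j in [set: 'I_M])
      (setT `&` [set x | k i x - (w i)%:E <= k j x - (w j)%:E])); last first.
  apply/seteqP; split => x /=; first by move=> [h1 h2]; split=> [|j _]; split=> //; exact: h2.
  move=> [[_ h1] h2]; split=> // j. by have [] := h2 j I.
apply: measurableI; first exact: (measurable_lte measurableT (mk i) (measurable_cst +oo)).
apply: fin_bigcap_measurable => // j _.
by apply: measurable_lee => //; apply: emeasurable_funB.
Qed.

Lemma measurable_uncovered : measurable uncovered.
Proof.
rewrite (_ : uncovered = \bigcap_(j in [set: 'I_M]) (k j @^-1` [set +oo])); last first.
  by apply/seteqP; split => x /= h; [move=> i _|move=> i]; exact: h.
apply: fin_bigcap_measurable => // j _.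
by rewrite -[X in measurable X]setTI; exact: mk.
Qed.

(* Ties between cells are broken by the index, so that these sets together with
   [uncovered] partition the whole space. *)
Definition first_cell w i : set T :=
  cell w i `\` \bigcup_(j in [set j : 'I_M | (j < i)%N]) cell w j.

Lemma measurable_first_cell w i : measurable (first_cell w i).
Proof.
apply: measurableD; first exact: measurable_cell.
by apply: fin_bigcup_measurable => // j _; exact: measurable_cell.
Qed.

Lemma first_cell_uniq w i j x : first_cell w i x -> first_cell w j x -> i = j.
Proof.
move=> [xi ni] [xj nj]; have [ij|ji|/val_inj//] := ltngtP i j.
  by case: nj; exists i.
by case: ni; exists j.
Qed.

Lemma cell_covered w i x : cell w i x -> ~ uncovered x.
Proof. by move=> [ki _] /(_ i) h; rewrite h ltxx in ki. Qed.

Lemma first_cell_cover w x : uncovered x \/ exists i, first_cell w i x.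
Proof.
have [|nu] := pselect (uncovered x); [by left|right].
have [i0 ki0] : exists i, k i x < +oo.
  apply: contrapT => h; apply: nu => i; apply/eqP; rewrite -leye_eq leNgt.
  by apply/negP => h'; apply: h; exists i.
have exc : exists i, cell w i x.
  case: (@arg_minP _ _ _ i0 predT (fun i => k i x - (w i)%:E)%E isT) => i _ hi.
  exists i; split; last by move=> j; exact: hi.
  have := hi i0 isT; have := k0 i0 x; move: ki0.
  by case: (k i x) (k i0 x) => [r||] [s||]//= _ _ _; rewrite ltry.
have exn : exists n, [exists i : 'I_M, (i == n :> nat) && `[< cell w i x >]].
  by have [i ci] := exc; exists i; apply/existsP; exists i; rewrite eqxx; apply/asboolP.
case: (ex_minnP exn) => n /existsP[i /andP[/eqP <- /asboolP ci]] hmin.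
exists i; split=> // -[j /= ji cj].
have := hmin j; rewrite leqNgt ji => /(_ _)/notF; apply.
by apply/existsP; exists j; rewrite eqxx; exact/asboolP.
Qed.

Local Notation reply := (best_response FE).
Local Notation cfin := (conj_fin FE).

(** The number b plus the minimum over g >= 0 of [local_cost g x] - sum_j w j * g j: [potential_le]
    is the bound and [potential_reply] its attainment. The shift b makes it nonnegative. *)
Definition potential (w : 'I_M -> R) (b : R) (x : T) : \bar R :=
  \sum_i (\1_(first_cell w i) x * (b - cfin (w i - fine (k i x))))%:E
  + (F 0%R + b%:E) * (\1_uncovered x)%:E.

Lemma potential_cell w b i x : first_cell w i x ->
  potential w b x = (b - cfin (w i - fine (k i x)))%:E.
Proof.
move=> xi; rewrite /potential [X in _ * X%:E]indicE memNset; last first.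
  exact: cell_covered xi.1.
rewrite mule0 adde0 (bigD1 i)//= big1 ?adde0 => [|j ji].
  by rewrite indicE mem_set// mul1r.
rewrite indicE memNset ?mul0r// => xj.
by move: ji; rewrite (first_cell_uniq xi xj) eqxx.
Qed.

Lemma potential_uncovered w b x : uncovered x -> potential w b x = F 0%R + b%:E.
Proof.
move=> xu; rewrite /potential [X in _ * X%:E]indicE mem_set// mule1 big1 ?add0e//.
move=> i _; rewrite indicE memNset ?mul0r// => -[/cell_covered]; exact.
Qed.

Section potential_bound.
Variables (w : 'I_M -> R) (b : R).
Hypotheses (b0 : (0 <= b)%R) (wb : forall i, (cfin (w i) <= b)%R).

Lemma cell_term_ge0 i x : (0 <= b - cfin (w i - fine (k i x)))%R.
Proof.
rewrite subr_ge0; apply: le_trans (wb i); apply: conj_fin_nd.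
by rewrite gerBl fine_ge0.
Qed.

Lemma cell_term_measurable i :
  measurable_fun setT (fun x => b - cfin (w i - fine (k i x)))%R.
Proof.
apply: measurable_funB => //; apply: measurableT_comp; first exact: conj_fin_measurable.
by apply: measurable_funB => //; apply: measurableT_comp => //; exact: mk.
Qed.

Lemma F0b_ge0 : 0 <= F 0%R + b%:E.
Proof. by rewrite adde_ge0 ?(entropy_ge0 FE)// lee_fin. Qed.

Lemma potential_ge0 x : 0 <= potential w b x.
Proof.
rewrite adde_ge0 ?mule_ge0 ?F0b_ge0 ?lee_fin// sume_ge0// => i _.
by rewrite lee_fin mulr_ge0// cell_term_ge0.
Qed.

Lemma measurable_cell_term_indic i : measurable_fun setT
  (fun x => (\1_(first_cell w i) x * (b - cfin (w i - fine (k i x))))%:E).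
Proof.
apply/measurable_EFinP; apply: measurable_funM; last exact: cell_term_measurable.
exact/measurable_indic/measurable_first_cell.
Qed.

Lemma measurable_uncovered_term :
  measurable_fun setT (fun x => (F 0%R + b%:E) * (\1_uncovered x)%:E).
Proof.
apply: measurable_funeM; apply/measurable_EFinP.
exact/measurable_indic/measurable_uncovered.
Qed.

Lemma potential_measurable : measurable_fun setT (potential w b).
Proof.
apply: emeasurable_funD; last exact: measurable_uncovered_term.
by apply: emeasurable_sum => i; exact: measurable_cell_term_indic.
Qed.

Lemma integral_potential : \int[mu]_x potential w b x =
  \sum_i \int[mu]_(x in first_cell w i) (b - cfin (w i - fine (k i x)))%:E
  + (F 0%R + b%:E) * mu uncovered.
Proof.
have t0 i x : 0 <= (\1_(first_cell w i) x * (b - cfin (w i - fine (k i x))))%:E.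
  by rewrite lee_fin mulr_ge0// cell_term_ge0.
rewrite ge0_integralD//; last 4 first.
- by move=> x _; exact: sume_ge0.
- by apply: emeasurable_sum => i; exact: measurable_cell_term_indic.
- by move=> x _; rewrite mule_ge0 ?F0b_ge0// lee_fin.
- exact: measurable_uncovered_term.
rewrite ge0_integral_sum//; last by move=> i; exact: measurable_cell_term_indic.
congr (_ + _).
  apply: eq_bigr => i _; rewrite [RHS]integral_mkcond; apply: eq_integral => x _.
  rewrite /patch indicE; case: ifPn => _; first by rewrite mul1r.
  by rewrite mul0r.
rewrite ge0_integralZl ?F0b_ge0//; last first.
  exact/measurable_EFinP/measurable_indic/measurable_uncovered.
by rewrite integral_indic ?setIT//; exact: measurable_uncovered.
Qed.

End potential_bound.

Section pointwise_duality.
Variables (w g : 'I_M -> R) (x : T).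
Hypothesis g0 : forall i, (0 <= g i)%R.

(** On cell i the slope u = w i - k i x dominates every w j - k j x. Hence the excesses w j - u are
    paid by the transport cost, and Young's inequality at u, applied to the total sum of g, pays the
    rest. *)
Lemma cell_young i : cell w i x ->
  (\sum_j w j * g j)%R%:E <= local_cost g x + (cfin (w i - fine (k i x)))%:E.
Proof.
move=> [kiy ki]; have kif : k i x = (fine (k i x))%:E.
  by rewrite fineK// ge0_fin_numE.
set u := (w i - fine (k i x))%R.
have sg0 : (0 <= \sum_j g j)%R by apply: sumr_ge0.
have h1 : (\sum_j (w j - u) * g j)%R%:E <= \sum_j k j x * (g j)%:E.
  rewrite -sumEFin; apply: lee_sum => j _; rewrite EFinM lee_wpmul2r ?lee_fin//.
  have := ki j; rewrite kif leeBrDr//= -EFinB -EFinD => /(le_trans _); apply.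
  by rewrite lee_fin /u; lra.
apply: (@le_trans _ _ ((\sum_j (w j - u) * g j)%R%:E + (u * \sum_j g j)%R%:E)).
  rewrite -EFinD lee_fin mulr_sumr -big_split/= ler_sum// => j _.
  by rewrite -mulrDl subrK.
by rewrite /local_cost -addeA leeD// young.
Qed.

(** Sending any mass from such a point costs +oo, so only g = 0 competes, and it costs [F 0]. *)
Lemma uncovered_young : uncovered x ->
  (\sum_j w j * g j)%R%:E + F 0%R <= local_cost g x.
Proof.
move=> xu; have [/forallP gz|] := boolP [forall j, g j == 0%R].
  have {}gz j : g j = 0%R by exact/eqP.
  rewrite /local_cost !big1 ?add0e// => j _; rewrite ?gz ?mule0 ?mulr0//.
move=> /forallPn[j gj]; have {}gj : (0 < g j)%R by rewrite lt_def gj g0.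
have -> : local_cost g x = +oo; last by rewrite leey.
rewrite /local_cost (bigD1 j)//= xu gt0_mulye ?lte_fin// addye ?addye//.
  by rewrite gt_eqF// (lt_le_trans ltNy0)// (entropy_ge0 FE).
by rewrite gt_eqF// (lt_le_trans ltNy0)// sume_ge0// => i _; rewrite mule_ge0// lee_fin.
Qed.

Lemma potential_le b :
  potential w b x + (\sum_j w j * g j)%R%:E <= local_cost g x + b%:E.
Proof.
have [xu|[i xi]] := first_cell_cover w x.
  rewrite potential_uncovered// addeAC leeD2r// addeC; exact: uncovered_young.
rewrite (potential_cell _ xi); have := cell_young xi.1.
have := local_cost_ge0 x g0.
case: (local_cost g x) => [r||//]; last by move=> _ _; rewrite addye// leey.
by rewrite -!EFinD !lee_fin; lra.
Qed.

End pointwise_duality.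

(** The pointwise minimizer for w: all mass at x goes to the atom of its first cell, in the amount
    optimal for the slope w i - k i x. *)
Definition cell_reply (w : 'I_M -> R) (i : 'I_M) (x : T) : R :=
  (\1_(first_cell w i) x * reply (w i - fine (k i x)))%R.

Lemma potential_reply w b x :
  potential w b x + (\sum_j w j * cell_reply w j x)%R%:E =
  local_cost (cell_reply w ^~ x) x + b%:E.
Proof.
have [xu|[i xi]] := first_cell_cover w x.
  have gz j : cell_reply w j x = 0%R.
    rewrite /cell_reply indicE memNset ?mul0r// => -[/cell_covered]; exact.
  rewrite potential_uncovered// /local_cost.
  rewrite (eq_bigr (fun=> 0%R)) => [|j _]; last by rewrite gz mulr0.
  rewrite [X in _ = X + _ + _](eq_bigr (fun=> 0)) => [|j _]; last by rewrite gz mule0.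
  have -> : (\sum_j cell_reply w j x)%R = 0%R by rewrite big1.
  by rewrite !big1_eq adde0 add0e.
have gj j : j != i -> cell_reply w j x = 0%R.
  move=> ji; rewrite /cell_reply indicE memNset ?mul0r// => xj.
  by move: ji; rewrite (first_cell_uniq xi xj) eqxx.
have gi : cell_reply w i x = reply (w i - fine (k i x)).
  by rewrite /cell_reply indicE mem_set// mul1r.
have sg : (\sum_j cell_reply w j x)%R = reply (w i - fine (k i x)).
  by rewrite (bigD1 i)//= big1 ?addr0.
rewrite (potential_cell _ xi) /local_cost sg entropy_best_response.
rewrite (bigD1 i)//= big1 => [|j ji]; last by rewrite gj// mulr0.
rewrite (bigD1 i)//= big1 => [|j ji]; last by rewrite gj// mule0.
have [kif _] := xi.1; have -> : k i x = (fine (k i x))%:E.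
  by rewrite fineK// ge0_fin_numE.
by rewrite gi adde0 -EFinM -!EFinD; congr EFin => /=; lra.
Qed.

(** * The dual value as an integral, weak duality and its equality case *)

Section null_ties.
Hypothesis ties : forall w i j, i != j -> mu (cell w i `&` cell w j) = 0.

Definition lower_cells w i : set T := \bigcup_(j in [set j : 'I_M | (j < i)%N]) cell w j.

Lemma measurable_lower_cells w i : measurable (lower_cells w i).
Proof. by apply: fin_bigcup_measurable => // j _; exact: measurable_cell. Qed.

Lemma cell_overlap_null w i : mu (cell w i `&` lower_cells w i) = 0.
Proof.
apply: measure_negligible.
  by apply: measurableI; [exact: measurable_cell|exact: measurable_lower_cells].
(* The finite union is padded by empty sets to a sequence, in order to apply countable
   subadditivity. *)
pose G n := if (insub n : option 'I_M) is Some j then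
  if (j < i)%N then cell w i `&` cell w j else set0 else set0.
apply: (@negligibleS _ _ _ _ (\bigcup_n G n)).
  by move=> x [xi [j /= ji xj]]; exists (val j) => //; rewrite /G valK ji.
apply: negligible_bigcup => n; rewrite /G.
case: insub => [j|]; last exact: negligible_set0.
case: ifPn => [ji|_]; last exact: negligible_set0.
exists (cell w i `&` cell w j); split=> //.
  by apply: measurableI; exact: measurable_cell.
by apply: ties; rewrite eq_sym -val_eqE /= neq_ltn ji.
Qed.

Lemma first_cellE w i :
  first_cell w i = cell w i `\` (cell w i `&` lower_cells w i).
Proof.
apply/seteqP; split => x [xi h]; split=> //; first by move=> [_]; exact: h.
by move=> h'; apply: h.
Qed.

Lemma measure_first_cell w i : mu (first_cell w i) = mu (cell w i).
Proof.
have -> : mu (cell w i) = mu (first_cell w i) + mu (cell w i `&` lower_cells w i).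
  by apply: measureDI; [exact: measurable_cell|exact: measurable_lower_cells].
by rewrite cell_overlap_null adde0.
Qed.

Lemma integral_first_cell w i (f : T -> \bar R) : measurable_fun setT f ->
  (forall x, 0 <= f x) ->
  \int[mu]_(x in cell w i) f x = \int[mu]_(x in first_cell w i) f x.
Proof.
move=> mf f0; rewrite first_cellE; apply: ge0_negligible_integral => //.
- by apply: measurableI; [exact: measurable_cell|exact: measurable_lower_cells].
- exact: measurable_cell.
- exact: measurable_funTS.
- exact: cell_overlap_null.
Qed.

Lemma measure_partition w :
  \sum_i mu (cell w i) + mu uncovered = mu setT.
Proof.
have m1 i : measurable_fun setT (fun x => (\1_(first_cell w i) x)%:E : \bar R).
  exact/measurable_EFinP/measurable_indic/measurable_first_cell.
have mu1 : measurable_fun setT (fun x => (\1_uncovered x)%:E : \bar R).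
  exact/measurable_EFinP/measurable_indic/measurable_uncovered.
have s0 x : setT x -> 0%R <= \sum_i (\1_(first_cell w i) x)%:E :> \bar R.
  by move=> _; apply: sume_ge0 => i _; rewrite lee_fin.
have ms : measurable_fun setT (fun x => \sum_i (\1_(first_cell w i) x)%:E : \bar R).
  by apply: emeasurable_sum.
rewrite -[RHS]mul1e -(integral_cst mu measurableT).
rewrite (eq_integral (fun x => \sum_i (\1_(first_cell w i) x)%:E + (\1_uncovered x)%:E)).
  rewrite ge0_integralD// ge0_integral_sum//.
  rewrite integral_indic ?setIT//; last exact: measurable_uncovered.
  congr (_ + _); apply: eq_bigr => i _.
  rewrite integral_indic//; last exact: measurable_first_cell.
  by rewrite setIT; exact/esym/measure_first_cell.
move=> x _; have [xu|[i xi]] := first_cell_cover w x.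
  rewrite big1 ?indicE ?mem_set ?add0e// => i _.
  by rewrite indicE memNset// => -[/cell_covered].
rewrite (bigD1 i)//= big1 => [|j ji].
  rewrite [X in X%:E + _ + _]indicE mem_set// indicE memNset ?adde0//.
  exact: cell_covered xi.1.
rewrite indicE memNset// => xj.
by move: ji; rewrite (first_cell_uniq xi xj) eqxx.
Qed.

(** The cells in [dual_value] overlap while [potential] lives on a partition; null ties identify the
    integrals, and [measure_partition] accounts for the constant b. *)
Lemma dual_value_potential w b : (0 <= b)%R -> (forall i, (cfin (w i) <= b)%R) ->
  dual_value w + b%:E * mu setT + (\sum_i cfin (- w i) * m i)%R%:E =
  \int[mu]_x potential w b x.
Proof.
move=> b0 wb; rewrite integral_potential//.
pose J i := \int[mu]_(x in first_cell w i) (b - cfin (w i - fine (k i x)))%:E.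
pose e i := (b * fine (mu (cell w i)) + cfin (- w i) * m i)%R.
have mufin A : measurable A -> mu A = (fine (mu A))%:E.
  by move=> mA; rewrite fineK// fin_num_measure.
have JE i : \int[mu]_(x in cell w i) conjugate F (- fine (k i x) + w i)%R =
    - (J i - b%:E * mu (cell w i)).
  under eq_integral do rewrite (conjugateE FE) addrC.
  rewrite /J -integral_first_cell; last 2 first.
  - by apply/measurable_EFinP; exact: cell_term_measurable.
  - by move=> x; rewrite lee_fin cell_term_ge0.
  rewrite -integralN_bounded_above ?oppeK//.
  - exact: measurable_cell.
  - apply: measurable_funTS; apply: measurableT_comp; first exact: conj_fin_measurable.
    by apply: measurable_funB => //; apply: measurableT_comp => //; exact: mk.
  - by move=> x _; have := cell_term_ge0 wb i x; rewrite subr_ge0.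
have J0 i : 0 <= J i.
  by apply: integral_ge0 => x _; rewrite lee_fin cell_term_ge0.
rewrite /dual_value.
(* Some [J i] may be +oo but none is -oo, which allows the sign to leave the sum. *)
rewrite (eq_bigr (fun i => - (J i + (- e i)%:E))) => [|i _]; last first.
  rewrite JE conjugateE -EFinM /e (mufin _ (measurable_cell w i)) -EFinM.
  have := J0 i; case: (J i) => [r||]//= _.
  by rewrite -EFinD; congr EFin; lra.
rewrite sumeN => [|i j _ _]; last first.
  by have := J0 i; have := J0 j; case: (J i) (J j) => [?||] [?||].
rewrite oppeK big_split/= sumEFin.
have [_ mU] := (I, measurable_uncovered).
rewrite ge0_muleDl ?(entropy_ge0 FE) ?lee_fin// (mufin _ measurableT) (mufin _ mU).
have tE : fine (mu setT) = (\sum_i fine (mu (cell w i)) + fine (mu uncovered))%R.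
  apply: EFin_inj; rewrite EFinD -sumEFin -!mufin// -(measure_partition w).
  by congr (_ + _); apply: eq_bigr => i _; rewrite -mufin//; exact: measurable_cell.
rewrite tE -!EFinM -!addeA; congr (_ + _).
rewrite addeCA; congr (_ + _); rewrite -!EFinD; congr EFin.
rewrite sumrN big_split/= -mulr_sumr; lra.
Qed.

Definition pairing (w : 'I_M -> R) (r : 'I_M -> R) : R := (\sum_i w i * r i)%R.

Lemma weighted_integrable w g : densities g ->
  mu.-integrable setT (EFin \o (fun x => \sum_j w j * g j x)%R).
Proof.
move=> dg; rewrite (_ : EFin \o _ = fun x => \sum_j (w j)%:E * (g j x)%:E); last first.
  by apply/funext => x /=; rewrite -sumEFin; apply: eq_bigr => j _; rewrite EFinM.
by apply: integrable_sum => // j _; apply: integrableZl => //; exact: (dg j).2.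
Qed.

Lemma integral_weighted w g : densities g ->
  \int[mu]_x (\sum_j w j * g j x)%R%:E = (pairing w (mass g))%:E.
Proof.
move=> dg; under eq_integral do rewrite -sumEFin.
rewrite integral_sum//; last first.
  move=> j; rewrite (_ : (fun _ => _) = (fun x => (w j)%:E * (EFin \o g j) x)).
    by apply: integrableZl => //; exact: (dg j).2.
  by apply/funext => x; rewrite EFinM.
rewrite /pairing -sumEFin; apply: eq_bigr => j _.
under eq_integral do rewrite EFinM.
by rewrite integralZl//; [rewrite EFinM massE|exact: (dg j).2].
Qed.

Definition potential_bound (w : 'I_M -> R) : R := (\sum_i `|cfin (w i)|)%R.

Lemma potential_bound_ge0 w : (0 <= potential_bound w)%R.
Proof. by apply: sumr_ge0. Qed.

Lemma conj_le_potential_bound w i : (cfin (w i) <= potential_bound w)%R.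
Proof.
rewrite /potential_bound (bigD1 i)//= (le_trans (ler_norm _))// lerDl.
by apply: sumr_ge0.
Qed.

Lemma integral_local_cost_shift g (b : R) : (0 <= b)%R -> densities g ->
  \int[mu]_x (local_cost (g ^~ x) x + b%:E) = source_cost g + b%:E * mu setT.
Proof.
move=> b0 dg; rewrite ge0_integralD//.
- by rewrite integral_cst.
- by move=> x _; apply: local_cost_ge0 => i; exact: (dg i).1.
- by apply: local_cost_measurable => i; exact: densities_measurable.
Qed.

Lemma local_cost_shift_measurable g (b : R) : densities g ->
  measurable_fun setT (fun x => local_cost (g ^~ x) x + b%:E).
Proof.
move=> dg; apply: emeasurable_funD => //.
by apply: local_cost_measurable => i; exact: densities_measurable.
Qed.

Lemma local_cost_shift_ge0 g (b : R) x : (0 <= b)%R -> densities g ->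
  0 <= local_cost (g ^~ x) x + b%:E.
Proof.
move=> b0 dg; rewrite adde_ge0// ?lee_fin//.
by apply: local_cost_ge0 => i; exact: (dg i).1.
Qed.

Lemma target_cost_ge w p : (forall i, (0 <= p i)%R) ->
  (- (pairing w p + \sum_i cfin (- w i) * m i))%:E <= target_cost p.
Proof.
move=> p0; rewrite /pairing -big_split/= -sumrN -sumEFin; apply: lee_sum => i _.
have mi := m0 i; have := young FE (- w i)%R (divr_ge0 (p0 i) (ltW mi)).
have := entropy_ge0 FE (p i / m i)%R.
case: (F _) => [r||]//=.
  rewrite !lee_fin => _ h; have := ler_wpM2l (ltW mi) h.
  by rewrite mulrDr mulrCA [(m i * (p i / m i))%R]mulrC divfK ?gt_eqF//; lra.
by move=> _ _; rewrite gt0_muley ?lte_fin// leey.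
Qed.

(** The masses p need not be those of g. The remaining linear term exhibits [dual_value] as bounded
    by functions affine in w; it vanishes when the constraint holds. *)
Lemma weak_duality w g p : densities g -> (forall i, (0 <= p i)%R) ->
  dual_value w + (\sum_i w i * (mass g i - p i))%R%:E
    <= source_cost g + target_cost p.
Proof.
move=> dg p0; pose b := potential_bound w.
have b0 := potential_bound_ge0 w; have wb := conj_le_potential_bound w.
have := integral_shift_le (potential_measurable w b)
  (local_cost_shift_measurable b dg) (potential_ge0 b0 wb)
  (fun x => local_cost_shift_ge0 x b0 dg) (weighted_integrable w dg)
  (fun x => potential_le w x (fun i => (dg i).1 x) b).
rewrite integral_weighted// integral_local_cost_shift// -(dual_value_potential b0 wb).
have := target_cost_ge w p0.
have -> : mu setT = (fine (mu setT))%:E by rewrite fineK// fin_num_measure.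
have -> : (\sum_i w i * (mass g i - p i) = pairing w (mass g) - pairing w p)%R.
  by rewrite /pairing -sumrB; apply: eq_bigr => i _; rewrite mulrBr.
have := source_cost_ge0 dg; have := target_cost_ge0 p.
case: (source_cost g) => [s||]//; last by move=> *; rewrite addye ?leey// gt_eqF// (lt_le_trans ltNy0).
case: (target_cost p) => [t||]//; last by move=> *; rewrite addey ?leey.
move=> _ _; rewrite lee_fin.
case: (dual_value w) => [a||]; last by move=> _ _; rewrite addNye leNye.
  by rewrite -EFinM -!EFinD !lee_fin; lra.
by rewrite -EFinM !addye// -EFinD leye_eq.
Qed.

Definition best_target (w : 'I_M -> R) (i : 'I_M) : R := (m i * reply (- w i))%R.

Lemma best_target_ge0 w i : (0 <= best_target w i)%R.
Proof. by rewrite mulr_ge0 ?best_response_ge0// ltW. Qed.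

Lemma target_cost_best w : target_cost (best_target w) =
  (- (pairing w (best_target w) + \sum_i cfin (- w i) * m i))%:E.
Proof.
rewrite /pairing -big_split/= -sumrN -sumEFin; apply: eq_bigr => i _.
have mi := m0 i.
rewrite {1}/best_target mulrAC divff ?mul1r ?gt_eqF// entropy_best_response.
by rewrite -EFinM; congr EFin; rewrite /best_target; lra.
Qed.

Lemma cell_reply_ge0 w i x : (0 <= cell_reply w i x)%R.
Proof. by rewrite mulr_ge0// best_response_ge0. Qed.

(** Costs are nonnegative and replies monotone, so replies are bounded densities. The bound depends
    on w alone and later makes the gap of a comparator uniformly bounded. *)
Lemma cell_reply_le w i x : (cell_reply w i x <= reply (w i))%R.
Proof.
rewrite /cell_reply indicE; case: (_ \in _); rewrite ?mul0r ?mul1r ?best_response_ge0//.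
by apply: best_response_nd; rewrite gerBl fine_ge0.
Qed.

Lemma cell_reply_densities w : densities (cell_reply w).
Proof.
move=> i; split=> [x|]; first exact: cell_reply_ge0.
apply: (@le_integrable _ _ _ _ _ measurableT _ (EFin \o cst (reply (w i)))).
- apply/measurable_EFinP; apply: measurable_funM.
    exact/measurable_indic/measurable_first_cell.
  apply: measurableT_comp; first exact: best_response_measurable.
  by apply: measurable_funB => //; apply: measurableT_comp => //; exact: mk.
- move=> x _; rewrite !gee0_abs ?lee_fin ?cell_reply_ge0 ?best_response_ge0//.
  exact: cell_reply_le.
- exact: finite_measure_integrable_cst.
Qed.

Lemma mass_cell_reply_le w i :
  (mass (cell_reply w) i <= reply (w i) * fine (mu setT))%R.
Proof.
rewrite -lee_fin -massE; last exact: cell_reply_densities.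
apply: (@le_trans _ _ (\int[mu]_x (cst (reply (w i))%:E x))).
  apply: ge0_le_integral => //.
  - by move=> x _; rewrite lee_fin cell_reply_ge0.
  - exact/measurable_EFinP/(densities_measurable _ (cell_reply_densities w)).
  - by move=> x _; rewrite lee_fin cell_reply_le.
by rewrite integral_cst// EFinM fineK// fin_num_measure.
Qed.

(** Both Young inequalities are equalities for the replies to w. Since these may violate the mass
    constraint, the cost equals the dual value up to a linear term in the gap. *)
Lemma dual_attained w :
  dual_value w + (\sum_i w i * (mass (cell_reply w) i - best_target w i))%R%:E
  = source_cost (cell_reply w) + target_cost (best_target w).
Proof.
pose b := potential_bound w; have dg := cell_reply_densities w.
have b0 := potential_bound_ge0 w; have wb := conj_le_potential_bound w.
have := integral_shift_eq (potential_measurable w b)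
  (local_cost_shift_measurable b dg) (potential_ge0 b0 wb)
  (fun x => local_cost_shift_ge0 x b0 dg) (weighted_integrable w dg)
  (potential_reply w b).
rewrite integral_weighted// integral_local_cost_shift// -(dual_value_potential b0 wb).
rewrite target_cost_best.
have -> : mu setT = (fine (mu setT))%:E by rewrite fineK// fin_num_measure.
have -> : (\sum_i w i * (mass (cell_reply w) i - best_target w i) =
    pairing w (mass (cell_reply w)) - pairing w (best_target w))%R.
  by rewrite /pairing -sumrB; apply: eq_bigr => i _; rewrite mulrBr.
have := source_cost_ge0 dg.
case: (source_cost _) => [s||]// _; rewrite -EFinM.
  case: (dual_value w) => [a||]//=.
  by rewrite -!EFinD => -[h]; congr EFin; lra.
by case: (dual_value w).
Qed.

(** By [dual_attained] the dual value is a nonnegative source cost plus finite terms. *)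
Lemma dual_value_gtNy w : -oo < dual_value w.
Proof.
have := dual_attained w.
have := source_cost_ge0 (cell_reply_densities w).
rewrite target_cost_best.
by case: (source_cost _) => [s||]// _; case: (dual_value w) => [a||]//; rewrite ltNyr.
Qed.

(** * Convexity of the costs *)

Section mixtures.
Variable t : R.
Hypothesis t01 : (0 <= t <= 1)%R.

Definition mix (I : Type) (a b : I -> R) (i : I) : R := (t * a i + (1 - t) * b i)%R.
Definition mixf (I : Type) (g h : I -> T -> R) (i : I) (x : T) : R :=
  (t * g i x + (1 - t) * h i x)%R.

Let t0 : (0 <= t)%R. Proof. by case/andP: t01. Qed.
Let t1 : (0 <= 1 - t)%R. Proof. by case/andP: t01 => _; rewrite subr_ge0. Qed.

Lemma mix_ge0 (p q : 'I_M -> R) : (forall i, (0 <= p i)%R) ->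
  (forall i, (0 <= q i)%R) -> forall i, (0 <= mix p q i)%R.
Proof. by move=> p0 q0 i; rewrite addr_ge0 ?mulr_ge0. Qed.

Lemma mixf_densities g h : densities g -> densities h -> densities (mixf g h).
Proof.
move=> dg dh i; split=> [x|].
  by apply: addr_ge0; apply: mulr_ge0 => //; [exact: (dg i).1|exact: (dh i).1].
rewrite (_ : _ \o _ = (fun x => t%:E * (EFin \o g i) x) \+
                      (fun x => (1 - t)%:E * (EFin \o h i) x)); last first.
  by apply/funext => x /=; rewrite -!EFinM -EFinD.
by apply: integrableD => //; apply: integrableZl => //; [exact: (dg i).2|exact: (dh i).2].
Qed.

Lemma mass_mixf g h i : densities g -> densities h ->
  mass (mixf g h) i = (t * mass g i + (1 - t) * mass h i)%R.
Proof.
move=> dg dh; apply: EFin_inj; rewrite -massE; last exact: mixf_densities.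
under eq_integral do rewrite EFinD !EFinM.
have ig := (dg i).2; have ih := (dh i).2.
by rewrite integralD ?integralZl// ?EFinD ?EFinM ?massE//; exact: integrableZl.
Qed.

Lemma entropy_mix a b :
  F (t * a + (1 - t) * b)%R <= t%:E * F a + (1 - t)%:E * F b.
Proof. exact: (entropy_convex FE). Qed.

Lemma local_cost_mix (g h : 'I_M -> R) x : (forall i, (0 <= g i)%R) ->
  (forall i, (0 <= h i)%R) ->
  local_cost (mix g h) x <= t%:E * local_cost g x + (1 - t)%:E * local_cost h x.
Proof.
move=> g0 h0; rewrite /local_cost.
have kg0 (u : 'I_M -> R) : (forall i, (0 <= u i)%R) -> forall i, 0 <= k i x * (u i)%:E.
  by move=> u0 i; rewrite mule_ge0// lee_fin.
rewrite !ge0_muleDr ?(entropy_ge0 FE) ?sume_ge0//; do ?[by move=> i _; exact: kg0].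
rewrite addeACA leeD//; last first.
  by rewrite big_split/= -!mulr_sumr entropy_mix.
rewrite !ge0_sume_distrr//; do ?[by move=> i _; exact: kg0].
rewrite -big_split/=; apply: lee_sum => i _.
by rewrite EFinD ge0_muleDr ?lee_fin ?mulr_ge0// !EFinM muleCA (muleCA (k i x)).
Qed.

Lemma source_cost_mix g h : densities g -> densities h ->
  source_cost (mixf g h) <= t%:E * source_cost g + (1 - t)%:E * source_cost h.
Proof.
move=> dg dh.
have mm u : densities u -> measurable_fun setT (fun x => local_cost (u ^~ x) x).
  by move=> du; apply: local_cost_measurable => i; exact: densities_measurable.
have c0 u x : densities u -> 0 <= local_cost (u ^~ x) x.
  by move=> du; apply: local_cost_ge0 => i; exact: (du i).1.
rewrite -!ge0_integralZl_EFin//; do ?[by move=> x _; exact: c0]; do ?exact: mm.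
rewrite -ge0_integralD//; do ?[by move=> x _; rewrite mule_ge0// c0];
  do ?[by apply: measurable_funeM; exact: mm].
apply: ge0_le_integral => //.
- by move=> x _; apply: c0; exact: mixf_densities.
- exact/mm/mixf_densities.
- by apply: emeasurable_funD; apply: measurable_funeM; exact: mm.
- by move=> x _; apply: local_cost_mix => i; [exact: (dg i).1|exact: (dh i).1].
Qed.

Lemma target_cost_mix p q :
  target_cost (mix p q) <= t%:E * target_cost p + (1 - t)%:E * target_cost q.
Proof.
have mF i a : 0 <= (m i)%:E * F a.
  by rewrite mule_ge0 ?(entropy_ge0 FE)// lee_fin ltW.
rewrite !ge0_sume_distrr//; do ?[by move=> i _; exact: mF].
rewrite -big_split/=; apply: lee_sum => i _.
rewrite [(mix p q i / m i)%R](_ : _ = t * (p i / m i) + (1 - t) * (q i / m i))%R; last first.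
  by rewrite /mix; ring.
rewrite muleCA (muleCA (1 - t)%:E) -ge0_muleDr ?mule_ge0 ?(entropy_ge0 FE) ?lee_fin//.
by rewrite lee_wpmul2l ?entropy_mix// lee_fin ltW.
Qed.

End mixtures.

Definition feasible g p := [/\ densities g, forall i, (0 <= p i)%R &
  source_cost g + target_cost p < +oo].
Definition total_cost g p : R := fine (source_cost g + target_cost p).
Definition gap g (p : 'I_M -> R) i : R := (mass g i - p i)%R.
Definition sqnorm (r : 'I_M -> R) : R := (\sum_i r i ^+ 2)%R.

Lemma sqnorm_ge0 r : (0 <= sqnorm r)%R.
Proof. by apply: sumr_ge0 => i _; rewrite sqr_ge0. Qed.

Lemma total_costE g p : feasible g p ->
  source_cost g + target_cost p = (total_cost g p)%:E.
Proof.
by move=> [dg p0 fin]; rewrite fineK// ge0_fin_numE// adde_ge0 ?source_cost_ge0 ?target_cost_ge0.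
Qed.

Lemma total_cost_ge0 g p : feasible g p -> (0 <= total_cost g p)%R.
Proof. by move=> [dg p0 _]; rewrite fine_ge0// adde_ge0 ?source_cost_ge0 ?target_cost_ge0. Qed.

Lemma total_cost_mix_le t g p h q : (0 <= t <= 1)%R -> feasible g p -> feasible h q ->
  source_cost (mixf t g h) + target_cost (mix t p q) <=
  (t * total_cost g p + (1 - t) * total_cost h q)%:E.
Proof.
move=> t01 fg fh; have [dg p0 _] := fg; have [dh q0 _] := fh.
have [t0 t1] := andP t01.
have := leeD (source_cost_mix t01 dg dh) (target_cost_mix t01 p q).
move=> /le_trans; apply.
rewrite [leRHS]EFinD !EFinM -!total_costE//.
rewrite (ge0_muleDr _ (source_cost_ge0 dg) (target_cost_ge0 p)).
by rewrite (ge0_muleDr _ (source_cost_ge0 dh) (target_cost_ge0 q)) addeACA.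
Qed.

Lemma feasible_mix t g p h q : (0 <= t <= 1)%R -> feasible g p -> feasible h q ->
  feasible (mixf t g h) (mix t p q).
Proof.
move=> t01 fg fh; have [dg p0 _] := fg; have [dh q0 _] := fh; split.
- exact: mixf_densities.
- exact: mix_ge0.
- by apply: le_lt_trans (total_cost_mix_le t01 fg fh) _; rewrite ltry.
Qed.

Lemma total_cost_mix t g p h q : (0 <= t <= 1)%R -> feasible g p -> feasible h q ->
  (total_cost (mixf t g h) (mix t p q) <=
   t * total_cost g p + (1 - t) * total_cost h q)%R.
Proof.
move=> t01 fg fh; rewrite -lee_fin -total_costE; last exact: feasible_mix.
exact: total_cost_mix_le.
Qed.

Lemma gap_mix t g p h q i : (0 <= t <= 1)%R -> densities g -> densities h ->
  gap (mixf t g h) (mix t p q) i = (t * gap g p i + (1 - t) * gap h q i)%R.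
Proof. by move=> t01 dg dh; rewrite /gap mass_mixf// /mix; ring. Qed.

(** * Strong duality by penalization and compactness *)

Section strong_duality.
Variable S : R.
Hypothesis dual_le : forall w, dual_value w <= S%:E.

Lemma comparator w : feasible (cell_reply w) (best_target w) /\
  (total_cost (cell_reply w) (best_target w) <=
   S + \sum_i w i * gap (cell_reply w) (best_target w) i)%R.
Proof.
have fw : feasible (cell_reply w) (best_target w).
  split; [exact: cell_reply_densities|by move=> i; exact: best_target_ge0|].
  rewrite -(dual_attained) lte_add_pinfty ?ltry//.
  by apply: le_lt_trans (dual_le w) _; rewrite ltry.
split=> //; rewrite -lee_fin -(total_costE fw) -(dual_attained) EFinD.
by rewrite leeD2r.
Qed.

(** The bound depends on w only through b, so the second-order term in [penalized_primal] has a
    constant independent of the near minimizer. *)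
Lemma comparator_gap w b i : (forall j, `|w j| <= b)%R ->
  (`|gap (cell_reply w) (best_target w) i| <=
   reply b * (fine (mu setT) + \sum_j m j))%R.
Proof.
move=> wb; have rb := best_response_ge0 FE b.
have := wb i; rewrite ler_norml => /andP[wb1 wb2].
have mS : (m i <= \sum_j m j)%R.
  by rewrite (bigD1 i)//= lerDl sumr_ge0// => j _; exact: ltW.
have mT : (0 <= fine (mu setT))%R by exact/fine_ge0.
have q0 := mass_ge0 i (cell_reply_densities w).
have p0 := best_target_ge0 w i.
have q1 : (mass (cell_reply w) i <= reply b * fine (mu setT))%R.
  apply: le_trans (mass_cell_reply_le w i) _.
  by rewrite ler_wpM2r// best_response_nd.
have p1 : (best_target w i <= reply b * \sum_j m j)%R.
  rewrite mulrC /best_target; apply: ler_pM => //; [exact: ltW|exact: best_response_ge0|].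
  by apply: best_response_nd; lra.
rewrite mulrDr ler_norml /gap; apply/andP; split; first by nra.
by nra.
Qed.

(* With w := kappa * (p - q) for a near minimizer with masses (q, p) of the
   penalized cost, a first-order expansion along the segment to the comparator
   of w shows that the penalized infimum is below [dual_value w]. *)
Lemma penalized_primal (kappa delta : R) : (0 < kappa)%R -> (0 < delta)%R ->
  exists g p, feasible g p /\
    (total_cost g p + kappa / 2 * sqnorm (gap g p) <= S + delta)%R.
Proof.
move=> kappa0 delta0.
pose pen g p := (total_cost g p + kappa / 2 * sqnorm (gap g p))%R.
pose A := [set e | exists g p, feasible g p /\ e = pen g p].
have pen0 g p : feasible g p -> (0 <= pen g p)%R.
  move=> fg; rewrite addr_ge0 ?total_cost_ge0// mulr_ge0 ?sqnorm_ge0// divr_ge0//.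
  exact: ltW.
have Ane : A !=set0.
  have [f0 _] := comparator (fun=> 0%R).
  by exists (pen (cell_reply (fun=> 0%R)) (best_target (fun=> 0%R))); do 2 eexists; split; first exact: f0.
have Alb : has_lbound A by exists 0%R => e [g [p [fg ->]]]; exact: pen0.
have Ainf : has_inf A by split.
pose V := inf A.
have V0 : (0 <= V)%R by apply: lb_le_inf => // e [g [p [fg ->]]]; exact: pen0.
suff VS : (V <= S)%R.
  have [e [g [p [fg ->]]] he] := inf_adherent delta0 Ainf.
  by exists g, p; split=> //; rewrite -/(pen g p); move: he; rewrite -/V; lra.
rewrite leNgt; apply/negP => SV.
(* For a near minimizer with gap r: c bounds [sqnorm r], b the weights kappa * |r i|, and D the
   distance from r to the gap of the comparator. None depends on the minimizer, so eta and t can be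
   chosen afterwards. *)
pose c := (2 * (V + 1) / kappa)%R.
have c0 : (0 <= c)%R by rewrite /c divr_ge0 ?ltW//; lra.
pose b := (kappa * (1 + c))%R.
pose D := (reply b * (fine (mu setT) + \sum_j m j) + (1 + c))%R.
pose D2 := (\sum_(i < M) D ^+ 2)%R.
have D20 : (0 <= D2)%R by apply: sumr_ge0 => i _; rewrite sqr_ge0.
have key eta t : (0 < eta)%R -> (eta < 1)%R -> (0 < t)%R -> (t <= 1)%R ->
    (V <= V + eta + t * (S - V) + t ^+ 2 * (kappa / 2 * D2))%R.
  move=> eta0 eta1 t0 t1.
  have [e [g [p [fg ->]]] he] := inf_adherent eta0 Ainf.
  rewrite -/V in he.
  pose r := gap g p; pose w i := (- (kappa * r i))%R.
  have sqr_r : (kappa / 2 * sqnorm r <= V + 1)%R.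
    by have := total_cost_ge0 fg; move: he; rewrite /pen -/r; lra.
  have rb i : (`|r i| <= 1 + c)%R.
    have ri : (r i ^+ 2 <= c)%R.
      rewrite /c ler_pdivlMr//.
      have : (r i ^+ 2 <= sqnorm r)%R.
        by rewrite /sqnorm (bigD1 i)//= lerDl sumr_ge0// => j _; rewrite sqr_ge0.
      by move=> h; have := ler_wpM2l (ltW kappa0) h; lra.
    have := sqr_ge0 (`|r i| - 1)%R; rewrite sqrrB1 real_normK ?num_real//.
    by have := normr_ge0 (r i); lra.
  have wb i : (`|w i| <= b)%R.
    by rewrite /w normrN normrM (gtr0_norm kappa0) ler_pM2l.
  have [fw cw] := comparator w.
  set g' := cell_reply w in fw cw; set p' := best_target w in fw cw.
  pose r' := gap g' p'; rewrite -/r' in cw.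
  have r'b i : (`|r' i - r i| <= D)%R.
    apply: le_trans (ler_normB _ _) _; apply: lerD; last exact: rb.
    exact: comparator_gap.
  have t01 : (0 <= 1 - t <= 1)%R by lra.
  have fm := feasible_mix t01 fg fw.
  have Vm : (V <= pen (mixf (1 - t) g g') (mix (1 - t) p p'))%R.
    by apply: inf_lbound => //; do 2 eexists; split; first exact: fm.
  apply: le_trans Vm _; rewrite /pen.
  have cm := total_cost_mix t01 fg fw.
  have -> : sqnorm (gap (mixf (1 - t) g g') (mix (1 - t) p p')) =
     (sqnorm r + 2 * t * (\sum_i r i * (r' i - r i)) +
      t ^+ 2 * sqnorm (fun i => r' i - r i))%R.
    rewrite /sqnorm !mulr_sumr -!big_split/=; apply: eq_bigr => i _.
    rewrite gap_mix//; [|by case: fg|by case: fw].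
    by rewrite -/r -/r'; ring.
  have sqd : (sqnorm (fun i => r' i - r i)%R <= D2)%R.
    apply: ler_sum => i _; rewrite -[X in (X <= _)%R]real_normK ?num_real//.
    by rewrite lerXn2r// nnegrE// (le_trans _ (r'b i)).
  (* The choice w = - kappa r makes the term w . r' in the comparator's cost cancel against the
     derivative of the penalty; what remains is a slope of at most S - V. *)
  have lin : (kappa * (\sum_i r i * (r' i - r i)) =
     - \sum_i w i * r' i - kappa * sqnorm r)%R.
    rewrite /sqnorm !mulr_sumr -sumrN -sumrB; apply: eq_bigr => i _.
    by rewrite /w; ring.
  have t2 : (t ^+ 2 * (kappa / 2 * sqnorm (fun i => r' i - r i)) <=
             t ^+ 2 * (kappa / 2 * D2))%R.
    by rewrite ler_wpM2l ?sqr_ge0// ler_wpM2l// divr_ge0// ltW.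
  have tc : (t * total_cost g' p' <= t * (S + \sum_i w i * r' i))%R.
    by rewrite ler_wpM2l// ltW.
  have tV : (t * (- total_cost g p - kappa * sqnorm r) <= - t * V)%R.
    rewrite mulNr -mulrN; apply: ler_wpM2l; first exact: ltW.
    have := mulr_ge0 (ltW kappa0) (sqnorm_ge0 r) => s0.
    have : (V <= pen g p)%R by apply: inf_lbound => //; exists g, p.
    by rewrite /pen -/r; lra.
  move: he cm t2 tc tV lin; rewrite /pen -/r.
  rewrite subKr.
  set X := (\sum_i r i * (r' i - r i))%R; set Y := (\sum_i w i * r' i)%R.
  move=> he cm t2 tc tV lin.
  have lin' : (t * (kappa * X) = t * (- Y - kappa * sqnorm r))%R by rewrite lin.
  lra.
(* With this t the quadratic term consumes at most half of the gain t (V - S), and eta below at most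
   a quarter, so V would be strictly smaller than itself. *)
pose q := (kappa * D2 + 1)%R.
have q0 : (0 < q)%R by rewrite /q ltr_wpDl// mulr_ge0// ltW.
pose t := Num.min 1%R ((V - S) / q)%R.
have t0 : (0 < t)%R by rewrite lt_min ltr01 divr_gt0// subr_gt0.
have t1 : (t <= 1)%R by rewrite ge_min lexx.
have tq : (t * (kappa / 2 * D2) <= (V - S) / 2)%R.
  have : (t <= (V - S) / q)%R by rewrite ge_min lexx orbT.
  by rewrite ler_pdivlMr// /q => h; nra.
pose eta := Num.min (2^-1)%R (t * (V - S) / 4)%R.
have eta0 : (0 < eta)%R by rewrite lt_min invr_gt0 ltr0n/= divr_gt0// mulr_gt0// subr_gt0.
have eta1 : (eta < 1)%R by rewrite gt_min invf_lt1// ltr1n.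
have eta2 : (eta <= t * (V - S) / 4)%R by rewrite ge_min lexx orbT.
have := key eta t eta0 eta1 t0 t1.
have : (t * (t * (kappa / 2 * D2)) <= t * ((V - S) / 2))%R by rewrite ler_wpM2l// ltW.
have : (0 < t * (V - S))%R by rewrite mulr_gt0// subr_gt0.
by move=> h1 h2 h3; nra.
Qed.

Definition near_optimal n g p := [/\ feasible g p,
  (total_cost g p <= S + n.+1%:R^-1)%R &
  forall i, (`|gap g p i| <= n.+1%:R^-1)%R].

Lemma near_optimal_ex n : exists g p, near_optimal n g p.
Proof.
pose N : R := n.+1%:R; have N0 : (0 < N)%R by rewrite ltr0n.
have N1 : (N^-1 <= 1)%R by rewrite invf_le1// ler1n.
(* As the total cost is nonnegative, the penalty is at most |S| + 1, and this kappa turns that into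
   (N * gap)^2 <= 1. *)
pose kappa := (2 * ((`|S| + 1) * N ^+ 2))%R.
have S1 : (0 < `|S| + 1)%R by rewrite ltr_wpDl.
have kappa0 : (0 < kappa)%R by rewrite mulr_gt0// mulr_gt0// exprn_gt0.
have Ni : (0 < N^-1)%R by rewrite invr_gt0.
have [g [p [fg h]]] := penalized_primal kappa0 Ni.
have t0 := total_cost_ge0 fg; have s0 := sqnorm_ge0 (gap g p).
exists g, p; split=> //.
  by apply: le_trans h; rewrite lerDl mulr_ge0// divr_ge0// ltW.
move=> i; rewrite -/N.
have gi : (gap g p i ^+ 2 <= sqnorm (gap g p))%R.
  by rewrite /sqnorm (bigD1 i)//= lerDl sumr_ge0// => j _; rewrite sqr_ge0.
have : ((`|S| + 1) * (N * gap g p i) ^+ 2 <= (`|S| + 1) * 1)%R.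
  have : (kappa / 2 * gap g p i ^+ 2 <= kappa / 2 * sqnorm (gap g p))%R.
    by rewrite ler_wpM2l// divr_ge0// ltW.
  have -> : (kappa / 2 * gap g p i ^+ 2 = (`|S| + 1) * (N * gap g p i) ^+ 2)%R.
    by rewrite /kappa; field.
  move: h N1; have := ler_norm S; move: (N^-1)%R (kappa / 2 * sqnorm (gap g p))%R => e y.
  by move: (_ * (N * _) ^+ 2)%R => z; lra.
rewrite ler_pM2l// => yle; rewrite -(ler_pM2l N0) mulfV ?gt_eqF//.
rewrite -[X in (X * _)%R](gtr0_norm N0) -normrM.
by move: yle; move: (N * gap g p i)%R => y y1; rewrite ler_norml; apply/andP; split; nra.
Qed.

Lemma near_optimal_weaken n n' g p : (n <= n')%N ->
  near_optimal n' g p -> near_optimal n g p.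
Proof.
move=> nn' [fg cg gg].
have h : (n'.+1%:R^-1 <= n.+1%:R^-1 :> R)%R by rewrite lef_pV2 ?posrE// ler_nat.
split=> // [|i]; first by apply: le_trans cg _; rewrite lerD2l.
exact: le_trans (gg i) h.
Qed.

Lemma half01 : (0 <= (2^-1 : R) <= 1)%R.
Proof. by apply/andP; split; lra. Qed.

Lemma near_optimal_mid n g p h q : near_optimal n g p -> near_optimal n h q ->
  near_optimal n (mixf 2^-1 g h) (mix 2^-1 p q).
Proof.
move=> [fg cg gg] [fh ch gh]; split.
- exact: feasible_mix half01 fg fh.
- have := total_cost_mix half01 fg fh.
  by move: cg ch; move: (n.+1%:R^-1)%R => e; lra.
- move=> i; rewrite (gap_mix _ _ _ half01); [|by case: fg|by case: fh].
  have := gg i; have := gh i; rewrite !ler_norml.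
  by move: (n.+1%:R^-1)%R => e /andP[? ?] /andP[? ?]; apply/andP; split; lra.
Qed.

Definition inverse1 (g : 'I_M -> T -> R) i x : R := (1 + g i x)^-1.
(** A strictly convex functional with values between 0 and M * mu(T) on all densities, so that no
    integrability beyond L^1 is required. *)
Definition spread g : R := (\sum_i \int[mu]_x (inverse1 g i x))%R.

Lemma inverse1_bounds g i x : densities g -> (0 < inverse1 g i x <= 1)%R.
Proof.
move=> dg; have h : (1 <= 1 + g i x)%R by rewrite lerDl; exact: (dg i).1.
by rewrite invr_gt0 (lt_le_trans _ h)//= invf_le1// (lt_le_trans _ h).
Qed.

Lemma measurable_inverse1 g i : densities g -> measurable_fun setT (inverse1 g i).
Proof.
move=> dg.
rewrite (_ : inverse1 g i = (fun y : R => (Num.max 1 y)^-1)%R \o (fun x => 1 + g i x)%R); last first.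
  by apply/funext => x; rewrite /inverse1 /= max_r// lerDl; exact: (dg i).1.
apply: measurableT_comp; last by apply: measurable_funD => //; exact: densities_measurable.
apply: nonincreasing_measurable => // x y xy.
rewrite lef_pV2 ?posrE ?lt_max ?ltr01//.
by rewrite ge_max !le_max lexx xy orbT.
Qed.

Lemma bounded_integrable (u : T -> R) (b : R) : measurable_fun setT u ->
  (forall x, `|u x| <= b)%R -> mu.-integrable setT (EFin \o u).
Proof.
move=> mfu ub; apply: (@le_integrable _ _ _ _ _ measurableT _ (EFin \o cst b)).
- exact/measurable_EFinP.
- move=> x _; rewrite /= lee_fin [leRHS]ger0_norm//.
  exact: le_trans (normr_ge0 _) (ub x).
- exact: finite_measure_integrable_cst.
Qed.

Lemma inverse1_integrable g i : densities g ->
  mu.-integrable setT (EFin \o inverse1 g i).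
Proof.
move=> dg; apply: (@bounded_integrable _ 1%R); first exact: measurable_inverse1.
by move=> x; have /andP[h1 h2] := inverse1_bounds i x dg; rewrite gtr0_norm.
Qed.

Lemma sqr_inverse1_integrable g h i : densities g -> densities h ->
  mu.-integrable setT (EFin \o (fun x => (inverse1 g i x - inverse1 h i x) ^+ 2)%R).
Proof.
move=> dg dh; apply: (@bounded_integrable _ 1%R).
  by apply: measurable_funX; apply: measurable_funB; exact: measurable_inverse1.
move=> x; have /andP[? ?] := inverse1_bounds i x dg.
have /andP[? ?] := inverse1_bounds i x dh.
by rewrite ger0_norm ?sqr_ge0//; nra.
Qed.

Lemma spread_ge0 g : densities g -> (0 <= spread g)%R.
Proof.
move=> dg; apply: sumr_ge0 => i _; apply: Rintegral_ge0 => x _.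
by have /andP[/ltW] := inverse1_bounds i x dg.
Qed.

Lemma spread_le g : densities g -> (spread g <= \sum_(i < M) fine (mu setT))%R.
Proof.
move=> dg; apply: ler_sum => i _; rewrite -[leRHS]mul1r -Rintegral_cst//.
apply: le_Rintegral => //.
- exact: inverse1_integrable.
- exact: finite_measure_integrable_cst.
- by move=> x _; have /andP[_] := inverse1_bounds i x dg.
Qed.

(** Strict convexity of the inverse, quantified by the distance of the inverses themselves. The
    defect has the factor 2ab - a - b = a(b - 1) + b(a - 1), nonnegative for a, b >= 1: hence the 1
    in 1 + g. *)
Lemma inverse_midpoint (a b : R) : (1 <= a)%R -> (1 <= b)%R ->
  (4^-1 * (a^-1 - b^-1) ^+ 2 <= 2^-1 * a^-1 + 2^-1 * b^-1 - (2^-1 * a + 2^-1 * b)^-1)%R.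
Proof.
move=> a1 b1.
have a0 : (0 < a)%R by lra.
have b0 : (0 < b)%R by lra.
have d0 : (0 < a ^+ 2 * b ^+ 2 * (a + b))%R by rewrite !mulr_gt0 ?exprn_gt0 ?addr_gt0.
rewrite -subr_ge0.
rewrite (_ : _ - _ = (a - b) ^+ 2 * (2 * a * b - a - b) / (4 * (a ^+ 2 * b ^+ 2 * (a + b))))%R; last first.
  by field; rewrite !gt_eqF//= ?addr_gt0.
have ab : (0 <= a * (b - 1) + b * (a - 1))%R by rewrite addr_ge0 ?mulr_ge0; lra.
apply: divr_ge0; last by rewrite mulr_ge0// ltW.
by apply: mulr_ge0; [exact: sqr_ge0|lra].
Qed.

Lemma spread_mid g h : densities g -> densities h ->
  (\sum_i \int[mu]_x ((inverse1 g i x - inverse1 h i x) ^+ 2) <=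
   4 * (2^-1 * spread g + 2^-1 * spread h - spread (mixf 2^-1 g h)))%R.
Proof.
move=> dg dh; rewrite /spread !mulr_sumr -big_split/= -sumrB mulr_sumr.
apply: ler_sum => i _.
have dm := mixf_densities half01 dg dh.
have [ig ih im] := And3 (inverse1_integrable i dg) (inverse1_integrable i dh)
  (inverse1_integrable i dm).
have iZ u (r : R) : mu.-integrable setT (EFin \o u) ->
    mu.-integrable setT (EFin \o (fun x => r * u x)%R).
  by move=> iu; exact: (integrableZl measurableT r iu).
have iD u v : mu.-integrable setT (EFin \o u) -> mu.-integrable setT (EFin \o v) ->
    mu.-integrable setT (EFin \o (fun x => u x + v x)%R).
  by move=> iu iv; exact: (integrableD measurableT iu iv).
have iB u v : mu.-integrable setT (EFin \o u) -> mu.-integrable setT (EFin \o v) ->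
    mu.-integrable setT (EFin \o (fun x => u x - v x)%R).
  by move=> iu iv; exact: (integrableB measurableT iu iv).
rewrite -!RintegralZl// -RintegralD//; do ?exact: iZ.
rewrite -RintegralB//; last by apply: iD; exact: iZ.
rewrite -RintegralZl//; last by apply: iB => //; apply: iD; exact: iZ.
apply: le_Rintegral => //.
- exact: sqr_inverse1_integrable.
- by apply: (iZ); apply: iB => //; apply: iD; exact: iZ.
move=> x _; rewrite -ler_pdivrMl//.
have g1 : (1 <= 1 + g i x)%R by rewrite lerDl; exact: (dg i).1.
have h1 : (1 <= 1 + h i x)%R by rewrite lerDl; exact: (dh i).1.
have := inverse_midpoint g1 h1; rewrite /inverse1 /mixf.
by rewrite (_ : 2^-1 * (1 + g i x) + 2^-1 * (1 + h i x) =
  1 + (2^-1 * g i x + (1 - 2^-1) * h i x))%R; last by field.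
Qed.

(** Let J be the supremum over n of the least spread among pairs near optimal to order n. Two pairs
    with spread at most J + e whose midpoint has spread at least J - e are close by [spread_mid]: 4
    ((J + e) - (J - e)) = 8 e. *)
Lemma minimizing_sequence :
  exists (g : nat -> 'I_M -> T -> R) (p : nat -> 'I_M -> R),
    (forall n, near_optimal n (g n) (p n)) /\
    (forall n i, \int[mu]_x ((inverse1 (g n) i x - inverse1 (g n.+1) i x) ^+ 2)%:E
       <= (8 * 8^-1 ^+ n)%:E).
Proof.
pose K n := [set e | exists g p, near_optimal n g p /\ e = spread g].
pose j n := inf (K n).
pose B : R := (\sum_(i < M) fine (mu setT))%R.
have Klb n : has_lbound (K n).
  by exists 0%R => e [g [p [[[dg _ _] _ _] ->]]]; exact: spread_ge0.
have Kne n : K n !=set0.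
  by have [g [p gp]] := near_optimal_ex n; exists (spread g), g, p.
have jle n g p : near_optimal n g p -> (j n <= spread g)%R.
  by move=> gp; apply: ge_inf => //; exists g, p.
have jub : has_ubound (range j).
  exists B => _ [n _ <-]; have [g [p gp]] := near_optimal_ex n.
  by apply: le_trans (jle _ _ _ gp) _; apply: spread_le; case: gp => -[].
have jsup : has_sup (range j) by split=> //; exists (j 0%N), 0%N.
pose J := sup (range j).
pose e n : R := (8^-1 ^+ n)%R.
have e0 n : (0 < e n)%R by rewrite exprn_gt0// invr_gt0.
(* An order at which the infimum exceeds J - e N0 is raised to at least N0; the infimum can only
   grow, since near optimality weakens as the order decreases. *)
have step N0 : exists gpN : ('I_M -> T -> R) * ('I_M -> R) * nat,
    [/\ (N0 <= gpN.2)%N, near_optimal gpN.2 gpN.1.1 gpN.1.2,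
      (spread gpN.1.1 <= J + e N0)%R &
      forall h q, near_optimal gpN.2 h q -> (J - e N0 <= spread h)%R].
  have [_ [n _ <-] jn] := sup_adherent (e0 N0) jsup.
  have [_ [g [p [gp ->]]] gj] := inf_adherent (e0 N0) (conj (Kne (maxn n N0)) (Klb (maxn n N0))).
  exists (g, p, maxn n N0); split=> //=; first by rewrite leq_maxr.
    apply: le_trans (ltW gj) _; rewrite lerD2r -/(j _).
    by apply: sup_ubound => //; exists (maxn n N0).
  move=> h q hq; apply: le_trans (ltW jn) _.
  by apply: (jle _ _ q); apply: near_optimal_weaken hq; rewrite leq_maxl.
have [s sP] := choice step.
exists (fun n => (s n).1.1), (fun n => (s n).1.2); split=> [n|n i].
  by have [kn gp _ _] := sP n; exact: near_optimal_weaken gp.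
have [_ gp gs gm] := sP n; have [_ gp' gs' gm'] := sP n.+1.
set N := (s n).2 in gp gm; set N' := (s n.+1).2 in gp' gm'.
set g := (s n).1.1 in gp gs *; set g' := (s n.+1).1.1 in gp' gs' *.
have dg : densities g by case: gp => -[].
have dg' : densities g' by case: gp' => -[].
have e1 : (e n.+1 <= e n)%R.
  by rewrite /e exprS ler_piMl ?exprn_ge0// invf_le1// ler1n.
(* The midpoint is near optimal to the smaller of the two orders, which need not belong to the
   smaller index. *)
have mid : (J - e n <= spread (mixf 2^-1 g g'))%R.
  have [NN|NN] := leqP N N'.
    by apply: gm; exact: near_optimal_mid gp (near_optimal_weaken NN gp').
  apply: (@le_trans _ _ (J - e n.+1)%R); first by rewrite lerD2l lerN2.
  by apply: gm'; exact: near_optimal_mid (near_optimal_weaken (ltnW NN) gp) gp'.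
have := spread_mid dg dg'.
have isq := sqr_inverse1_integrable i dg dg'.
rewrite -[X in X <= _]fineK; last exact: integrable_fin_num isq.
rewrite lee_fin => sm.
apply: (@le_trans _ _ (\sum_i \int[mu]_x ((inverse1 g i x - inverse1 g' i x) ^+ 2))%R).
  rewrite (bigD1 i)//= lerDl; apply: sumr_ge0 => l _.
  by apply: Rintegral_ge0 => x _; exact: sqr_ge0.
apply: le_trans sm _; rewrite -/(e n).
by move: gs gs' mid e1; move: (spread _) (spread g) (spread g') (e n) (e n.+1) => a b c d f; lra.
Qed.

(** Uniform integrability in the manner of de la Vallee Poussin: above the level L a density is
    dominated by a small multiple of the cost, because F is superlinear. *)
Lemma mass_truncation (eps K : R) : (0 < eps)%R -> (0 <= K)%R ->
  exists2 L : R, (0 <= L)%R & forall h i, densities h -> source_cost h <= K%:E ->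
    (mass h i <= \int[mu]_x Num.min (h i x) L + eps)%R.
Proof.
(* This slope gives 2 / a * K = eps * K / (K + 1) <= eps. With L = 2 C / a below, s > L implies C <
   a s / 2, hence F s >= a s / 2. *)
move=> eps0 K0; pose a := (2 * (K + 1) / eps)%R.
have a0 : (0 < a)%R by apply: divr_gt0 => //; lra.
have [C C0 FC] := entropy_superlinear_bound FE a.
pose L := (2 * C / a)%R.
have L0 : (0 <= L)%R by apply: divr_ge0; lra.
exists L => // h i dh hK.
have h0 l x : (0 <= h l x)%R by exact: (dh l).1.
have mm : measurable_fun setT (fun x => Num.min (h i x) L).
  by apply: measurable_minr => //; exact: densities_measurable.
have min0 x : (0 <= Num.min (h i x) L)%R by rewrite le_min h0.
have im : mu.-integrable setT (EFin \o (fun x => Num.min (h i x) L)).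
  apply: (@bounded_integrable _ L mm) => x; rewrite ger0_norm//.
  by rewrite ge_min lexx orbT.
have mlc : measurable_fun setT (fun x => local_cost (h ^~ x) x).
  by apply: local_cost_measurable => l; exact: densities_measurable.
have lc0 x : 0 <= local_cost (h ^~ x) x by exact: local_cost_ge0.
have a20 : (0 <= 2 / a)%R by rewrite divr_ge0// ltW.
have pt x : (h i x)%:E <= (Num.min (h i x) L)%:E + (2 / a)%:E * local_cost (h ^~ x) x.
  have hs : (h i x <= \sum_l h l x)%R by rewrite (bigD1 i)//= lerDl sumr_ge0.
  have [hL|Lh] := leP (h i x) L.
    by rewrite leeDl// mule_ge0// lee_fin divr_ge0// ltW.
  apply: (@le_trans _ _ ((2 / a)%:E * local_cost (h ^~ x) x)); last by rewrite leeDr// lee_fin.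
  apply: (@le_trans _ _ ((2 / a)%:E * F (\sum_l h l x)%R)); last first.
    apply: lee_wpmul2l; first by rewrite lee_fin.
    rewrite /local_cost leeDr// sume_ge0// => l _.
    by rewrite mule_ge0// lee_fin.
  have := FC (\sum_l h l x)%R (sumr_ge0 _ (fun l _ => h0 l x)).
  have := entropy_ge0 FE (\sum_l h l x)%R.
  case: (F _) => [r _|_ _|//]; last by rewrite gt0_muley ?leey// lte_fin divr_gt0.
  rewrite -EFinM !lee_fin => ar.
  apply: (le_trans hs); rewrite mulrAC ler_pdivlMr//.
  have : (L * a < h i x * a)%R by rewrite ltr_pM2r.
  rewrite /L divfK ?gt_eqF// => CL.
  have : (h i x * a <= (\sum_l h l x) * a)%R by rewrite ler_pM2r.
  by move: ar; move: (\sum_l h l x)%R => s; lra.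
rewrite -lee_fin -massE//.
apply: (@le_trans _ _ (\int[mu]_x ((Num.min (h i x) L)%:E + (2 / a)%:E * local_cost (h ^~ x) x))).
  apply: ge0_le_integral => //.
  - by move=> x _; rewrite lee_fin.
  - by apply/measurable_EFinP; exact: densities_measurable.
  - by apply: emeasurable_funD; [exact/measurable_EFinP|exact: measurable_funeM].
rewrite ge0_integralD//; last 4 first.
- by move=> x _; rewrite lee_fin.
- exact/measurable_EFinP.
- by move=> x _; rewrite mule_ge0.
- exact: measurable_funeM.
rewrite ge0_integralZl_EFin// EFinD; apply: leeD.
  by rewrite /Rintegral fineK//; exact: integrable_fin_num im.
apply: (@le_trans _ _ ((2 / a)%:E * K%:E)); first by rewrite lee_wpmul2l.
rewrite -EFinM lee_fin /a.
rewrite (_ : 2 / (2 * (K + 1) / eps) * K = eps * (K / (K + 1)))%R; last first.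
  by field; rewrite !gt_eqF//= ltr_wpDl.
have K1 : (0 < K + 1)%R by lra.
by apply: ler_piMr; [exact: ltW|rewrite ler_pdivrMr// mul1r; lra].
Qed.

Lemma sum_le_local_cost : exists2 C : R, (0 <= C)%R & forall (g : 'I_M -> R) i x,
  (forall l, (0 <= g l)%R) -> (g i)%:E <= local_cost g x + C%:E.
Proof.
have [C C0 FC] := entropy_superlinear_bound FE 1.
exists C => // g i x g0.
have gs : (g i <= \sum_l g l)%R by rewrite (bigD1 i)//= lerDl sumr_ge0.
have := FC (\sum_l g l)%R (sumr_ge0 _ (fun l _ => g0 l)).
have lcF : F (\sum_l g l)%R <= local_cost g x.
  by rewrite /local_cost leeDr// sume_ge0// => l _; rewrite mule_ge0// lee_fin.
rewrite mul1r EFinB leeBlDr// => h; apply: (@le_trans _ _ (F (\sum_l g l)%R + C%:E)).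
  by apply: le_trans h; rewrite lee_fin.
exact: leeD.
Qed.

(** Vitali's argument: truncations at L converge by dominated convergence, and the cut-off masses
    are uniformly small by [mass_truncation]. *)
Lemma mass_cvg (g : nat -> 'I_M -> T -> R) (f : 'I_M -> T -> R) (K : R) i :
  (0 <= K)%R -> (forall n, densities (g n)) -> densities f ->
  (forall n, source_cost (g n) <= K%:E) -> source_cost f <= K%:E ->
  {ae mu, forall x, (fun n => g n i x) @ \oo --> f i x} ->
  (fun n => mass (g n) i) @ \oo --> mass f i.
Proof.
move=> K0 dg df gK fK gf; apply/cvgrPdist_le => eps eps0.
have e30 : (0 < eps / 3)%R by rewrite divr_gt0.
have [L L0 HL] := mass_truncation e30 K0.
pose tr (h : 'I_M -> T -> R) (x : T) : R := Num.min (h i x) L.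
have mtr h : densities h -> measurable_fun setT (tr h).
  by move=> dh; apply: measurable_minr => //; exact: densities_measurable.
have tr0 h x : densities h -> (0 <= tr h x <= L)%R.
  by move=> dh; rewrite le_min L0 ge_min lexx orbT !andbT; exact: (dh i).1.
have itr h : densities h -> mu.-integrable setT (EFin \o tr h).
  move=> dh; apply: (@bounded_integrable _ L (mtr _ dh)) => x.
  by have /andP[h1 h2] := tr0 h x dh; rewrite ger0_norm.
have tr_le h : densities h -> (\int[mu]_x tr h x <= mass h i)%R.
  move=> dh; rewrite /mass -/(Rintegral mu setT (h i)).
  apply: le_Rintegral => //; [exact: itr|exact: (dh i).2|].
  by move=> x _; rewrite ge_min lexx.
have cv : (fun n => \int[mu]_x tr (g n) x)%R @ \oo --> (\int[mu]_x tr f x)%R.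
  apply: fine_cvg.
  rewrite /Rintegral fineK; last exact: integrable_fin_num (itr _ df).
  have [] := @dominated_convergence _ _ _ mu setT measurableT
    (fun n => EFin \o tr (g n)) (EFin \o tr f) (EFin \o cst L).
  - by move=> n; exact/measurable_EFinP/mtr.
  - exact/measurable_EFinP/mtr.
  - apply: filterS gf => x gfx _; apply: cvg_EFin; first exact: nearW.
    apply/cvgrPdist_le => e e0.
    have : \forall n \near \oo, (`|f i x - g n i x| <= e)%R by move/cvgrPdist_le : gfx; apply.
    apply: filterS => n; rewrite /tr /= !ler_norml => /andP[h1 h2].
    by have [?|?] := leP (f i x) L; have [?|?] := leP (g n i x) L; apply/andP; split; lra.
  - exact: finite_measure_integrable_cst.
  - apply: nearW => x n _; rewrite lee_fin.
    by have /andP[h1 h2] := tr0 (g n) x (dg n); rewrite ger0_norm.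
  by [].
have : \forall n \near \oo,
    (`|\int[mu]_x tr f x - \int[mu]_x tr (g n) x| <= eps / 3)%R.
  by move/cvgrPdist_le : cv; apply.
apply: filterS => n; rewrite !ler_norml => /andP[h1 h2].
have := HL _ i (dg n) (gK n); have := HL _ i df fK.
have := tr_le _ df; have := tr_le _ (dg n).
rewrite -/(tr (g n)) -/(tr f) => q1 q2 q3 q4.
by apply/andP; split; lra.
Qed.

Lemma primal_attained :
  exists g, densities g /\ source_cost g + target_cost (mass g) <= S%:E.
Proof.
have [g [p [gp cauchy]]] := minimizing_sequence.
have dg n : densities (g n) by case: (gp n) => -[].
have p0 n i : (0 <= p n i)%R by case: (gp n) => -[].
have cost_le n : source_cost (g n) + target_cost (p n) <= (S + n.+1%:R^-1)%:E.
  by have [fg h _] := gp n; rewrite total_costE// lee_fin.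
have n1 n : (n.+1%:R^-1 <= 1 :> R)%R by rewrite invf_le1// ler1n.
have S1 : (0 <= S + 1)%R.
  have [fg h _] := gp 0%N; rewrite invr1 in h.
  exact: le_trans (total_cost_ge0 fg) h.
have src_le n : source_cost (g n) <= (S + 1)%:E.
  apply: le_trans (le_trans (cost_le n) _); first by rewrite leeDl// target_cost_ge0.
  by rewrite lee_fin lerD2l.
have [C C0 HC] := sum_le_local_cost.
have muT : mu setT = (fine (mu setT))%:E by rewrite fineK// fin_num_measure.
(* The L^1 bound required for extracting the limit comes from the minorant of F of slope 1. *)
have intC n i : \int[mu]_x (g n i x)%:E <= (S + 1 + C * fine (mu setT))%:E.
  apply: (@le_trans _ _ (\int[mu]_x (local_cost ((g n) ^~ x) x + C%:E))).
    apply: ge0_le_integral => //.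
    - by move=> x _; rewrite lee_fin; exact: (dg n i).1.
    - by apply/measurable_EFinP; exact: densities_measurable.
    - exact: local_cost_shift_measurable.
    - by move=> x _; apply: HC => l; exact: (dg n l).1.
  by rewrite integral_local_cost_shift// muT -EFinM EFinD leeD2r.
have lim i : exists f : T -> R, [/\ measurable_fun setT f, forall x, (0 <= f x)%R,
      \int[mu]_x (f x)%:E <= (S + 1 + C * fine (mu setT))%:E &
      {ae mu, forall x, (fun n => g n i x) @ \oo --> f x}].
  apply: (@inverse_transform_limit _ _ _ mu (fun n => g n i) _ 8%R).
  - by move=> n; exact: densities_measurable.
  - by move=> n x; exact: (dg n i).1.
  - by move=> n; exact: intC.
  - by [].
  - by move=> n; exact: cauchy.
have [f fP] := choice lim.
have df : densities f.
  move=> i; have [mfi f0 fi _] := fP i; split=> //.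
  apply/integrableP; split; first exact/measurable_EFinP.
  under eq_integral do rewrite /= ger0_norm//.
  by apply: le_lt_trans fi _; rewrite ltry.
have aecvg : {ae mu, forall x, forall i, (fun n => g n i x) @ \oo --> f i x}.
  by apply: filter_forall => i; have [] := fP i.
have mlc h : densities h -> measurable_fun setT (fun x => local_cost (h ^~ x) x).
  by move=> dh; apply: local_cost_measurable => l; exact: densities_measurable.
have lc0 h x : densities h -> 0 <= local_cost (h ^~ x) x.
  by move=> dh; apply: local_cost_ge0 => l; exact: (dh l).1.
have src_lim : source_cost f <= limn_einf (fun n => source_cost (g n)).
  apply: (@le_trans _ _ (\int[mu]_x limn_einf (fun n => local_cost ((g n) ^~ x) x))).
    apply: ae_ge0_le_integral => //.
    - by move=> x _; exact: lc0.
    - exact: mlc.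
    - by move=> x _; apply: limn_einf_ge0 => n; exact: lc0.
    - by apply: measurable_fun_limn_einf => n; exact: mlc.
    apply: filterS aecvg => x gx _.
    apply: (@le_trans _ _ (limn_einf (fun n => \sum_i k i x * (g n i x)%:E) +
                          limn_einf (fun n => F (\sum_i g n i x)%R))).
      apply: leeD.
        apply: le_trans (le_limn_einf_sum _ _).
          apply: lee_sum => i _; apply: mule_limn_einf => // n; exact: (dg n i).1.
        by move=> i n; rewrite mule_ge0// lee_fin; exact: (dg n i).1.
      apply: (lsc_limn_einf (entropy_lsc FE)).
      by apply: cvgn_sum => i; exact: gx.
    apply: le_limn_einfD => n; last exact: (entropy_ge0 FE).
    by apply: sume_ge0 => i _; rewrite mule_ge0// lee_fin; exact: (dg n i).1.
  apply: fatou => //; first by move=> n; exact: mlc.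
  by move=> n x _; exact: lc0.
have src_f : source_cost f <= (S + 1)%:E.
  by apply: le_trans src_lim (limn_einf_le _); exact: nearW.
have mass_lim i : (fun n => mass (g n) i) @ \oo --> mass f i.
  apply: (mass_cvg S1 dg df src_le src_f).
  by have [] := fP i.
have inv0 : (fun n => n.+1%:R^-1)%R @ \oo --> (0 : R)%R by exact: cvg_harmonic.
(* The gaps tend to 0, so the limit satisfies the mass constraint exactly. *)
have p_lim i : (fun n => p n i) @ \oo --> mass f i.
  have -> : (fun n => p n i) = (fun n => mass (g n) i - gap (g n) (p n) i)%R.
    by apply/funext => n; rewrite /gap; ring.
  rewrite -[mass f i]subr0; apply: cvgB; first exact: mass_lim.
  apply/cvgrPdist_le => e e0.
  have : \forall n \near \oo, (`|0 - n.+1%:R^-1 : R| <= e)%R.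
    by move/cvgrPdist_le : inv0; apply.
  apply: filterS => n; rewrite !sub0r !normrN [X in (X <= _)%R -> _]ger0_norm// => ne.
  by apply: le_trans ne; case: (gp n).
have tgt_lim : target_cost (mass f) <= limn_einf (fun n => target_cost (p n)).
  apply: le_trans (le_limn_einf_sum _ _); last first.
    by move=> i n; rewrite mule_ge0 ?(entropy_ge0 FE)// lee_fin ltW.
  apply: lee_sum => i _; apply: le_trans (limn_einfZ _ (m0 i)).
  rewrite lee_pmul2l ?lte_fin//.
  apply: (lsc_limn_einf (entropy_lsc FE)).
  by apply: cvgMl; exact: p_lim.
exists f; split=> //; apply/lee_addgt0Pr => e e0.
apply: le_trans (leeD src_lim tgt_lim) _.
apply: le_trans (le_limn_einfD _ _) _.
- by move=> n; exact: source_cost_ge0.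
- by move=> n; exact: target_cost_ge0.
apply: limn_einf_le; have : \forall n \near \oo, (`|0 - n.+1%:R^-1 : R| <= e)%R.
  by move/cvgrPdist_le : inv0; apply.
apply: filterS => n; rewrite sub0r normrN ger0_norm// => ne.
by apply: le_trans (cost_le n) _; rewrite -EFinD lee_fin lerD2l.
Qed.

End strong_duality.

Theorem semidiscrete_duality :
  ereal_inf [set source_cost g + target_cost (mass g) | g in densities] =
  ereal_sup (range dual_value).
Proof.
apply/eqP; rewrite eq_le; apply/andP; split.
  have [->|supy] := eqVneq (ereal_sup (range dual_value)) +oo; first by rewrite leey.
  have supNy : -oo < ereal_sup (range dual_value).
    apply: (lt_le_trans (dual_value_gtNy (fun=> 0%R))).
    by apply: ereal_sup_ubound; exists (fun=> 0%R).
  have supE : ereal_sup (range dual_value) = (fine (ereal_sup (range dual_value)))%:E.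
    by rewrite fineK// fin_numE gt_eqF.
  have ub w : dual_value w <= (fine (ereal_sup (range dual_value)))%:E.
    by rewrite -supE; apply: ereal_sup_ubound; exists w.
  have [g [dg gS]] := primal_attained ub.
  by rewrite supE; apply: le_trans gS; apply: ereal_inf_lbound; exists g.
apply: ge_ereal_sup => _ [w _ <-]; apply: le_ereal_inf_tmp => _ [g dg <-].
have := weak_duality w dg (fun i => mass_ge0 i dg).
by under eq_bigr do rewrite subrr mulr0; rewrite big1_eq adde0.
Qed.

(* [dual_value] is an infimum of affine functions of w, attained at every w. *)
Theorem dual_value_concave (t : R) (a b : 'I_M -> R) : (0 <= t <= 1)%R ->
  t%:E * dual_value a + (1 - t)%:E * dual_value b <=
  dual_value (fun i => t * a i + (1 - t) * b i)%R.
Proof.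
move=> t01; set w := (fun i => _); have [t0 t1] := andP t01.
have := dual_attained w; set g := cell_reply w; set p := best_target w.
have dg : densities g := cell_reply_densities w.
have p0 : forall i, (0 <= p i)%R := best_target_ge0 w.
have := weak_duality a dg p0; have := weak_duality b dg p0.
have : 0 <= source_cost g + target_cost p.
  by rewrite adde_ge0 ?source_cost_ge0 ?target_cost_ge0.
have := dual_value_gtNy w; have := dual_value_gtNy a; have := dual_value_gtNy b.
have -> : (\sum_i w i * (mass g i - p i) = t * (\sum_i a i * (mass g i - p i)) +
    (1 - t) * (\sum_i b i * (mass g i - p i)))%R.
  by rewrite !mulr_sumr -big_split/=; apply: eq_bigr => i _; rewrite /w; ring.
move: (\sum_i a i * _)%R (\sum_i b i * _)%R => ra rb.
case: (dual_value w) => [vw||]//; last by move=> *; rewrite leey.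
case: (source_cost g + target_cost p) => [z||]//.
case: (dual_value a) => [va||]//; case: (dual_value b) => [vb||]// _ _ _ _.
rewrite -!EFinM -!EFinD !lee_fin => hb ha [hw].
have := ler_wpM2l t0 ha; have := ler_wpM2l (_ : 0 <= 1 - t)%R hb.
by rewrite subr_ge0 => /(_ t1); lra.
Qed.

End null_ties.

End semidiscrete.

(** * Transport plans as densities *)

Section transport_plans.
Local Open Scope charge_scope.

Section density.
Context d (T : measurableType d) (R : realType).
Variables (nu mu : {finite_measure set T -> \bar R}) (g : T -> R).
Hypotheses (g0 : forall x, (0 <= g x)%R)
  (ig : mu.-integrable setT (EFin \o g))
  (nuE : forall A, measurable A -> nu A = \int[mu]_(x in A) (g x)%:E).

Lemma density_dominated : nu `<< mu.
Proof.
apply/null_content_dominatesP => A mA A0; rewrite nuE//.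
apply: null_set_integral => //.
exact: measurable_int (integrableS measurableT mA (@subsetT _ _) ig).
Qed.

Lemma density_ae_eq :
  ae_eq mu setT ('d (charge_of_finite_measure nu) '/d mu) (EFin \o g).
Proof.
apply: integral_ae_eq => //.
- by apply: Radon_Nikodym_integrable; exact: density_dominated.
- exact: measurable_int ig.
- move=> A _ mA; rewrite -Radon_Nikodym_integral//; last exact: density_dominated.
  exact: nuE.
Qed.

Lemma density_integral (f : T -> \bar R) : measurable_fun setT f ->
  (forall x, 0 <= f x) -> \int[nu]_x f x = \int[mu]_x (f x * (g x)%:E).
Proof.
move=> mf f0; have numu := density_dominated.
rewrite -(Radon_Nikodym_SigmaFinite.change_of_variables numu f0 measurableT mf).
have mRN : measurable_fun setT (Radon_Nikodym_SigmaFinite.f nu mu).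
  by apply: measurable_int (Radon_Nikodym_SigmaFinite.f_integrable _).
have mg : measurable_fun setT (EFin \o g) by exact: measurable_int ig.
apply: ge0_ae_eq_integral => //.
- exact: emeasurable_funM.
- exact: emeasurable_funM.
- by move=> x _; rewrite mule_ge0 ?Radon_Nikodym_SigmaFinite.f_ge0.
- by move=> x _; rewrite mule_ge0 ?lee_fin.
have h1 := ae_eq_Radon_Nikodym_SigmaFinite numu measurableT.
have h2 := density_ae_eq.
near=> x => _; congr (_ * _).
have -> : Radon_Nikodym_SigmaFinite.f nu mu x =
    ('d (charge_of_finite_measure nu) '/d mu) x by near: x; apply: filterS h1 => x; exact.
by near: x; apply: filterS h2 => x; exact.
Unshelve. all: by end_near. Qed.

Lemma discrepancy_density (F : R -> \bar R) (Omega : set T) :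
  marginal_entropy F -> measurable Omega ->
  discrepancy F Omega nu mu = \int[mu]_(x in Omega) F (g x).
Proof.
move=> FE mO; rewrite /discrepancy asboolT; last exact: density_dominated.
have mF := entropy_measurable FE.
have mRN : measurable_fun setT ('d (charge_of_finite_measure nu) '/d mu).
  apply: (measurable_int mu); apply: Radon_Nikodym_integrable.
  exact: density_dominated.
have mg : measurable_fun setT g by apply/measurable_EFinP; exact: measurable_int ig.
apply: ge0_ae_eq_integral => //.
- apply: measurable_funTS; apply: measurableT_comp => //.
  exact: measurableT_comp.
- by apply: measurable_funTS; exact: measurableT_comp.
- by move=> x _; exact: entropy_ge0.
- by move=> x _; exact: entropy_ge0.
have := density_ae_eq; apply: filterS => x h _.
by rewrite h.
Qed.

End density.

Section restriction.
Context d (T : measurableType d) (R : realType).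
Variable mu : {measure set T -> \bar R}.

Lemma ge0_integral_mrestr (D : set T) (mD : measurable D) (f : T -> \bar R) :
  measurable_fun setT f -> (forall x, 0 <= f x) ->
  \int[mrestr mu mD]_x f x = \int[mu]_(x in D) f x.
Proof.
move=> mf f0; have mDc : measurable (~` D) by exact: measurableC.
have Dc0 : mrestr mu mD (~` D) = 0 by rewrite /mrestr setICl measure0.
rewrite (ge0_negligible_integral mDc measurableT _ _ Dc0)//.
rewrite setTD setCK; apply: eq_measure_integral => A mA AD.
by rewrite /= /mrestr setIidl.
Qed.

End restriction.

Section atoms.
Context d1 d2 (T1 : measurableType d1) (T2 : measurableType d2) (R : realType).
Variables (mu : {finite_measure set T1 -> \bar R}) (M : nat).
Variables (y : 'I_M -> T2) (g : 'I_M -> T1 -> R).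
Variable gam : {finite_measure set (T1 * T2)%type -> \bar R}.
Hypotheses (my : forall i, measurable [set y i]) (y_inj : injective y)
  (g0 : forall i x, (0 <= g i x)%R)
  (ig : forall i, mu.-integrable setT (EFin \o g i)).

Definition fiber i : set (T1 * T2) := setT `*` [set y i].

Lemma measurable_fiber i : measurable (fiber i).
Proof. exact: measurableX. Qed.

Hypotheses (gam_fiber : forall i A, measurable A ->
    gam (A `*` [set y i]) = \int[mu]_(x in A) (g i x)%:E)
  (gam_off : gam (~` \bigcup_(i in [set: 'I_M]) fiber i) = 0).

Lemma measurable_fibers : measurable (\bigcup_(i in [set: 'I_M]) fiber i).
Proof. by apply: fin_bigcup_measurable => // i _; exact: measurable_fiber. Qed.

(** A plan without mass off the fibers is a sum of restrictions to the fibers; the first projection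
    of the i-th restriction is the measure of density [g i]. *)
Lemma atoms_integral (h : T1 * T2 -> \bar R) : measurable_fun setT h ->
  (forall p, 0 <= h p) ->
  \int[gam]_p h p = \sum_i \int[mu]_x (h (x, y i) * (g i x)%:E).
Proof.
move=> mh h0.
rewrite (ge0_negligible_integral (measurableC measurable_fibers) measurableT _ _ gam_off)//.
rewrite setTD setCK.
have -> : \bigcup_(i in [set: 'I_M]) fiber i =
    \big[setU/set0]_(i <- index_enum 'I_M) fiber i.
  by rewrite -bigcup_seq; apply: eq_bigcupl; split=> i // _; exact: mem_index_enum.
rewrite ge0_integral_bigsetU//; last 4 first.
- by move=> i; exact: measurable_fiber.
- exact: index_enum_uniq.
- move=> i j _ _ [p [[_ pi] [_ pj]]]; apply: y_inj.
  by rewrite -(pi : p.2 = y i) -(pj : p.2 = y j).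
- exact: measurable_funTS.
apply: eq_bigr => i _.
have mhi : measurable_fun setT (fun x => h (x, y i)).
  by apply: measurableT_comp => //; exact: pair2_measurable.
have mf := measurable_fiber i.
rewrite (eq_integral (fun p => h (p.1, y i))); last first.
  by move=> [x z] /[!inE] -[_ /= ->].
rewrite -(ge0_integral_mrestr gam mf)//; last exact: (measurableT_comp mhi measurable_fst).
pose nu : {finite_measure set T1 -> \bar R} := image_measure (mrestr gam mf) measurable_fst.
have -> : \int[mrestr gam mf]_p h (p.1, y i) = \int[nu]_x h (x, y i).
  by rewrite ge0_integral_pushforward.
apply: (density_integral (g0 i) (ig i)) => //.
move=> A mA; rewrite -gam_fiber// /nu /image_measure /pushforward /mrestr.
congr (gam _); apply/seteqP; split => -[x z] /=; first by move=> [Ax [_ zy]].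
by move=> [Ax zy]; split.
Qed.

End atoms.

Section atomic_measure.
Context d (T : measurableType d) (R : realType) (nu : {measure set T -> \bar R}).
Variables (M : nat) (m : 'I_M -> R) (y : 'I_M -> T).
Hypotheses (my : forall i, measurable [set y i]) (y_inj : injective y)
  (nuE : forall A, measurable A -> nu A = \sum_(i < M) (m i)%:E * \d_(y i) A).

Lemma atomic_measure1 i : nu [set y i] = (m i)%:E.
Proof.
rewrite nuE// (bigD1 i)//= big1 ?adde0 => [|j ji].
  by rewrite diracE mem_set// mule1.
rewrite diracE memNset ?mule0//= => /y_inj/eqP ji'.
by rewrite ji' in ji.
Qed.

Lemma atomic_measure_integral (h : T -> \bar R) : measurable_fun setT h ->
  (forall x, 0 <= h x) -> \int[nu]_x h x = \sum_i (m i)%:E * h (y i).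
Proof.
move=> mh h0; pose Y := \big[setU/set0]_(i <- index_enum 'I_M) [set y i].
have mY : measurable Y by apply: bigsetU_measurable.
have Yi i : Y (y i).
  by rewrite /Y -bigcup_seq; exists i => //=; exact: mem_index_enum.
have Yc0 : nu (~` Y) = 0.
  rewrite nuE; last exact: measurableC.
  by apply: big1 => i _; rewrite diracE memNset ?mule0// => /(_ (Yi i)).
rewrite (ge0_negligible_integral (measurableC mY) measurableT _ _ Yc0)//.
rewrite setTD setCK /Y ge0_integral_bigsetU//; last 3 first.
- exact: index_enum_uniq.
- by move=> i j _ _ [x [/= -> /y_inj]].
- exact: measurable_funTS.
apply: eq_bigr => i _.
rewrite (eq_integral (cst (h (y i)))); last by move=> x /[!inE] ->.
by rewrite integral_cst// [nu _]atomic_measure1 muleC.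
Qed.

End atomic_measure.

Section coupling.
Context d1 d2 (T1 : measurableType d1) (T2 : measurableType d2) (R : realType).
Variables (mu : {finite_measure set T1 -> \bar R}) (M : nat).
Variables (y : 'I_M -> T2) (g : 'I_M -> T1 -> R) (dg : densities mu g).

(** The sum of the images of g_i mu under x |-> (x, y i). The proof of [densities] is an argument so
    that inference finds the finite-measure structure. *)
Definition coupling & densities mu g : set (T1 * T2) -> \bar R :=
  fun A => \sum_i \int[mu]_(x in (pair^~ (y i)) @^-1` A) (g i x)%:E.

Local Notation gam := (coupling dg).

Let mpre i A : measurable A -> measurable ((pair^~ (y i)) @^-1` A : set T1).
Proof. by move=> mA; rewrite -[X in measurable X]setTI; exact: pair2_measurable. Qed.

Let mg i : measurable_fun setT (fun x => (g i x)%:E).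
Proof. exact: measurable_int (dg i).2. Qed.

Let g0 i x : 0 <= (g i x)%:E. Proof. by rewrite lee_fin; exact: (dg i).1. Qed.

Let gam0 : gam set0 = 0.
Proof. by apply: big1 => i _; rewrite preimage_set0 integral_set0. Qed.

Let gam_ge0 A : 0 <= gam A.
Proof. by apply: sume_ge0 => i _; exact: integral_ge0. Qed.

Let gam_sigma_additive : semi_sigma_additive gam.
Proof.
move=> A mA tA mUA.
have -> : gam (\bigcup_n A n) = \sum_(n <oo) gam (A n).
  rewrite /coupling nneseries_sum; last by move=> i n _; exact: integral_ge0.
  apply: eq_bigr => i _; rewrite preimage_bigcup ge0_integral_bigcup//.
  - by move=> n; exact: mpre.
  - exact: measurable_funTS.
  - by apply/trivIsetP => a b _ _ ab; rewrite -preimage_setI (trivIsetP.1 tA)// preimage_set0.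
by apply: is_cvg_nneseries => n _ _; exact: gam_ge0.
Qed.

HB.instance Definition _ :=
  isMeasure.Build _ _ _ gam gam0 gam_ge0 gam_sigma_additive.

Let gam_fin : fin_num_fun gam.
Proof.
move=> A mA; rewrite /coupling sum_fin_num; apply/allP => _ /mapP[i _ ->].
by apply: integrable_fin_num; [exact: mpre|exact: integrableS (mpre i mA) _ (dg i).2].
Qed.

HB.instance Definition _ := Measure_isFinite.Build _ _ _ gam gam_fin.

End coupling.

Section coupling_values.
Context d1 d2 (T1 : measurableType d1) (T2 : measurableType d2) (R : realType).
Variables (mu : {finite_measure set T1 -> \bar R}) (M : nat).
Variables (y : 'I_M -> T2) (g : 'I_M -> T1 -> R) (dg : densities mu g).
Hypothesis y_inj : injective y.

Lemma coupling_fiber i A : coupling y dg (A `*` [set y i]) = \int[mu]_(x in A) (g i x)%:E.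
Proof.
rewrite /coupling (bigD1 i)//= big1 ?adde0 => [|j ji].
  by congr (\int[mu]_(x in _) _); apply/seteqP; split=> x //= -[].
rewrite (_ : _ @^-1` _ = set0) ?integral_set0//.
by apply/seteqP; split=> x //= -[_ /y_inj/eqP]; exact/negP.
Qed.

Lemma coupling_off_fibers :
  coupling y dg (~` \bigcup_(i in [set: 'I_M]) fiber (T1 := T1) y i) = 0.
Proof.
apply: big1 => i _; rewrite (_ : _ @^-1` _ = set0) ?integral_set0//.
by apply/seteqP; split=> x //=; apply; exists i.
Qed.

Lemma coupling_concentrated (A : set T1) (B : set T2) :
  measurable A -> mu (~` A) = 0 -> (forall i, B (y i)) ->
  coupling y dg (~` (A `*` B)) = 0.
Proof.
move=> mA A0 By; apply: big1 => i _.
rewrite (_ : _ @^-1` _ = ~` A); last first.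
  by apply/seteqP; split=> x /= h; [move=> Ax; apply: h|case].
have mA' : measurable (~` A) by exact: measurableC.
apply: null_set_integral => //.
exact: measurable_int (integrableS measurableT mA' (@subsetT _ _) (dg i).2).
Qed.

End coupling_values.

Section transport_densities.
Context (R : realType) (d : nat).
Local Notation V := 'rV[R]_d.
Variables (Omega : set V) (c : V -> V -> \bar R) (h : V * V -> \bar R).
Variables (F : R -> \bar R) (mu nu : {finite_measure set V -> \bar R}).
Variables (M : nat) (m : 'I_M -> R) (xs : 'I_M -> V).
Hypotheses (FE : marginal_entropy F) (mOmega : measurable Omega)
  (my : forall i, measurable [set xs i]) (xs_inj : injective xs)
  (xs_Omega : forall i, Omega (xs i)) (m0 : forall i, (0 < m i)%R)
  (mu_Omega : concentrated_on Omega mu)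
  (nuE : forall A, measurable A -> nu A = \sum_(i < M) (m i)%:E * \d_(xs i) A)
  (mh : measurable_fun setT h) (h0 : forall p, 0 <= h p)
  (hc : forall x y, Omega x -> Omega y -> h (x, y) = c x y).

(** The cost c is controlled only on the square of [Omega]; h is a nonnegative measurable extension
    of it, so that the abstract duality applies on the ambient space. *)
Let k i x := h (x, xs i).

Let mF : measurable_fun setT F. Proof. exact: entropy_measurable FE. Qed.

Lemma nu_off_Omega : nu (~` Omega) = 0.
Proof.
rewrite nuE; last exact: measurableC.
by apply: big1 => i _; rewrite diracE memNset ?mule0// => /(_ (xs_Omega i)).
Qed.

Lemma mu_integral_Omega (u : V -> \bar R) : measurable_fun setT u ->
  (forall x, 0 <= u x) -> \int[mu]_(x in Omega) u x = \int[mu]_x u x.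
Proof.
move=> mfu u0.
by rewrite [RHS](ge0_negligible_integral (measurableC mOmega) measurableT _ _ mu_Omega)//
  setTD setCK.
Qed.

Lemma nu_integral_Omega (u : V -> \bar R) : measurable_fun setT u ->
  (forall x, 0 <= u x) -> \int[nu]_(x in Omega) u x = \sum_i (m i)%:E * u (xs i).
Proof.
move=> mfu u0; rewrite -(atomic_measure_integral my xs_inj nuE mfu u0).
by rewrite [RHS](ge0_negligible_integral (measurableC mOmega) measurableT _ _ nu_off_Omega)//
  setTD setCK.
Qed.

Section energy_of_densities.
Variables (gam : {finite_measure set (V * V)%type -> \bar R}) (g : 'I_M -> V -> R).
Hypotheses (dg : densities mu g)
  (gam_Omega : concentrated_on (Omega `*` Omega) gam)
  (gam_fiber : forall i A, measurable A ->
    gam (A `*` [set xs i]) = \int[mu]_(x in A) (g i x)%:E)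
  (gam_off : gam (~` \bigcup_(i in [set: 'I_M]) fiber xs i) = 0).

Let g0 i x : (0 <= g i x)%R. Proof. exact: (dg i).1. Qed.
Let ig i : mu.-integrable setT (EFin \o g i). Proof. exact: (dg i).2. Qed.
Let mg i : measurable_fun setT (g i).
Proof. by apply/measurable_EFinP; exact: measurable_int (ig i). Qed.

Let gam_integral := atoms_integral my xs_inj g0 ig gam_fiber gam_off.

Lemma gamE B : measurable B ->
  gam B = \sum_i \int[mu]_x ((\1_B (x, xs i))%:E * (g i x)%:E).
Proof.
move=> mB; rewrite -(gam_integral (h := fun p => (\1_B p)%:E)).
- by rewrite integral_indic// setIT.
- exact/measurable_EFinP/measurable_indic.
- by move=> p; rewrite lee_fin.
Qed.

Let sg x : R := (\sum_i g i x)%R.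

Lemma first_marginalE A : measurable A ->
  image_measure gam measurable_fst A = \int[mu]_(x in A) (sg x)%:E.
Proof.
move=> mA; rewrite /image_measure /pushforward gamE; last first.
  by rewrite -[X in measurable X]setTI; exact: measurable_fst.
under [RHS]eq_integral do rewrite /sg -sumEFin.
rewrite ge0_integral_sum//; last 2 first.
- by move=> i; apply: measurable_funTS; exact/measurable_EFinP.
- by move=> i x _; rewrite lee_fin.
apply: eq_bigr => i _; rewrite [RHS]integral_mkcond; apply: eq_integral => x _.
rewrite /patch indicE; have [xA|xA] := boolP (x \in A).
  by rewrite mem_set ?mul1e//=; exact: set_mem.
by rewrite memNset ?mul0e//=; move/negP: xA; rewrite inE.
Qed.

Let q := mass mu g.

Lemma second_marginalE A : measurable A ->
  image_measure gam measurable_snd A = \sum_i (\1_A (xs i))%:E * (q i)%:E.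
Proof.
move=> mA; rewrite /image_measure /pushforward gamE; last first.
  by rewrite -[X in measurable X]setTI; exact: measurable_snd.
apply: eq_bigr => i _.
rewrite (eq_integral (fun x => (\1_A (xs i))%:E * (g i x)%:E)); last first.
  by move=> x _; congr ((_ %:R)%:E * _).
rewrite ge0_integralZl_EFin//.
- by rewrite massE.
- by move=> x _; rewrite lee_fin.
- exact/measurable_EFinP.
Qed.

(** The density of the second marginal with respect to [nu], set to 0 off the atoms. *)
Let qd z : R := (\sum_i \1_[set xs i] z * (q i / m i))%R.

Let q0 i : (0 <= q i)%R. Proof. exact: mass_ge0. Qed.

Let qd0 z : (0 <= qd z)%R.
Proof. by apply: sumr_ge0 => i _; rewrite mulr_ge0// divr_ge0// ltW. Qed.

Let mqd : measurable_fun setT qd.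
Proof.
by apply: measurable_sum => i; apply: measurable_funM.
Qed.

Let qdE i : qd (xs i) = (q i / m i)%R.
Proof.
rewrite /qd (bigD1 i)//= big1 ?addr0 => [|j ji].
  by rewrite indicE mem_set// mul1r.
rewrite indicE memNset ?mul0r//= => /xs_inj/eqP ji'.
by rewrite eq_sym ji' in ji.
Qed.

Lemma second_marginal_density A : measurable A ->
  image_measure gam measurable_snd A = \int[nu]_(z in A) (qd z)%:E.
Proof.
move=> mA; rewrite second_marginalE// integral_mkcond.
rewrite (atomic_measure_integral my xs_inj nuE); last 2 first.
- by apply/(measurable_restrictT _ mA); apply: measurable_funTS; exact/measurable_EFinP.
- by move=> z; rewrite /patch; case: ifP => _ //; rewrite lee_fin.
apply: eq_bigr => i _; rewrite /patch indicE qdE.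
case: (_ \in _); last by rewrite mul0e mule0.
by rewrite mul1e -EFinM mulrCA mulfV ?mulr1// gt_eqF.
Qed.

Let iqd : nu.-integrable setT (EFin \o qd).
Proof.
apply/integrableP; split; first exact/measurable_EFinP.
under eq_integral do rewrite /= ger0_norm//.
by rewrite -second_marginal_density// -ge0_fin_numE// fin_num_measure.
Qed.

Let isg : mu.-integrable setT (EFin \o sg).
Proof.
rewrite (_ : EFin \o sg = fun x => \sum_i (g i x)%:E).
  by apply: integrable_sum => // i _; exact: ig.
by apply/funext => x; rewrite /= /sg sumEFin.
Qed.

Let sg0 x : (0 <= sg x)%R. Proof. exact: sumr_ge0. Qed.

Lemma energy_of_densities :
  energy Omega c F mu nu gam = source_cost mu F k g + target_cost F m q.
Proof.
rewrite /energy (discrepancy_density isg first_marginalE)//.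
rewrite (discrepancy_density iqd second_marginal_density)//.
have msg : measurable_fun setT sg by exact: measurable_sum.
rewrite mu_integral_Omega; last 2 first.
- exact: measurableT_comp.
- by move=> x; exact: entropy_ge0.
rewrite nu_integral_Omega; last 2 first.
- exact: measurableT_comp.
- by move=> x; exact: entropy_ge0.
congr (_ + _); last by apply: eq_bigr => i _; rewrite qdE.
have mkg i : measurable_fun setT (fun x => k i x * (g i x)%:E).
  apply: emeasurable_funM; last exact/measurable_EFinP.
  by apply: measurableT_comp => //; exact: pair2_measurable.
have kg0 i x : 0 <= k i x * (g i x)%:E by apply: mule_ge0; [exact: h0|rewrite lee_fin].
rewrite /source_cost /local_cost ge0_integralD//; last 4 first.
- by move=> x _; exact: sume_ge0.
- exact: emeasurable_sum.
- by move=> x _; exact: entropy_ge0.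
- exact: measurableT_comp.
congr (_ + _); rewrite ge0_integral_sum//.
have mO2 : measurable (Omega `*` Omega) by exact: measurableX.
rewrite (eq_integral h); last by move=> [x y] /[!inE] -[Ox Oy]; rewrite hc.
transitivity (\int[gam]_p h p); last exact: gam_integral.
by rewrite [RHS](ge0_negligible_integral (measurableC mO2) measurableT _ _ gam_Omega)//
  setTD setCK.
Qed.

End energy_of_densities.

Lemma energy_densities (gam : {finite_measure set (V * V)%type -> \bar R}) :
  concentrated_on (Omega `*` Omega) gam -> energy Omega c F mu nu gam < +oo ->
  exists2 g, densities mu g &
    energy Omega c F mu nu gam = source_cost mu F k g + target_cost F m (mass mu g).
Proof.
move=> gO gy.
have c0 : 0 <= \int[gam]_(p in Omega `*` Omega) c p.1 p.2.
  by apply: integral_ge0 => -[x y] [/= Ox Oy]; rewrite -hc.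
have disc0 (rho lam : {finite_measure set V -> \bar R}) : 0 <= discrepancy F Omega rho lam.
  rewrite /discrepancy; case: ifP => _; last by rewrite leey.
  by apply: integral_ge0 => x _; exact: entropy_ge0.
have dom (rho lam : {finite_measure set V -> \bar R}) :
    discrepancy F Omega rho lam < +oo -> rho `<< lam.
  by rewrite /discrepancy; case: ifP => [/asboolP//|_]; rewrite ltxx.
have dom1 : image_measure gam measurable_fst `<< mu.
  apply: dom; apply: le_lt_trans gy; rewrite /energy.
  by apply: (@le_trans _ _ (\int[gam]_(p in Omega `*` Omega) c p.1 p.2 +
    discrepancy F Omega (image_measure gam measurable_fst) mu)); rewrite ?leeDl ?leeDr.
have dom2 : image_measure gam measurable_snd `<< nu.
  by apply: dom; apply: le_lt_trans gy; rewrite /energy leeDr// adde_ge0.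
pose Y : set V := \bigcup_(i in [set: 'I_M]) [set xs i].
have mY : measurable Y by apply: fin_bigcup_measurable.
have nuY : nu (~` Y) = 0.
  rewrite nuE; last exact: measurableC.
  apply: big1 => i _; rewrite diracE memNset ?mule0//=.
  by apply; exists i.
have gam_off : gam (~` \bigcup_(i in [set: 'I_M]) fiber xs i) = 0.
  have /null_content_dominatesP/(_ _ (measurableC mY) nuY) := dom2.
  rewrite /image_measure /pushforward => <-; congr (gam _).
  apply/seteqP; split => -[x y] /=; first by move=> h1 [i _ /= h2]; apply: h1; exists i.
  by move=> h1 [i _ [_ /= h2]]; apply: h1; exists i.
have mf i := measurable_fiber (T1 := V) my i.
(* The first projection of the part of the plan above atom i: it lies below the whole first
   marginal, and is therefore dominated by [mu]. *)
pose gi i : {finite_measure set V -> \bar R} := image_measure (mrestr gam (mf i)) measurable_fst.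
have giE i A : measurable A -> gi i A = gam (A `*` [set xs i]).
  move=> mA; rewrite /gi /image_measure /pushforward /= /mrestr; congr (gam _).
  by apply/seteqP; split => -[x y] /= => [[? []]|[]].
have gidom i : gi i `<< mu.
  apply/null_content_dominatesP => A mA A0; rewrite giE//.
  have /null_content_dominatesP/(_ _ mA A0) := dom1.
  rewrite /image_measure /pushforward => h1; apply/eqP; rewrite -measure_le0 -h1.
  apply: le_measure; rewrite ?inE.
  - exact: measurableX.
  - by rewrite -[X in measurable X]setTI; exact: measurable_fst.
  - by move=> [x y] [].
(* This form of the derivative is finite and nonnegative at every point, as [densities] requires. *)
pose g i x := fine (Radon_Nikodym_SigmaFinite.f (gi i) mu x).
have gE i x : (g i x)%:E = Radon_Nikodym_SigmaFinite.f (gi i) mu x.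
  by rewrite fineK//; exact: Radon_Nikodym_SigmaFinite.f_fin_num.
have dg : densities mu g.
  move=> i; split=> [x|]; first exact/fine_ge0/Radon_Nikodym_SigmaFinite.f_ge0.
  rewrite (_ : EFin \o g i = Radon_Nikodym_SigmaFinite.f (gi i) mu).
    exact: Radon_Nikodym_SigmaFinite.f_integrable.
  by apply/funext => x /=; rewrite gE.
exists g => //; apply: energy_of_densities => // i A mA.
rewrite -giE//; under eq_integral do rewrite gE.
exact: Radon_Nikodym_SigmaFinite.f_integral.
Qed.

Theorem unbalanced_transport_densities : unbalanced_transport Omega c F mu nu =
  ereal_inf [set source_cost mu F k g + target_cost F m (mass mu g) | g in densities (M := M) mu].
Proof.
apply/eqP; rewrite eq_le; apply/andP; split; apply: le_ereal_inf_tmp.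
- move=> _ [g dg <-].
  pose gam : {finite_measure set (V * V)%type -> \bar R} := coupling xs dg.
  have gO : concentrated_on (Omega `*` Omega) gam.
    exact: coupling_concentrated.
  rewrite -(energy_of_densities dg gO).
  + by apply: ereal_inf_lbound; exists gam.
  + by move=> i A mA; exact: coupling_fiber.
  + exact: coupling_off_fibers.
- move=> _ [gam gO <-].
  have [gy|] := ltP (energy Omega c F mu nu gam) +oo; last first.
    by rewrite leye_eq => /eqP ->; rewrite leey.
  have [g dg ->] := energy_densities gO gy.
  by apply: ereal_inf_lbound; exists g.
Qed.

End transport_densities.

End transport_plans.

(** * Null sets of the iterated Lebesgue measure *)

Section null_preimage_square.
Context (R : realType).
Implicit Types (E : set R) (kappa a : R).
Local Notation lam := (@lebesgue_measure R).

Let mq kappa a : measurable_fun setT (fun t : R => kappa + (t - a) ^+ 2)%R.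
Proof.
apply: measurable_funD => //; apply: measurable_funX.
exact: measurable_funB.
Qed.

Let mside s a delta : measurable [set t : R | (delta <= s * (t - a))%R].
Proof.
rewrite (_ : [set t | _] = (fun t : R => s * (t - a))%R @^-1` `[delta, +oo[).
  rewrite -[X in measurable X]setTI; apply: measurable_funM => //.
  exact: measurable_funB.
by apply/seteqP; split => t /=; rewrite in_itv/= andbT.
Qed.

(* On the two half-lines |t - a| >= delta the map t |-> (t - a)^2 expands
   distances by at least 2 delta, so it pulls covers of small total length back
   to covers of small total length. *)
Let null_half E kappa a delta s : measurable E -> lam E = 0 -> (0 < delta)%R ->
  (s ^+ 2 = 1)%R ->
  lam [set t | (delta <= s * (t - a))%R /\ E (kappa + (t - a) ^+ 2)%R] = 0.
Proof.
move=> mE E0 d0 s2.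
set T := [set t | _].
have mT : measurable T.
  by apply: measurableI; [exact: mside|rewrite -[X in measurable X]setTI; exact: mq].
apply/eqP; rewrite -measure_le0; apply/lee_addgt0Pr => e e0; rewrite add0e.
have : (wlength idfun)^*%mu E < (e * delta)%:E.
  by rewrite [X in X < _](_ : _ = lam E)// E0 lte_fin mulr_gt0.
rewrite outer_measure_open_itv_cover => /ereal_inf_lt[_ [I [Iitv EI] <-]] sI.
pose Q i := [set t | (delta <= s * (t - a))%R /\ I i (kappa + (t - a) ^+ 2)%R].
have mI i : measurable (I i : set R) by have [ab ->] := Iitv i; exact: measurable_itv.
have mQ i : measurable (Q i).
  by apply: measurableI; [exact: mside|rewrite -[X in measurable X]setTI; exact: mq].
have TQ : T `<=` \bigcup_i Q i.
  by move=> t [t1 /EI[i _ It]]; exists i.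
apply: le_trans (measure_sigma_subadditive lam mQ mT TQ) _.
have Qle i : lam (Q i) <= (delta^-1)%:E * wlength idfun (I i).
  have [[u v] IE] := Iitv i.
  have [Q0|/set0P[t0 t0Q]] := eqVneq (Q i) set0.
    by rewrite Q0 measure0 mule_ge0// lee_fin invr_ge0 ltW.
  have uv t : Q i t -> (u < kappa + (t - a) ^+ 2 < v)%R.
    by move=> [_]; rewrite IE /= in_itv.
  (* On the half-line |t - t0| <= (v - u) / (2 delta); the interval of radius L around t0 has length
     (v - u) / delta. *)
  pose L := ((v - u) / (2 * delta))%R.
  have L0 : (0 <= L)%R.
    by rewrite /L divr_ge0//; [have /andP[] := uv _ t0Q; lra|lra].
  have QL : Q i `<=` `[(t0 - L)%R, (t0 + L)%R]%classic.
    move=> t tQ; have /andP[h1 h2] := uv _ tQ; have /andP[h3 h4] := uv _ t0Q.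
    have [[d1 _] [d2 _]] := (tQ, t0Q).
    have key : ((2 * delta) * `|t - t0| <= v - u)%R.
      have -> : `|t - t0|%R = `|s * (t - a) - s * (t0 - a)|%R.
        rewrite -mulrBr normrM (_ : `|s|%R = 1%R) ?mul1r; first by congr (`|_|%R); ring.
        by apply/eqP; rewrite -(@eqrXn2 _ 2)// -normrX s2 normr1 expr1n.
      move: d1 d2 h1 h2 h3 h4.
      have -> : ((t - a) ^+ 2 = (s * (t - a)) ^+ 2)%R by rewrite exprMn s2 mul1r.
      have -> : ((t0 - a) ^+ 2 = (s * (t0 - a)) ^+ 2)%R by rewrite exprMn s2 mul1r.
      move: (s * (t - a))%R (s * (t0 - a))%R => p q dp dq h1 h2 h3 h4.
      by have [pq|pq] := leP q p; [rewrite ger0_norm ?subr_ge0//|rewrite ltr0_norm ?subr_lt0//]; nra.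
    have : (`|t - t0| <= L)%R by rewrite /L ler_pdivlMr ?mulr_gt0// mulrC.
    by rewrite ler_norml /= in_itv/= => /andP[? ?]; apply/andP; split; lra.
  apply: (@le_trans _ _ (lam `[(t0 - L)%R, (t0 + L)%R]%classic)).
    apply: le_measure => //; rewrite inE; first exact: mQ.
    exact: measurable_itv.
  have uvlt : (u < v)%R by have /andP[] := uv _ t0Q; lra.
  rewrite lebesgue_measure_itv/= IE wlength_itv/= !lte_fin uvlt -!EFinB -EFinM.
  case: ifP => _; rewrite lee_fin; last by rewrite mulr_ge0 ?invr_ge0 ?subr_ge0 ?ltW.
  rewrite (_ : t0 + L - (t0 - L) = delta^-1 * (v - u))%R// /L.
  by field; rewrite gt_eqF.
apply: (@le_trans _ _ (\sum_(i <oo) (delta^-1)%:E * wlength idfun (I i))).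
  by apply: lee_nneseries => i *; [exact: measure_ge0|exact: Qle].
rewrite nneseriesZl//.
apply: (@le_trans _ _ ((delta^-1)%:E * (e * delta)%:E)).
  by rewrite lee_wpmul2l ?lee_fin ?invr_ge0 ?ltW.
by rewrite -EFinM lee_fin mulrCA mulVf ?mulr1// gt_eqF.
Qed.

(** The half-lines with delta = 1 / (n + 1) exhaust the complement of the point a, near which the
    square is not expanding. The number kappa collects the squares of coordinates already sliced
    off. *)
Lemma null_preimage_square E kappa a : measurable E -> lam E = 0 ->
  lam [set t | E (kappa + (t - a) ^+ 2)%R] = 0.
Proof.
move=> mE E0; apply: measure_negligible.
  by rewrite -[X in measurable X]setTI; exact: mq.
pose T s n := [set t | (n.+1%:R^-1 <= s * (t - a))%R /\ E (kappa + (t - a) ^+ 2)%R].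
have Tn s n : (s ^+ 2 = 1)%R -> lam.-negligible (T s n).
  move=> s2; apply/negligibleP; last by apply: null_half.
  by apply: measurableI; [exact: mside|rewrite -[X in measurable X]setTI; exact: mq].
have N0 : lam.-negligible ([set a] `|` (\bigcup_n T 1%R n `|` \bigcup_n T (-1)%R n)).
  apply: negligibleU.
    by apply/negligibleP => //; exact: lebesgue_measure_set1.
  by apply: negligibleU; apply: negligible_bigcup => n; apply: Tn; rewrite ?sqrrN expr1n.
apply: negligibleS N0.
move=> t /= Et; have [->|ta] := eqVneq t a; [by left|right].
have [n _ hn] : \forall n \near \oo, (n.+1%:R^-1 < `|t - a| :> R)%R.
  have ta0 : (0 < `|t - a|)%R by rewrite normr_gt0 subr_eq0.
  exact: near_infty_natSinv_lt (PosNum ta0).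
have {}hn := hn n (leqnn n).
have [at0|at0] := leP 0%R (t - a)%R.
  by left; exists n => //; split=> //; rewrite mul1r -(ger0_norm at0) ltW.
by right; exists n => //; split=> //; rewrite mulN1r -(ltr0_norm at0) ltW.
Qed.

End null_preimage_square.

Section disjoint_positive.
Context d (T : measurableType d) (R : realType).
Variable mu : {measure set T -> \bar R}.

(** In B, N disjoint sets of mass at least e have total mass at least N e, which exceeds mu B once N
    > mu B / e. *)
Lemma disjoint_large_finite (J : pointedType) (H : J -> set T) (B : set T) (e : R) :
  measurable B -> mu B < +oo -> (0 < e)%R ->
  (forall i, measurable (H i)) -> trivIset setT H ->
  finite_set [set i | e%:E <= mu (H i `&` B)].
Proof.
move=> mB Bfin e0 mH tH; apply: contrapT => /infiniteP/pcard_leP[f].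
have mHB (n : nat) : measurable (H (f n) `&` B) by exact: measurableI.
have fD (n : nat) : e%:E <= mu (H (f n) `&` B) by exact: (@funS _ _ _ _ f n I).
have tf : trivIset setT (fun n : nat => H (f n) `&` B).
  apply/trivIsetP => i j _ _ ij; rewrite setIACA (trivIsetP.1 tH) ?set0I//.
  by apply: contra ij => /eqP /(@inj _ _ _ f) h; apply/eqP/h; rewrite inE.
have le_B N : \sum_(n < N) mu (H (f n) `&` B) <= mu B.
  rewrite -(measure_bigsetU mu (fun n => mHB n))//.
  apply: le_measure; rewrite ?inE//; first exact: bigsetU_measurable.
  rewrite -(bigcup_mkord N (fun n : nat => H (f n) `&` B)).
  by apply: bigcup_sub => n _; exact: subIsetr.
have muB0 : (0 <= fine (mu B) / e)%R by rewrite divr_ge0 ?fine_ge0// ltW.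
have := archi_boundP muB0; set N := Num.Def.archi_bound _ => Nlt.
have : mu B < mu B; last by rewrite ltxx.
apply: lt_le_trans (le_B N).
apply: (@lt_le_trans _ _ (\sum_(n < N) e%:E)); last by apply: lee_sum => n _; exact: fD.
rewrite sumEFin sumr_const card_ord -(fineK (x := mu B)); last by rewrite ge0_fin_numE.
by rewrite lte_fin -mulr_natl -ltr_pdivrMr.
Qed.

End disjoint_positive.

Section countable_positive.
Context (R : realType).
Local Notation lam := (@lebesgue_measure R).

Lemma disjoint_positive_countable (H : R -> set R) :
  (forall t, measurable (H t)) -> trivIset setT H ->
  countable [set t | lam (H t) != 0].
Proof.
move=> mH tH.
pose B (n : nat) : set R := `[(- n%:R)%R, n%:R%R]%classic.
have mB n : measurable (B n) by exact: measurable_itv.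
have Bfin n : lam (B n) < +oo.
  by rewrite lebesgue_measure_itv/=; case: ifP => _; rewrite -?EFinB ltry.
(* One index serves for the window and for the threshold, since the condition weakens when either
   grows. *)
pose D n := [set t | (n.+1%:R^-1)%:E <= lam (H t `&` B n)].
have Dc n : countable (D n).
  apply: finite_set_countable; apply: (@disjoint_large_finite _ _ _ lam R H (B n));
    [exact: mB|exact: Bfin|by rewrite invr_gt0|exact: mH|exact: tH].
have cD : countable (\bigcup_n D n) by apply: bigcup_countable => // n _; exact: Dc.
apply: sub_countable cD; apply: subset_card_le => t /= Ht; apply: contrapT => nD.
move/negP: Ht; apply; apply/eqP.
have HtE : H t = \bigcup_n (H t `&` B n).
  apply/seteqP; split => [x Hx|x [n _ []]//].
  have := archi_boundP (normr_ge0 x); set N := Num.Def.archi_bound _ => xN.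
  by exists N => //; split=> //; rewrite /B /= in_itv/= -ler_norml ltW.
suff N0 n : lam.-negligible (H t `&` B n).
  apply: measure_negligible; first exact: mH.
  by rewrite HtE; exact: negligible_bigcup.
have mHB l : measurable (H t `&` B l) by exact: measurableI.
apply/negligibleP; first exact: mHB.
apply/eqP; rewrite -measure_le0; apply/lee_addgt0Pr => e e0; rewrite add0e.
have [m _ hm] := near_infty_natSinv_lt (PosNum e0).
have {}hm := hm (maxn m n) (leq_maxl _ _).
apply: (@le_trans _ _ (lam (H t `&` B (maxn m n)))).
  apply: le_measure; rewrite ?inE; [exact: mHB|exact: mHB|].
  apply: setIS => x; rewrite /B /= !in_itv/= => /andP[h1 h2].
  have : (n%:R <= (maxn m n)%:R :> R)%R by rewrite ler_nat leq_maxr.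
  by move=> ?; apply/andP; split; lra.
apply: (@le_trans _ _ ((maxn m n).+1%:R^-1)%:E); last by rewrite lee_fin ltW.
by rewrite leNgt; apply/negP => /ltW h; apply: nD; exists (maxn m n).
Qed.

End countable_positive.

(** * Borel sets of row vectors and their slices *)

Section rV_measurable.
Context (R : realType).

Lemma rV_open_measurable d (A : set 'rV[R]_d) : open A -> measurable A.
Proof. exact: sub_sigma_algebra. Qed.

Lemma rV_closed_measurable d (A : set 'rV[R]_d) : closed A -> measurable A.
Proof.
move=> cA; rewrite -[A]setCK; apply: measurableC.
by apply: rV_open_measurable; exact: closed_openC.
Qed.

Lemma rV_set1_measurable d (x : 'rV[R]_d) : measurable [set x].
Proof.
apply: rV_closed_measurable; apply: accessible_closed_set1.
exact/hausdorff_accessible/norm_hausdorff.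
Qed.

Lemma rV_continuous (X : topologicalType) e (g : X -> 'rV[R]_e) :
  (forall j, continuous (fun x => g x 0%R j)) -> continuous g.
Proof.
move=> gc x A [P hP sPA].
have : \forall y \near x, forall j, P 0%R j (g y 0%R j).
  by apply: filter_forall => j; apply: gc; exact: hP.
by apply: filterS => y hy; apply: sPA => i j; rewrite (ord1 i).
Qed.

Lemma rV_continuous_measurable d e (g : 'rV[R]_d -> 'rV[R]_e) :
  continuous g -> measurable_fun setT g.
Proof.
move=> gc; apply: (@measurability _ _ _ _ _ _ (@open 'rV[R]_e)) => //.
move=> _ [A oA <-]; rewrite setTI; apply: rV_open_measurable.
by move/continuousP : gc; exact.
Qed.

Lemma R_rV_continuous_measurable e (g : R -> 'rV[R]_e) :
  continuous g -> measurable_fun setT g.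
Proof.
move=> gc; apply: (@measurability _ _ _ _ _ _ (@open 'rV[R]_e)) => //.
move=> _ [A oA <-]; rewrite setTI; apply: open_measurable.
by move/continuousP : gc; exact.
Qed.

Lemma coord_measurable d (i : 'I_d) : measurable_fun setT (fun x : 'rV[R]_d => x 0%R i).
Proof.
apply: (measurability _ (RGenOpens.measurableE R)) => _ [_ [a [b ->] <-]].
rewrite setTI; apply: rV_open_measurable.
have := @coord_continuous R 1 d 0%R i; move/continuousP; apply.
exact: interval_open.
Qed.

Lemma edist_measurable d :
  measurable_fun setT (fun p : 'rV[R]_d * 'rV[R]_d => Defs.edist p.1 p.2).
Proof.
apply: (@measurableT_comp _ _ _ _ _ _ (@Num.sqrt R)).
  by apply: continuous_measurable_fun => t; exact: sqrt_continuous.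
apply: measurable_sum => i; apply: measurable_funX; apply: measurable_funB.
  exact: measurableT_comp (coord_measurable i) measurable_fst.
exact: measurableT_comp (coord_measurable i) measurable_snd.
Qed.

Lemma row_mx_head (t : R) d (v : 'rV[R]_d) : row_mx (t%:M : 'rV[R]_1) v 0%R (@ord0 d) = t.
Proof.
have -> : ord0 = lshift d ord0 :> 'I_(1 + d) by apply: val_inj.
by rewrite row_mxEl mxE eqxx.
Qed.

Lemma row_mx_tail (t : R) d (v : 'rV[R]_d) j :
  row_mx (t%:M : 'rV[R]_1) v 0%R (lift ord0 j) = v 0%R j.
Proof.
have -> : lift ord0 j = rshift 1 j :> 'I_(1 + d) by apply: val_inj.
by rewrite row_mxEr.
Qed.

Lemma row_mx_measurable (t : R) d :
  measurable_fun setT (fun v : 'rV[R]_d => row_mx (t%:M : 'rV[R]_1) v : 'rV[R]_d.+1).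
Proof.
apply: rV_continuous_measurable; apply: rV_continuous => j.
case: (unliftP ord0 j) => [l ->|->].
  under eq_fun do rewrite row_mx_tail; exact: coord_continuous.
by under eq_fun do rewrite row_mx_head; exact: cst_continuous.
Qed.

Lemma row_mx_measurable_head d (v : 'rV[R]_d) :
  measurable_fun setT (fun t : R => row_mx (t%:M : 'rV[R]_1) v : 'rV[R]_d.+1).
Proof.
apply: R_rV_continuous_measurable; apply: rV_continuous => j.
case: (unliftP ord0 j) => [l ->|->].
  by under eq_fun do rewrite row_mx_tail; exact: cst_continuous.
by under eq_fun do rewrite row_mx_head.
Qed.

Definition slice d (A : set 'rV[R]_d.+1) (t : R) : set 'rV[R]_d :=
  [set v : 'rV[R]_d | A (row_mx (t%:M : 'rV[R]_1) v)].

Lemma measurable_slice d (A : set 'rV[R]_d.+1) t : measurable A -> measurable (slice A t).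
Proof.
move=> mA; rewrite -[X in measurable X]setTI.
exact: (@row_mx_measurable t d).
Qed.

End rV_measurable.

(** * Null sets through slices *)

Section lebesgue_null.
Context (R : realType).
Local Notation lam := (@lebesgue_measure R).

(** All subsets of a countable set are Borel, so the preimage of a measurable set, or its
    complement, lies in N and is Borel: f is measurable automatically. *)
Lemma countable_support_integral0 (f : R -> \bar R) (N : set R) :
  countable N -> (forall t, ~ N t -> f t = 0) -> \int[lam]_t f t = 0.
Proof.
move=> cN f0.
have mN (B : set R) : B `<=` N -> measurable B.
  move=> BN; apply: countable_measurable => [t|]; first exact: (@measurable_set1 R).
  exact: sub_countable (subset_card_le BN) cN.
have mf : measurable_fun setT f.
  move=> _ Y mY; rewrite setTI.
  have [Y0|Y0] := pselect (Y 0).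
    rewrite -[_ @^-1` _]setCK; apply: measurableC; apply: (mN) => t /= Yt.
    by apply: contrapT => Nt; apply: Yt; rewrite /= f0.
  by apply: (mN) => t /= Yt; apply: contrapT => Nt; apply: Y0; rewrite -(f0 t).
rewrite -(@integral0 _ _ _ lam setT); apply: ae_eq_integral => //.
exists N; split; first exact: (mN).
- exact: countable_lebesgue_measure0.
- by move=> t /= ht; apply: contrapT => Nt; apply: ht => _; rewrite f0.
Qed.

Lemma lebesgue_rV_null_slices d (A : set 'rV[R]_d.+1) (N : set R) :
  countable N -> (forall t, ~ N t -> lebesgue_rV (slice A t) = 0) ->
  lebesgue_rV A = 0.
Proof. by move=> cN A0; exact: countable_support_integral0 cN A0. Qed.

Definition sqdist d (x a : 'rV[R]_d) : R := (\sum_i (x 0 i - a 0 i) ^+ 2)%R.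
Definition tailv d (a : 'rV[R]_d.+1) : 'rV[R]_d := \row_j a 0%R (lift ord0 j).

Lemma sqdist_row_mx d t (v : 'rV[R]_d) (a : 'rV[R]_d.+1) :
  sqdist (row_mx (t%:M : 'rV[R]_1) v : 'rV[R]_d.+1) a =
  ((t - a 0 ord0) ^+ 2 + sqdist v (tailv a))%R.
Proof.
rewrite /sqdist big_ord_recl row_mx_head; congr (_ + _)%R.
by apply: eq_bigr => i _; rewrite row_mx_tail mxE.
Qed.

Lemma lebesgue_rV1 (A : set 'rV[R]_1) : measurable A ->
  lebesgue_rV A = lam [set t | A (row_mx (t%:M : 'rV[R]_1) (0 : 'rV[R]_0) : 'rV[R]_1)].
Proof.
move=> mA /=.
set B := [set t | _].
have mB : measurable B.
  by rewrite -[X in measurable X]setTI; exact: row_mx_measurable_head.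
rewrite -[X in _ = lam X](setIT B) -integral_indic//; apply: eq_integral => t _.
Qed.

(** Each slice is a set of the same kind in one dimension less, the square of the fixed coordinate
    moving into kappa. On the line this is [null_preimage_square]. *)
Lemma null_sphere_preimage d (E : set R) (kappa : R) (a : 'rV[R]_d.+1) (A : set 'rV[R]_d.+1) :
  measurable E -> lam E = 0 -> measurable A ->
  A `<=` [set x | E (kappa + sqdist x a)%R] -> lebesgue_rV A = 0.
Proof.
move=> mE E0; elim: d kappa a A => [|d ih] kappa a A mA AE.
  rewrite lebesgue_rV1//.
  have := null_preimage_square kappa (a 0%R ord0) mE E0.
  move=> h; apply/eqP; rewrite -measure_le0 -h; apply: le_measure; rewrite ?inE.
  - by rewrite -[X in measurable X]setTI; exact: row_mx_measurable_head.
  - rewrite -[X in measurable X]setTI.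
    by apply: measurable_funD => //; apply: measurable_funX; exact: measurable_funB.
  - move=> t /= /AE /=; rewrite sqdist_row_mx.
    by rewrite /sqdist big_ord0 addr0.
apply: (@lebesgue_rV_null_slices _ _ set0) => // t _.
apply: (ih (kappa + (t - a 0 ord0) ^+ 2)%R (tailv a)).
  exact: measurable_slice.
by move=> v /AE /=; rewrite sqdist_row_mx addrA.
Qed.

Lemma disjoint_slices_null d (H : R -> set R) (kappa : R -> R) (a : 'rV[R]_d.+1)
    (A : set 'rV[R]_d.+2) :
  (forall t, measurable (H t)) -> trivIset setT H -> measurable A ->
  (forall t, slice A t `<=` [set v | H t (kappa t + sqdist v a)%R]) ->
  lebesgue_rV A = 0.
Proof.
move=> mH tH mA AH.
apply: (lebesgue_rV_null_slices (disjoint_positive_countable mH tH)) => t /= Ht.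
apply: (null_sphere_preimage (mH t) _ _ (AH t)).
  by apply/eqP; apply: contrapT => /negP.
exact: measurable_slice.
Qed.

End lebesgue_null.

(** * Sets on which the squared distance determines a linear form *)

Section graph_null.
Context (R : realType).
Local Notation lam := (@lebesgue_measure R).
Variable D : set (R * R).
Hypotheses (mD : measurable D)
  (D_graph : forall u u' s, D (u, s) -> D (u', s) -> u = u').

Definition dotv d (e x : 'rV[R]_d) : R := (\sum_i e 0 i * x 0 i)%R.

Lemma dotv_row_mx d t (v : 'rV[R]_d) (e : 'rV[R]_d.+1) :
  dotv e (row_mx (t%:M : 'rV[R]_1) v : 'rV[R]_d.+1) = (e 0 ord0 * t + dotv (tailv e) v)%R.
Proof.
rewrite /dotv big_ord_recl row_mx_head; congr (_ + _)%R.
by apply: eq_bigr => i _; rewrite row_mx_tail mxE.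
Qed.

Lemma countableU (T : Type) (P Q : set T) : countable P -> countable Q -> countable (P `|` Q).
Proof.
move=> cP cQ; rewrite (_ : P `|` Q = \bigcup_(i in [set: bool]) (if i then P else Q)).
  by apply: bigcup_countable => // -[].
apply/seteqP; split => [x [Px|Qx]|x [[] _ xI]]; [by exists true|by exists false|by left|by right].
Qed.

Section plane.
Variables (e1 e2 b kappa a1 a2 : R).
Hypothesis e2_neq0 : (e2 != 0)%R.

(** Up to the factor |e|, the signed distance to the line through a spanned by e. *)
Let height t y : R := (e1 * (y - a2) - e2 * (t - a1))%R.
Let cut t s : R := (s - kappa - (t - a1) ^+ 2)%R.

(** The values s of kappa + |x - a|^2 taken by points x = (t, y) satisfying the constraint [D] in
    one of four regions: ta is the sign of y - a2, recovered from s by a square root, and sg the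
    sign of the height. *)
Let H (sg ta : R) t : set R := [set s | [/\ (0 < cut t s)%R,
  (0 < sg * height t (a2 + ta * Num.sqrt (cut t s)))%R &
  D (e1 * t + e2 * (a2 + ta * Num.sqrt (cut t s)) + b, s)%R]].

Let mcut t : measurable_fun setT (cut t).
Proof. by apply: measurable_funB => //; exact: measurable_funB. Qed.

Let my ta t : measurable_fun setT (fun s => a2 + ta * Num.sqrt (cut t s))%R.
Proof.
apply: measurable_funD => //; apply: measurable_funM => //.
apply: measurableT_comp (mcut t).
by apply: continuous_measurable_fun => s; exact: sqrt_continuous.
Qed.

Let mpos (g : R -> R) : measurable_fun setT g -> measurable [set s | (0 < g s)%R].
Proof.
move=> mg; rewrite (_ : [set s | _] = g @^-1` `]0%R, +oo[).
  by rewrite -[X in measurable X]setTI; exact: mg.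
by apply/seteqP; split => s /=; rewrite in_itv/= andbT.
Qed.

Let mH sg ta t : measurable (H sg ta t).
Proof.
rewrite (_ : H sg ta t = [set s | (0 < cut t s)%R] `&`
  [set s | (0 < sg * height t (a2 + ta * Num.sqrt (cut t s)))%R] `&`
  [set s | D (e1 * t + e2 * (a2 + ta * Num.sqrt (cut t s)) + b, s)%R]); last first.
  by apply/seteqP; split => s [] // [].
apply: measurableI; first apply: measurableI.
- exact: mpos.
- apply: mpos; apply: measurable_funM => //; apply: measurable_funB => //.
  by apply: measurable_funM => //; apply: measurable_funB.
- rewrite -[X in measurable X]setTI.
  apply: (_ : measurable_fun setT (fun s : R =>
    (e1 * t + e2 * (a2 + ta * Num.sqrt (cut t s)) + b, s)%R)) => //.
  apply: measurable_fun_pair => //; apply: measurable_funD => //.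
  by apply: measurable_funD => //; apply: measurable_funM.
Qed.

(* Off the line through a spanned by e, on which the height vanishes, the values
   of e . x and |x - a|^2 together with the sign of the height determine x. *)
Let tH sg ta : (sg ^+ 2 = 1)%R -> (ta ^+ 2 = 1)%R -> trivIset setT (H sg ta).
Proof.
move=> sg2 ta2 t t' _ _ [s []] [c0 h0 d0] [c0' h0' d0'].
have := D_graph d0 d0'.
have sq : ((ta * Num.sqrt (cut t s)) ^+ 2 = cut t s)%R.
  by rewrite exprMn ta2 mul1r sqr_sqrtr// ltW.
have sq' : ((ta * Num.sqrt (cut t' s)) ^+ 2 = cut t' s)%R.
  by rewrite exprMn ta2 mul1r sqr_sqrtr// ltW.
move: h0 h0' sq sq'.
move: (ta * Num.sqrt (cut t s))%R (ta * Num.sqrt (cut t' s))%R => y y'.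
rewrite /height /cut => h0 h0' sq sq' E.
set f := (e1 * (a2 + y - a2) - e2 * (t - a1))%R in h0.
set f' := (e1 * (a2 + y' - a2) - e2 * (t' - a1))%R in h0'.
have ex : (e1 * (t - a1) + e2 * y = e1 * (t' - a1) + e2 * y')%R by lra.
have r2 : ((t - a1) ^+ 2 + y ^+ 2 = (t' - a1) ^+ 2 + y' ^+ 2)%R by lra.
have ff : (f ^+ 2 = f' ^+ 2)%R.
  have fE : (f ^+ 2 = (e1 ^+ 2 + e2 ^+ 2) * ((t - a1) ^+ 2 + y ^+ 2)
    - (e1 * (t - a1) + e2 * y) ^+ 2)%R by rewrite /f; ring.
  have fE' : (f' ^+ 2 = (e1 ^+ 2 + e2 ^+ 2) * ((t' - a1) ^+ 2 + y' ^+ 2)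
    - (e1 * (t' - a1) + e2 * y') ^+ 2)%R by rewrite /f'; ring.
  by rewrite fE fE' ex r2.
have {}ff : (f = f')%R.
  have : (sg * f = sg * f')%R.
    by apply/eqP; rewrite -(@eqrXn2 _ 2) ?ltW// !exprMn ff.
  have : (sg != 0)%R by apply/negP => /eqP sg0; move: sg2; rewrite sg0 expr0n/= => /eqP; rewrite eq_sym oner_eq0.
  by move=> sg0 /(mulfI sg0).
have e0 : (e1 ^+ 2 + e2 ^+ 2 != 0)%R.
  by rewrite gt_eqF// ltr_wpDl ?sqr_ge0// exprn_even_gt0.
suff : ((e1 ^+ 2 + e2 ^+ 2) * (t - a1) = (e1 ^+ 2 + e2 ^+ 2) * (t' - a1))%R.
  by move/(mulfI e0); lra.
have -> : ((e1 ^+ 2 + e2 ^+ 2) * (t - a1) = e1 * (e1 * (t - a1) + e2 * y) - e2 * f)%R.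
  by rewrite /f; ring.
by rewrite ex ff /f'; ring.
Qed.

Lemma plane_graph_null_sections (B : R -> set R) : (forall t, measurable (B t)) ->
  (forall t y, B t y -> D (e1 * t + e2 * y + b, kappa + ((t - a1) ^+ 2 + (y - a2) ^+ 2))%R) ->
  exists2 N : set R, countable N & forall t, ~ N t -> lam (B t) = 0.
Proof.
move=> mB BD.
pose Nc sg ta := [set t | lam (H sg ta t) != 0].
have cN sg ta : (sg ^+ 2 = 1)%R -> (ta ^+ 2 = 1)%R -> countable (Nc sg ta).
  by move=> sg2 ta2; exact: disjoint_positive_countable (mH sg ta) (tH sg2 ta2).
(* The value t = a1 is excluded because for e1 = 0 the height vanishes on that whole line. For other
   t, the points with y = a2 or height 0 number at most two. *)
exists ([set a1] `|` ((Nc 1 1 `|` Nc 1 (-1)) `|` (Nc (-1) 1 `|` Nc (-1) (-1))))%R.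
  apply: countableU; first exact: finite_set_countable.
  by apply: countableU; apply: countableU; apply: cN; rewrite ?sqrrN expr1n.
move=> t /not_orP[/eqP ta1 /not_orP[/not_orP[n1 n2] /not_orP[n3 n4]]].
pose S sg ta := [set y | H sg ta t (kappa + (t - a1) ^+ 2 + (y - a2) ^+ 2)%R].
have Sn sg ta : ~ Nc sg ta t -> lam.-negligible (S sg ta).
  move=> /negP; rewrite negbK => /eqP H0; apply/negligibleP.
    rewrite -[X in measurable X]setTI.
    apply: (_ : measurable_fun setT (fun y : R => kappa + (t - a1) ^+ 2 + (y - a2) ^+ 2)%R) => //.
    by apply: measurable_funD => //; apply: measurable_funX; exact: measurable_funB.
  exact: (null_preimage_square _ _ (mH sg ta t) H0).
apply: measure_negligible; first exact: mB.
have : lam.-negligible ([set a2] `|` ([set a2 + e2 * (t - a1) / e1]%R `|`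
    ((S 1 1 `|` S 1 (-1)) `|` (S (-1) 1 `|` S (-1) (-1)))))%R.
  apply: negligibleU; last apply: negligibleU.
  - by apply/negligibleP => //; exact: lebesgue_measure_set1.
  - by apply/negligibleP => //; exact: lebesgue_measure_set1.
  - by apply: negligibleU; apply: negligibleU; exact: Sn.
apply: negligibleS => y By.
have [->|ya] := eqVneq y a2; [by left|right].
have [h0|h0] := eqVneq (height t y) 0%R.
  left => /=; have [e10|e10] := eqVneq e1 0%R.
    move: h0; rewrite /height e10 mul0r sub0r => /eqP; rewrite oppr_eq0 mulf_eq0 (negbTE e2_neq0)/=.
    by rewrite subr_eq0 (negbTE ta1).
  by rewrite -[y in LHS](subrK a2) addrC; congr (_ + _)%R; apply: (mulfI e10); rewrite mulrCA divff// mulr1; move: h0; rewrite /height; lra.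
right.
have Sy sg ta : (0 < ta * (y - a2))%R -> (ta ^+ 2 = 1)%R -> (0 < sg * height t y)%R -> S sg ta y.
  move=> ta0 ta2 sg0; rewrite /S /H /=.
  have -> : cut t (kappa + (t - a1) ^+ 2 + (y - a2) ^+ 2) = ((ta * (y - a2)) ^+ 2)%R.
    by rewrite exprMn ta2 mul1r /cut; ring.
  rewrite sqrtr_sqr gtr0_norm// mulrA -expr2 ta2 mul1r subrKC.
  by split; [rewrite exprn_gt0|exact: sg0|rewrite -[X in D (_, X)]addrA; exact: BD].
have := ya; rewrite neq_lt => /orP[y1|y1]; have := h0; rewrite neq_lt => /orP[f1|f1].
- by right; right; apply: Sy; rewrite ?sqrrN ?expr1n//; lra.
- by left; right; apply: Sy; rewrite ?sqrrN ?expr1n//; lra.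
- by right; left; apply: Sy; rewrite ?sqrrN ?expr1n//; lra.
- by left; left; apply: Sy; rewrite ?sqrrN ?expr1n//; lra.
Qed.

End plane.

(** Slicing keeps the form of the constraint: e . x loses a coordinate to b and |x - a|^2 one to
    kappa. The induction goes down to the plane as long as the tail of e is nonzero; otherwise
    disjointness is immediate. *)
Lemma graph_null d (e a : 'rV[R]_d.+2) (b kappa : R) (A : set 'rV[R]_d.+2) :
  (e != 0)%R -> measurable A ->
  A `<=` [set x | D (dotv e x + b, kappa + sqdist x a)%R] -> lebesgue_rV A = 0.
Proof.
elim: d e a b kappa A => [|d ih] e a b kappa A e0 mA AD.
all: have [e'0|e'0] := eqVneq (tailv e) 0%R.
1,3: have e10 : (e 0 ord0 != 0)%R.
1,3: apply: contra e0 => /eqP e10; apply/eqP/rowP => j; rewrite mxE.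
1,2: by case: (unliftP ord0 j) => [l ->|->//]; move/rowP : e'0 => /(_ l); rewrite !mxE.
(* Here e . x depends on the first coordinate alone, so a value s in D fixes t and the level sets of
   different slices are disjoint. *)
1,2: apply: (@disjoint_slices_null _ _ (fun t => [set s | D (e 0 ord0 * t + b, s)%R])
       (fun t => kappa + (t - a 0 ord0) ^+ 2)%R (tailv a)) => //.
1,4: by move=> t; rewrite -[X in measurable X]setTI;
  apply: (_ : measurable_fun setT (fun s : R => (e 0 ord0 * t + b, s)%R)) => //;
  apply: measurable_fun_pair.
1,3: by move=> t t' _ _ [s [/= h1 h2]]; apply: (mulfI e10); have := D_graph h1 h2; lra.
1,2: move=> t v /AD /=; rewrite dotv_row_mx sqdist_row_mx e'0 addrA /dotv big1 ?addr0//.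
1,2: by move=> i _; rewrite mxE mul0r.
- have e20 : (tailv e 0 ord0 != 0)%R.
    by apply: contra e'0 => /eqP h; apply/eqP/rowP => j; rewrite ord1 h mxE.
  have mB t : measurable [set y | slice A t (row_mx (y%:M : 'rV[R]_1) (0 : 'rV[R]_0) : 'rV[R]_1)].
    by rewrite -[X in measurable X]setTI; apply: row_mx_measurable_head => //; exact: measurable_slice.
  have [|N cN NB] := @plane_graph_null_sections (e 0 ord0)%R (tailv e 0 ord0)%R b kappa
    (a 0 ord0)%R (tailv a 0 ord0)%R e20 _ mB.
    move=> t y /AD /=; rewrite dotv_row_mx sqdist_row_mx dotv_row_mx sqdist_row_mx.
    by rewrite /dotv /sqdist !big_ord0 !addr0.
  apply: (lebesgue_rV_null_slices cN) => t /NB; rewrite lebesgue_rV1//.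
  exact: measurable_slice.
- apply: (@lebesgue_rV_null_slices _ _ _ set0) => // t _.
  apply: (ih (tailv e) (tailv a) (e 0 ord0 * t + b)%R (kappa + (t - a 0 ord0) ^+ 2)%R) => //.
    exact: measurable_slice.
  move=> v /AD /=; rewrite dotv_row_mx sqdist_row_mx addrA.
  by rewrite (addrC (e 0 ord0 * t)%R) -(addrA (dotv _ _)).
Qed.

End graph_null.

(** * Radial costs *)

Section radial_cells.
Context (R : realType).
Variables (l : R -> \bar R) (lP : radial_profile l).

(** The profile is monotone on nonnegative reals only; extended by l 0 it is monotone on the line,
    hence Borel. *)
Definition profile_ext (r : R) : \bar R := l (Num.max 0 r)%R.

Lemma profile_extE r : (0 <= r)%R -> profile_ext r = l r.
Proof. by move=> r0; rewrite /profile_ext (max_idPr r0). Qed.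

Lemma profile_ext_measurable : measurable_fun setT profile_ext.
Proof.
apply: (measurability _ (ErealGenOInfty.measurableE R)) => _ [_ [y ->] <-].
rewrite setTI; apply: is_interval_measurable => a b /=.
rewrite !in_itv/= !andbT => ya yb z /andP[az zb].
rewrite in_itv/= andbT; apply: lt_le_trans ya _; apply: (profile_nondecreasing lP).
by rewrite le_max lexx/= ge_max !le_max lexx/= az orbT.
Qed.

Lemma profile_inj r s : (0 <= r)%R -> (0 <= s)%R -> l r = l s -> l r < +oo -> r = s.
Proof.
move=> r0 s0 rs ry; have [h|h|//] := ltgtP r s.
  have : l r < l s by apply: (profile_increasing lP); rewrite -?rs// r0 h.
  by rewrite rs ltxx.
have : l s < l r by apply: (profile_increasing lP); rewrite ?s0 ?h.
by rewrite rs ltxx.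
Qed.

Lemma edist_ge0 d (x y : 'rV[R]_d) : (0 <= Defs.edist x y)%R.
Proof. exact: sqrtr_ge0. Qed.

Lemma edistE d (x y : 'rV[R]_d) : Defs.edist x y = Num.sqrt (sqdist x y).
Proof. by []. Qed.

Lemma sqdist_ge0 d (x y : 'rV[R]_d) : (0 <= sqdist x y)%R.
Proof. by apply: sumr_ge0 => i _; exact: sqr_ge0. Qed.

Definition radial_cost d (p : 'rV[R]_d * 'rV[R]_d) : \bar R := l (Defs.edist p.1 p.2).

Lemma radial_cost_measurable d : measurable_fun setT (@radial_cost d).
Proof.
rewrite (_ : @radial_cost d = profile_ext \o (fun p => Defs.edist p.1 p.2)).
  exact: measurableT_comp profile_ext_measurable (@edist_measurable R d).
by apply/funext => p /=; rewrite profile_extE// edist_ge0.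
Qed.

Lemma radial_cost_ge0 d (p : 'rV[R]_d * 'rV[R]_d) : 0 <= radial_cost p.
Proof. by apply: (profile_ge0 lP); exact: edist_ge0. Qed.

(** Here s stands for |x - xs i|^2 and u for |x - xs j|^2 - |x - xs i|^2, which is affine in x with
    linear part 2 (xs i - xs j); p and q are the weights of the two cells. *)
Definition tie (p q : R) : set (R * R) := [set us |
  [/\ (0 <= us.2)%R, (0 <= us.2 + us.1)%R,
      profile_ext (Num.sqrt us.2) < +oo, profile_ext (Num.sqrt (us.2 + us.1)) < +oo &
      (fine (profile_ext (Num.sqrt us.2)) - p = fine (profile_ext (Num.sqrt (us.2 + us.1))) - q)%R]].

Lemma tie_measurable p q : measurable (tie p q).
Proof.
have ms : measurable_fun setT (fun us : R * R => us.2 + us.1)%R.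
  exact: measurable_funD measurable_snd measurable_fst.
have mr (f : R * R -> R) : measurable_fun setT f ->
    measurable_fun setT (fun us => profile_ext (Num.sqrt (f us))).
  move=> mf; apply: measurableT_comp profile_ext_measurable _.
  apply: measurableT_comp mf.
  by apply: continuous_measurable_fun => s; exact: sqrt_continuous.
have m2 := mr _ measurable_snd.
have m3 := mr _ ms.
rewrite (_ : tie p q = [set us | (0 <= us.2)%R] `&` [set us | (0 <= us.2 + us.1)%R]
  `&` ([set us | profile_ext (Num.sqrt us.2) < +oo] `&`
       [set us | profile_ext (Num.sqrt (us.2 + us.1)) < +oo]) `&`
  (fun us => fine (profile_ext (Num.sqrt us.2)) - p -
    (fine (profile_ext (Num.sqrt (us.2 + us.1))) - q))%R @^-1` [set 0%R]); last first.
  apply/seteqP; split => us /=.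
    by move=> [? ? ? ? ->]; rewrite subrr.
  by move=> [[[? ?] [? ?]] /eqP]; rewrite subr_eq0 => /eqP ?; split.
have mge (f : R * R -> R) : measurable_fun setT f -> measurable [set us | (0 <= f us)%R].
  move=> mf; rewrite (_ : [set us | _] = f @^-1` `[0%R, +oo[).
    by rewrite -[X in measurable X]setTI; exact: mf.
  by apply/seteqP; split => us /=; rewrite in_itv/= andbT.
have mlt (f : R * R -> \bar R) : measurable_fun setT f -> measurable [set us | f us < +oo].
  by move=> mf; rewrite -[X in measurable X]setTI; exact: emeasurable_fun_infty_o.
apply: measurableI; first apply: measurableI; first apply: measurableI.
- exact: mge measurable_snd.
- exact: mge ms.
- by apply: measurableI; exact: mlt.
- rewrite -[X in measurable X]setTI.
  apply: measurable_funB => //; first by apply: measurable_funB => //; exact: measurableT_comp.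
    by apply: measurable_funB => //; exact: measurableT_comp.
Qed.

(** The value s fixes the cost to [xs i], the tie then fixes the cost to [xs j], and strict
    monotonicity where l is finite recovers the distance. *)
Lemma tie_graph p q u u' s : tie p q (u, s) -> tie p q (u', s) -> u = u'.
Proof.
move=> [/= s0 su sy suy E1] [/= _ su' _ suy' E2].
have : profile_ext (Num.sqrt (s + u)) = profile_ext (Num.sqrt (s + u')).
  have fin r : profile_ext r < +oo -> profile_ext r = (fine (profile_ext r))%:E.
    move=> ry; rewrite fineK// ge0_fin_numE//.
    by apply: (profile_ge0 lP); rewrite le_max lexx.
  by rewrite (fin _ suy) (fin _ suy'); congr EFin; lra.
rewrite !profile_extE ?sqrtr_ge0// => h.
have := profile_inj (sqrtr_ge0 _) (sqrtr_ge0 _) h.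
rewrite -profile_extE ?sqrtr_ge0// => /(_ suy) h2.
have : (s + u = s + u')%R by rewrite -(sqr_sqrtr su) -(sqr_sqrtr su') h2.
lra.
Qed.

Section overlap.
Variables (d M : nat) (xs : 'I_M -> 'rV[R]_d) (w : 'I_M -> R).
Let k i x := radial_cost (x, xs i).

Lemma radial_cost_point_measurable i : measurable_fun setT (k i).
Proof.
rewrite (_ : k i = @radial_cost d \o (fun x => (x, xs i))) //.
apply: measurableT_comp; first exact: radial_cost_measurable.
by apply: measurable_fun_pair.
Qed.

Lemma overlap_tie i j x : cell k w i x -> cell k w j x ->
  tie (w i) (w j) (dotv (2 *: (xs i - xs j)) x
    + (\sum_a (xs j 0 a ^+ 2 - xs i 0 a ^+ 2)), sqdist x (xs i))%R.
Proof.
move=> [iy ile] [jy jle].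
have sE : (sqdist x (xs i) + (dotv (2 *: (xs i - xs j)) x
    + \sum_a (xs j 0 a ^+ 2 - xs i 0 a ^+ 2)) = sqdist x (xs j))%R.
  rewrite /sqdist /dotv -!big_split/=; apply: eq_bigr => a _.
  by rewrite !mxE; ring.
have E : k i x - (w i)%:E = k j x - (w j)%:E by apply/eqP; rewrite eq_le ile jle.
have kfin t : k t x < +oo -> k t x \is a fin_num.
  by move=> ty; rewrite ge0_fin_numE//; exact: radial_cost_ge0.
split => /=; rewrite ?sE ?sqdist_ge0// -edistE profile_extE ?edist_ge0//.
move: E; rewrite -(fineK (kfin _ iy)) -(fineK (kfin _ jy)) -!EFinB => -[].
by rewrite -edistE profile_extE ?edist_ge0.
Qed.

End overlap.

Lemma radial_overlap_null d M (xs : 'I_M -> 'rV[R]_d.+2) (w : 'I_M -> R) i j A :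
  injective xs -> i != j -> measurable A ->
  A `<=` cell (fun a x => radial_cost (x, xs a)) w i `&`
         cell (fun a x => radial_cost (x, xs a)) w j ->
  lebesgue_rV A = 0.
Proof.
move=> xinj ij mA AO.
apply: (@graph_null R _ (tie_measurable (w i) (w j)) (@tie_graph (w i) (w j)) _
  (2 *: (xs i - xs j)) (xs i) (\sum_a (xs j 0 a ^+ 2 - xs i 0 a ^+ 2)) 0)%R => //.
  rewrite scaler_eq0 negb_or pnatr_eq0/= subr_eq0.
  by apply: contra ij => /eqP/xinj ->.
by move=> x /AO[xi xj] /=; rewrite add0r; exact: overlap_tie.
Qed.

End radial_cells.

Lemma integral_restrict_full d (T : measurableType d) (R : realType)
    (mu : {measure set T -> \bar R}) (D Omega : set T) (f : T -> \bar R) :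
  measurable D -> measurable Omega -> mu (~` Omega) = 0 -> measurable_fun setT f ->
  \int[mu]_(x in Omega `&` D) f x = \int[mu]_(x in D) f x.
Proof.
move=> mD mO O0 mf.
have part (g : T -> \bar R) : measurable_fun setT g -> (forall x, 0 <= g x) ->
    \int[mu]_(x in Omega `&` D) g x = \int[mu]_(x in D) g x.
  move=> mg g0; rewrite [RHS](@ge0_negligible_integral _ _ _ mu _ (~` Omega))//.
  - by congr (integral _ _ _); rewrite setDE setCK setIC.
  - exact: measurableC.
  - exact: measurable_funTS.
rewrite [LHS]integralE [RHS]integralE; congr (_ - _); apply: part.
- exact: measurable_funepos.
- by move=> x; exact: funepos_ge0.
- exact: measurable_funeneg.
- by move=> x; exact: funeneg_ge0.
Qed.

Lemma measure_concentrated d (T : measurableType d) (R : realType)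
    (mu : {measure set T -> \bar R}) (Omega A : set T) :
  measurable Omega -> measurable A -> concentrated_on Omega mu ->
  mu (Omega `&` A) = mu A.
Proof.
move=> mO mA O0; rewrite [RHS](measureDI mu mA mO) setIC [X in X + _](_ : _ = 0) ?add0e//.
apply/eqP; rewrite -measure_le0 -[leRHS]O0.
by apply: le_measure; rewrite ?inE; [exact: measurableD|exact: measurableC|move=> x []].
Qed.

(** Domination by [lebesgue_rV] tests every measurable subset A of the overlap. In dimension 0 two
    distinct atoms cannot exist; in dimension 1, A inherits nullity from B; beyond, the graph
    argument applies. *)
Lemma radial_overlap_null_subset (R : realType) d M (l : R -> \bar R)
    (xs : 'I_M -> 'rV[R]_d) (w : 'I_M -> R) i j (A B : set 'rV[R]_d) :
  radial_profile l -> injective xs -> i != j -> measurable A -> measurable B ->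
  A `<=` B -> (d = 1%N -> lebesgue_rV B = 0) ->
  A `<=` cell (fun a x => radial_cost l (x, xs a)) w i `&`
         cell (fun a x => radial_cost l (x, xs a)) w j ->
  lebesgue_rV A = 0.
Proof.
case: d xs A B => [|[|d]] xs A B lP xinj ij mA mB AB B0 AO.
- by move: ij; rewrite (xinj i j) ?eqxx// [LHS]thinmx0 [RHS]thinmx0.
- have {}B0 := B0 erefl; move: B0; rewrite !lebesgue_rV1// => B0.
  apply/eqP; rewrite -measure_le0 -[leRHS]B0.
  apply: le_measure; rewrite ?inE; last by move=> t /AB.
    by rewrite -[X in measurable X]setTI; exact: row_mx_measurable_head.
  by rewrite -[X in measurable X]setTI; exact: row_mx_measurable_head.
- by apply: (radial_overlap_null lP xinj ij mA (w := w)); exact: AO.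
Qed.

(** * Laguerre cells of a radial cost *)

Section radial_transport.
Context (R : realType) (d M : nat).
Local Notation V := 'rV[R]_d.
Variables (Omega : set V) (c : V -> V -> \bar R) (l : R -> \bar R).
Variables (F : R -> \bar R) (mu : {finite_measure set V -> \bar R}).
Variables (m : 'I_M -> R) (xs : 'I_M -> V).
Hypotheses (mOmega : measurable Omega) (lP : radial_profile l)
  (cE : forall x y, Omega x -> Omega y -> c x y = l (Defs.edist x y))
  (FE : marginal_entropy F) (mu_Omega : concentrated_on Omega mu)
  (xs_Omega : forall i, Omega (xs i)).

Let k i x := radial_cost l (x, xs i).

Lemma laguerre_cellE w i : laguerre_cell Omega c xs w i = Omega `&` cell k (w 0%R) i.
Proof.
apply/seteqP; split => x /=.
  by move=> [Ox iy ile]; split=> //; split=> [|j]; [move: iy|move: (ile j)]; rewrite !cE.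
by move=> [Ox [iy ile]]; split=> // [|j]; [move: iy|move: (ile j)]; rewrite !cE.
Qed.

Lemma residual_setE : residual_set Omega c xs = Omega `&` uncovered k.
Proof.
by apply/seteqP; split => x /= [Ox xi]; split=> // i; move: (xi i); rewrite /k /radial_cost cE.
Qed.

Let mk := radial_cost_point_measurable lP xs.

Lemma dual_objectiveE w : dual_objective Omega c F xs m mu w = dual_value mu F k m (w 0%R).
Proof.
rewrite /dual_objective /dual_value residual_setE; congr (- _ + _ * _).
  apply: eq_bigr => i _; congr (_ + _); rewrite laguerre_cellE.
  rewrite -[RHS](integral_restrict_full (Omega := Omega)) //.
  - by apply: eq_integral => x; rewrite inE => -[Ox _]; rewrite cE.
  - exact: measurable_cell.
  - under eq_fun do rewrite (conjugateE FE).
    apply/measurable_EFinP; apply: measurableT_comp (conj_fin_measurable FE) _.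
    by apply: measurable_funD => //; apply: measurableT_comp => //; exact: measurableT_comp (mk i).
by rewrite measure_concentrated//; exact: measurable_uncovered.
Qed.

Lemma radial_cells_null (xs_inj : injective xs) (mu_ac : mu `<< @lebesgue_rV R d)
    (cells_d1 : d = 1%N -> forall (w : 'rV[R]_M) (i j : 'I_M), i != j ->
       lebesgue_rV (laguerre_cell Omega c xs w i `&` laguerre_cell Omega c xs w j) = 0) :
  forall (w : 'I_M -> R) i j, i != j -> mu (cell k w i `&` cell k w j) = 0.
Proof.
move=> w i j ij; set O := _ `&` _.
have mO : measurable O by apply: measurableI; exact: measurable_cell.
(* The cells of k extend outside [Omega], whereas [cells_d1] concerns Laguerre cells, which lie
   inside. *)
rewrite -(measure_concentrated mOmega mO mu_Omega).
have mOO : measurable (Omega `&` O) by exact: measurableI.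
apply: (mu_ac (Omega `&` O)) => // A mA AO.
apply: (radial_overlap_null_subset (w := w) lP xs_inj ij mA mOO AO) => [d1|x /AO[_]//].
have := cells_d1 d1 (\row_a w a)%R i j ij; rewrite !laguerre_cellE setIACA setIid.
by rewrite (_ : (\row_a w a)%R 0%R = w)//; apply/funext => a; rewrite mxE.
Qed.

End radial_transport.

Theorem theorem3p1 (R : realType) (d : nat) (U : set 'rV[R]_d)
  (Omega := closure U)
  (F : R -> \bar R) (c : 'rV[R]_d -> 'rV[R]_d -> \bar R)
  (mu nu : {finite_measure set 'rV[R]_d -> \bar R})
  (M : nat) (m : 'I_M -> R) (xs : 'I_M -> 'rV[R]_d)
  (U_open : open U)
  (F_entropy : marginal_entropy F)
  (c_cost : cost Omega c)
  (c_radial : radial Omega c)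
  (mu_Omega : concentrated_on Omega mu)
  (nu_Omega : concentrated_on Omega nu)
  (mu_ac : mu `<< @lebesgue_rV R d)
  (nuE : forall A, measurable A -> nu A = \sum_(i < M) (m i)%:E * \d_(xs i) A)
  (m_gt0 : forall i, (0 < m i)%R)
  (xs_Omega : forall i, Omega (xs i))
  (xs_inj : injective xs)
  (* On the line two cells may overlap in positive measure, e.g. for the cost
     |x - y| when w_i - w_j = |x_i - x_j|, and the formula then fails. *)
  (cells_d1 : d = 1%N -> forall (w : 'rV[R]_M) (i j : 'I_M), i != j ->
     lebesgue_rV (laguerre_cell Omega c xs w i `&` laguerre_cell Omega c xs w j)
       = 0)
  (G := dual_objective Omega c F xs m mu) :
  [/\ forall w, -oo < G w,
      unbalanced_transport Omega c F mu nu = ereal_sup (range G)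
    & ereal_concave G].
Proof.
have [l lP cE] := c_radial.
have mO : measurable Omega by apply: rV_closed_measurable; exact: closed_closure.
pose k i x := radial_cost l (x, xs i).
have mk : forall i, measurable_fun setT (k i) := radial_cost_point_measurable lP xs.
have k0 i x : 0 <= k i x by exact: radial_cost_ge0.
have GE w : G w = dual_value mu F k m (w 0%R) by exact: dual_objectiveE.
have ties : forall w i j, i != j -> mu (cell k w i `&` cell k w j) = 0.
  exact: (radial_cells_null mO lP cE).
split => [w||t a b t01].
- by rewrite GE; exact: (dual_value_gtNy F_entropy mk k0 m_gt0 ties).
- rewrite (@unbalanced_transport_densities R d Omega c (@radial_cost R l d) F mu nu M m xs) //.
  + rewrite (semidiscrete_duality F_entropy mk k0 m_gt0 ties); congr ereal_sup.
    apply/seteqP; split => _ [w _ <-].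
      exists (\row_i w i)%R => //; rewrite GE; congr dual_value.
      by apply/funext => i; rewrite mxE.
    by exists (w 0%R) => //; rewrite GE.
  + by move=> i; exact: rV_set1_measurable.
  + exact: radial_cost_measurable.
  + by move=> p; exact: radial_cost_ge0.
  + by move=> x y Ox Oy; rewrite cE.
- rewrite !GE; apply: le_trans (dual_value_concave F_entropy mk k0 m_gt0 ties (a 0%R) (b 0%R) t01) _.
  rewrite (_ : (t *: a + (1 - t) *: b)%R 0%R = fun i => (t * a 0 i + (1 - t) * b 0 i)%R) //.
  by apply/funext => i; rewrite !mxE.
Qed.
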